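(* Let $G=(\Lambda,E)$ be a finite connected undirected graph without self-loops, endowed with edge weights $W_{ij}=W_{ji}>0$ for $\{i,j\}\in E$, and set $W_{ij}=0$ if $\{i,j\}\notin E$ (in particular $W_{ii}=0$). Partition $\Lambda=I\cup J$, $I\cap J=\emptyset$, with $|J|\ge 2$, and let $\rho\in J$. Let $(X,T)$ be the vrjp in exchangeable time scale on $\Lambda$ started at $\rho$ with weights $W$. For $\beta_I\in\mathbb{R}^I$ define the $J\times J$ matrices $$W^J(\beta_I):=W_{JJ}+W_{JI}([H^W_\beta]_{II})^{-1}W_{IJ},\qquad W^{J\neq}(\beta_I):=\big(W^J_{ij}(\beta_I)1_{\{i\neq j\}}\big)_{i,j\in J},$$ and define $\widehat W\in\mathbb{R}^{(I\cup\{\rho\})\times(I\cup\{\rho\})}$ by $\widehat W_{ij}=W_{ij}$ for $i,j\in I$, $\widehat W_{i\rho}=\widehat W_{\rho i}=\sum_{k\in J}W_{ik}$ for $i\in I$, and $\widehat W_{\rho\rho}=0$. Then the restrictions $(X^J,T^J)$ and $(X^{J\neq},T^{J\neq})$ are mixtures of vrjps in exchangeable time scale on $J$ with random weights $W^J(\beta_I)$ and $W^{J\neq}(\beta_I)$ respectively, where $\beta_I$ is the restriction to $I$ of a random vector $\beta_{I\cup\{\rho\}}$ with law $\nu^{\widehat W}_{I\cup\{\rho\}}$. Precisely, for every measurable $A\subseteq J^{\mathbb{N}_0}\times(0,\infty)^{\mathbb{N}_0}$, $$P_\rho^{W,\Lambda}((X^{J\neq},T^{J\neq})\in A)=\int_{\mathbb{R}^{I\cup\{\rho\}}}P_\rho^{W^{J\neq}(\beta_I),J}((X,T)\in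 A)\,\nu^{\widehat W}_{I\cup\{\rho\}}(d\beta_{I\cup\{\rho\}})=\int_{\mathbb{R}^\Lambda}P_\rho^{W^{J\neq}(\beta_I),J}((X,T)\in A)\,\nu^W_\Lambda(d\beta_\Lambda),$$ and the same identities hold with $(X^{J\neq},T^{J\neq})$ and $W^{J\neq}(\beta_I)$ replaced by $(X^J,T^J)$ and $W^J(\beta_I)$. (On the left-hand side $(X,T)$ is the canonical process on $\Lambda^{\mathbb{N}_0}\times(0,\infty)^{\mathbb{N}_0}$, on the right-hand side the canonical process on $J^{\mathbb{N}_0}\times(0,\infty)^{\mathbb{N}_0}$.)
   Context: Encoding of jump processes: a continuous-time jump process on a vertex set $\Lambda$ is encoded by $(X_n,T_n)_{n\in\mathbb{N}_0}$, where $X_n\in\Lambda$ is the $n$-th position visited and $T_n>0$ is the waiting time before the jump from $X_n$ to $X_{n+1}$; $X_{n+1}=X_n$ (''self-loop'') is allowed. Vrjp: for a finite (or locally finite) vertex set $\Lambda$ and a symmetric matrix $W=(W_{ij})_{i,j\in\Lambda}$ of nonnegative weights, the vertex-reinforced jump process $(Y_t)_{t\ge0}$ started at $\rho$ jumps, conditionally on its past and on $Y_t=i$, to $j\neq i$ at rate $W_{ij}L_j(t)$, where $L_j(t)=1+\int_0^t1_{\{Y_s=j\}}ds$. The vrjp in exchangeable time scale is $Z_t=Y_{D^{-1}(t)}$ with $D(t)=\sum_{i\in\Lambda}(L_i(t)^2-1)$. $P^{W,\Lambda}_\rho$ denotes the law of $(X_n,T_n)_{n}$ obtained from $Z$ (built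 from the off-diagonal entries of $W$), augmented by self-loops as follows: for each vertex $i$ an independent Poisson process of intensity $\frac12W_{ii}$ is attached, and whenever the particle is at $i$ and this clock rings a self-loop $i\to i$ is inserted. A ''mixture of vrjps with random weights $W'$'' means the law obtained by first sampling $W'$ and then running the vrjp with weights $W'$. Restriction and self-loop removal: given $(X_n,T_n)_n$, let $\sigma_0=0$, $\sigma_n=\inf\{l>\sigma_{n-1}:X_l\neq X_{\sigma_{n-1}}\}$, and $(X^{\neq}_n,T^{\neq}_n):=(X_{\sigma_n},\sum_{l=\sigma_n}^{\sigma_{n+1}-1}T_l)$. For $\emptyset\neq J\subseteq\Lambda$ let $\tau_0=0$, $\tau_n=\inf\{l>\tau_{n-1}:X_l\in J\}$ and $(X^J_n,T^J_n):=(X_{\tau_n},T_{\tau_n})$. $(X^{J\neq},T^{J\neq})$ denotes first restricting to $J$ then removing self-loops. Notation: for a vector $v$ and matrix $A$, $v_I$ and $A_{IJ}$ denote restrictions to index sets. For $\beta\in\mathbb{R}^\Lambda$, $H^W_\beta:=2\operatorname{diag}(\beta)-W$. For finite $\Lambda$ and symmetric $W\in[0,\infty)^{\Lambda\times\Lambda}$ (diagonal entries allowed), $\nu^W_\Lambda$ is the probability measure $\nu^W_\Lambda(d\beta)=(2/\pi)^{|\Lambda|/2}1_{\{H^W_\beta>0\}}\frac{e^{-\frac12\langle 1,H^W_\beta 1\rangle}}{\sqrt{\det H^W_\beta}}d\beta$ on $\mathbb{R}^\Lambda$, where $H>0$ means positive definite and $1$ is the all-ones vector. *)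

(* Defs.v *)
From HB Require Import structures.
From mathcomp Require Import all_boot all_order all_algebra.
From mathcomp Require Import all_classical all_reals all_analysis.
Set Implicit Arguments.
Unset Strict Implicit.
Unset Printing Implicit Defensive.
Import Order.TTheory GRing.Theory Num.Theory.
Local Open Scope classical_set_scope.
Local Open Scope ring_scope.

(* Path space: (X_n, T_n)_{n in N_0}, X_n in V, T_n in R.             *)
(* The extra parameter v0 (the starting vertex) is only used to equip *)
(* the type with a point, as required by MathComp-Analysis'            *)
(* measurable types.                                                   *)
Definition PathT (V : finType) (R : realType) (v0 : V) : Type :=
  ((nat -> V) * (nat -> R))%type.

Section PathInstances.
Variables (V : finType) (R : realType) (v0 : V).
HB.instance Definition _ := Choice.on (PathT R v0).
HB.instance Definition _ :=
  isPointed.Build (PathT R v0) (fun _ => v0, fun _ => 0).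
End PathInstances.

Section Vrjp.
Variables (R : realType) (V : finType).

Definition cylset (v0 : V) (n : nat) (x : nat -> V) (B : nat -> set R)
  : set (PathT R v0) :=
  [set w | (forall k, (k <= n)%N -> w.1 k = x k) /\
           (forall k, (k < n)%N -> B k (w.2 k))].

Definition cyl (v0 : V) : set (set (PathT R v0)) :=
  [set C | exists n x B, (forall k, measurable (B k)) /\ C = cylset (v0:=v0) n x B].

Definition PathSp (v0 : V) := g_sigma_algebraType (@cyl v0).

(* iterated Lebesgue integral over R^n (first coordinate outermost);     *)
(* for nonnegative measurable integrands this is the integral w.r.t.     *)
(* n-dimensional Lebesgue measure (Tonelli).                             *)
Definition scons (s : R) (t : nat -> R) : nat -> R :=
  fun k => if k is k'.+1 then t k' else s.

Fixpoint iterint (n : nat) (f : (nat -> R) -> \bar R) : \bar R :=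
  match n with
  | 0 => f (fun _ => 0)
  | n'.+1 => (\int[lebesgue_measure]_s iterint n' (fun t => f (scons s t)))%E
  end.

Definition intR (U : finType) (g : (U -> R) -> \bar R) : \bar R :=
  iterint #|U| (fun t => g (fun u => t (enum_rank u))).

Definition loc (x : nat -> V) (t : nat -> R) (k : nat) (v : V) : R :=
  \sum_(m < k | x m == v) t m.

(* Density of the k-th step (holding time T_k = t k at X_k, then jump    *)
(* to X_{k+1}) of the vrjp in exchangeable time scale with self-loops.   *)
(* In exchangeable time scale the particle at i with local times l jumps *)
(* to j <> i at rate W_ij/2 * sqrt(1+l_j)/sqrt(1+l_i), and performs a    *)
(* self-loop at rate W_ii/2.  The survival exponent is the integral of   *)
(* the total rate over the holding time.                                 *)
Definition dens (W : V -> V -> R) (x : nat -> V) (t : nat -> R) (k : nat) : R :=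
  let i := x k in let j := x k.+1 in let s := t k in let l := loc x t k in
  if 0 < s then
    (if j != i then W i j / 2 * Num.sqrt (1 + l j) / Num.sqrt (1 + l i + s)
     else W i i / 2) *
    expR (- (\sum_(v | v != i)
               W i v * Num.sqrt (1 + l v) *
                 (Num.sqrt (1 + l i + s) - Num.sqrt (1 + l i))
             + W i i * s / 2))
  else 0.

Definition is_vrjp_law (W : V -> V -> R) (rho : V)
  (P : probability (PathSp rho) R) : Prop :=
  forall (n : nat) (x : nat -> V) (B : nat -> set R),
    (forall k, measurable (B k)) ->
    P (cylset (v0:=rho) n x B) =
    ((x 0%N == rho)%:R%:E *
     iterint n (fun t => (\prod_(k < n) (\1_(B k) (t k) * dens W x t k))%:E))%E.

(* first index m > l with p m (junk value l.+1 if there is none) *)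
Definition next (p : pred nat) (l : nat) : nat :=
  match pselect (exists m, (l < m)%N && p m) with
  | left h => ex_minn h
  | right _ => l.+1
  end.

Fixpoint tauJ (J : {set V}) (x : nat -> V) (n : nat) : nat :=
  if n is n'.+1 then next (fun m => x m \in J) (tauJ J x n') else 0%N.

Definition restrJ (J : {set V}) (rho : V) (d : {x : V | x \in J})
  (w : PathT R rho) : PathT R d :=
  (fun n => insubd d (w.1 (tauJ J w.1 n)), fun n => w.2 (tauJ J w.1 n)).

End Vrjp.

Section Loops.
Variables (R : realType) (U : finType).

Fixpoint sigmaN (x : nat -> U) (n : nat) : nat :=
  if n is n'.+1 then next (fun m => x m != x (sigmaN x n')) (sigmaN x n')
  else 0%N.

Definition rmloops (u0 : U) (w : PathT R u0) : PathT R u0 :=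
  (fun n => w.1 (sigmaN w.1 n),
   fun n => \sum_(sigmaN w.1 n <= l < sigmaN w.1 n.+1) w.2 l).

End Loops.

Section Mats.
Variables (R : realType).

Definition Hb (U : finType) (W : U -> U -> R) (beta : U -> R) : U -> U -> R :=
  fun i j => 2 * (i == j)%:R * beta i - W i j.

Definition subM (U : finType) (S : {set U}) (M : U -> U -> R) : 'M[R]_#|S| :=
  \matrix_(a, b) M (enum_val a) (enum_val b).

Definition posdef (n : nat) (M : 'M[R]_n) : Prop :=
  forall v : 'cV[R]_n, v != 0 -> 0 < (v^T *m M *m v) ord0 ord0.

Definition nu_dens (U : finType) (W : U -> U -> R) (beta : U -> R) : R :=
  let H := subM [set: U] (Hb W beta) in
  if `[< posdef H >] then
    Num.sqrt (2 / pi) ^+ #|U| *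
    expR (- (\sum_i \sum_j Hb W beta i j) / 2) / Num.sqrt (\det H)
  else 0.

Variables (V : finType) (W : V -> V -> R) (I J : {set V}).

Definition WJ (beta : V -> R) (i j : {x : V | x \in J}) : R :=
  W (val i) (val j) +
  \sum_(a < #|I|) \sum_(b < #|I|)
     W (val i) (enum_val a) * (invmx (subM I (Hb W beta))) a b
       * W (enum_val b) (val j).

Definition WJneq (beta : V -> R) (i j : {x : V | x \in J}) : R :=
  if i == j then 0 else WJ beta i j.

Definition What (rho : V) (u w : {x : V | x \in rho |: I}) : R :=
  let i := val u in let j := val w in
  if i == rho then (if j == rho then 0 else \sum_(k in J) W j k)
  else if j == rho then \sum_(k in J) W i k else W i j.

Definition extb (rho : V) (beta : {x : V | x \in rho |: I} -> R) : V -> R :=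
  fun v => if insub v is Some u then beta u else 0.

End Mats.

(* Main.v *)
(* Write [l] for the local times of a path.  In exchangeable time scale the densities of the
   successive steps telescope: a path [x] of [n] steps has density
   [prod_k W(x_k, x_k+1)/2 * sqrt(1 + l(x_n)) * prod_v (1 + l_v)^(-1/2)
      * exp (- 1/2 sum_ij W_ij (sqrt ((1 + l_i) (1 + l_j)) - 1))],
   self-loops included, and the last two factors are the Laplace transform of [nu^W] at [l].  So the
   vrjp is the [nu^W]-mixture of the path weights [prod_k (W(x_k, x_k+1)/2) exp (- beta(x_k) t_k)],
   with the boundary factor [sqrt (1 + l(x_n))].  For fixed [beta], summing such weights over the
   excursions into [I] produces the Neumann series of [inv (H_II) W_IJ], that is, path weights on [J]
   with [W] replaced by its Schur complement [W^J]; integrating out [beta_J] turns them back into the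
   vrjp on [J] with weights [W^J(beta_I)].  Eliminating vertices one at a time writes [nu^W] as a
   product of inverse Gaussian factors, and the marginal on [I] sees [J] only through the total
   weights [sum_(k in J) W_ik], which is why [What] gives the same law of [beta_I].  For fixed weights,
   summing over the number of loops in a holding time shows that deleting the loops of a vrjp deletes
   the diagonal of its weights.  Everywhere it is enough to bound one probability by another on
   cylinders, since a probability dominated by a probability equals it. *)
Require Import Defs.
From HB Require Import structures.
From mathcomp Require Import all_boot all_order all_algebra fingroup perm.
From mathcomp Require Import all_classical all_reals all_analysis.
From mathcomp Require Import measurable_realfun ring lra.
Set Implicit Arguments.
Unset Strict Implicit.
Unset Printing Implicit Defensive.
Import Order.TTheory GRing.Theory Num.Theory.
Import numFieldNormedType.Exports.
Local Open Scope classical_set_scope.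
Local Open Scope ring_scope.

(** Domination keeps recurrence out of the argument. A path that never returns to [J], or that loops
    forever, meets the default value of [next], and the preimage of a cylinder may contain such
    paths. The proof only exhibits disjoint events inside that preimage, one for each number [N] of
    original steps, and sums their probabilities; that nothing is missed follows from total mass
    one. The sum over excursions decouples because the boundary factor involves the local time of
    the last vertex only, and this vertex lies in [J]: holding times in [I] enter through
    exponentials alone. The families [QJ] and [Qneq] are prescribed only where the block [H_II] is
    positive definite, and no measurability in [beta] is given. For [QJ] it is recovered from the
    cylinder formulas after multiplication by the indicator of positive pivots, which the density of
    [nu] contains anyway; there [Qneq] is expressed through [QJ]. Integrals over holding times and
    over [beta] are brought to a common form [iint] with named coordinates, over the product
    sigma-algebra, where Tonelli applies one coordinate at a time. *)

Lemma measurable_comp2 d d1 d2 d3 (X : measurableType d) (Y : measurableType d1)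
    (Z : measurableType d2) (U : measurableType d3) (g : Y -> Z -> U)
    (a : X -> Y) (b : X -> Z) :
  measurable_fun setT (fun p : Y * Z => g p.1 p.2) ->
  measurable_fun setT a -> measurable_fun setT b ->
  measurable_fun setT (fun x => g (a x) (b x)).
Proof.
by move=> mg ma mb; exact: (measurableT_comp mg (measurable_fun_pair ma mb)).
Qed.

Arguments measurable_comp2 {d d1 d2 d3 X Y Z U} g a b.

(** * The product sigma-algebra on real functions *)

Section FunctionSpace.
Variables (R : realType) (K : choiceType).

(** Rectangles with finitely many constrained coordinates form a pi-system. The list [s] bounds the
    constrained coordinates, so that [K] may be infinite, as for sequences of holding times. *)
Definition coord_sets : set (set (K -> R)) :=
  [set A | exists (s : seq K) (B : K -> set R),
    (forall k, measurable (B k)) /\ A = [set f | forall k, k \in s -> B k (f k)]].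

Definition FunSp := g_sigma_algebraType coord_sets.

Lemma coord_sets_setI : setI_closed coord_sets.
Proof.
move=> _ _ [s [B [mB ->]]] [s' [B' [mB' ->]]].
exists (s ++ s'), (fun k => (if k \in s then B k else setT) `&`
  (if k \in s' then B' k else setT)); split.
  by move=> k; apply: measurableI; case: ifP.
apply/seteqP; split=> [f [/= fB fB'] k|f /= fBB'].
  rewrite mem_cat => _; split; case: ifPn => //; [exact: fB|exact: fB'].
by split=> k ks; have := fBB' k; rewrite mem_cat ks ?orbT => /(_ isT) [].
Qed.

Lemma measurable_eval (k : K) : measurable_fun setT (fun f : FunSp => f k).
Proof.
move=> _ B mB; rewrite setTI; apply: sub_gen_smallest.
exists [:: k], (fun=> B); split=> //; apply/seteqP; split=> f /=.
  by move=> fB k'; rewrite inE => /eqP ->.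
by apply; rewrite inE.
Qed.

Lemma measurable_toFunSp d (X : measurableType d) (h : X -> K -> R) :
  (forall k, measurable_fun setT (fun x => h x k)) ->
  measurable_fun setT (h : X -> FunSp).
Proof.
move=> mh; apply: (@measurability _ _ _ FunSp setT h coord_sets) => //.
move=> _ [_ [s [B [mB ->]]] <-]; rewrite setTI.
rewrite (_ : _ @^-1` _ = \bigcap_(k in [set` s]) ((fun x => h x k) @^-1` B k)).
  by apply: fin_bigcap_measurable => // k _; rewrite -[X in measurable X]setTI; exact: mh.
by apply/seteqP; split=> x /=.
Qed.

End FunctionSpace.

(** * Iterated integrals *)

Section IteratedIntegral.
Variables (R : realType) (K : choiceType).
Notation mu := (@lebesgue_measure R).

Definition upd (f : K -> R) (k : K) (x : R) : K -> R :=
  fun k' => if k' == k then x else f k'.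

Lemma upd_same f k x : upd f k x k = x.
Proof. by rewrite /upd eqxx. Qed.

Lemma upd_other f k x k' : k' != k -> upd f k x k' = f k'.
Proof. by rewrite /upd => /negbTE ->. Qed.

Lemma updC f k x k' x' : k != k' -> upd (upd f k x) k' x' = upd (upd f k' x') k x.
Proof.
move=> kk'; apply/funext => j; rewrite /upd.
by have [->|//] := eqVneq j k; rewrite (negbTE kk').
Qed.

(** Tonelli integral over the coordinates in [s], the others being frozen at [f]. Coordinates are
    named instead of shifted as in [iterint], so that [s] can be split, permuted and renamed. *)
Fixpoint iint (s : seq K) (g : (K -> R) -> \bar R) (f : K -> R) : \bar R :=
  if s is k :: s' then (\int[mu]_x iint s' g (upd f k x))%E else g f.

Lemma measurable_upd d (X : measurableType d) (h : X -> FunSp R K) k (y : X -> R) :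
  measurable_fun setT h -> measurable_fun setT y ->
  measurable_fun setT (fun x => upd (h x) k (y x) : FunSp R K).
Proof.
move=> mh my; apply: measurable_toFunSp => k'; rewrite /upd.
by case: (k' == k) => //; exact: (measurableT_comp (measurable_eval k') mh).
Qed.

Arguments measurable_upd {d X} h k y.

Lemma iint_ge0 s g f : (forall f, 0 <= g f)%E -> (0 <= iint s g f)%E.
Proof. by elim: s f => //= k s IH f g0; apply: integral_ge0 => x _; exact: IH. Qed.

Lemma iint_cat s s' g f : iint (s ++ s') g f = iint s (iint s' g) f.
Proof. by elim: s f => //= k s IH f; apply: eq_integral => x _; exact: IH. Qed.

Lemma measurable_iint d (X : measurableType d) (s : seq K)
    (g : X -> (K -> R) -> \bar R) (h : X -> FunSp R K) :
  measurable_fun setT (fun p : X * FunSp R K => g p.1 p.2 : \bar R) ->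
  (forall x f, 0 <= g x f)%E -> measurable_fun setT h ->
  measurable_fun setT (fun x => iint s (g x) (h x) : \bar R).
Proof.
elim: s d X g h => [|k s IH] d X g h mg g0 mh /=.
  exact: (measurable_comp2 (Z := FunSp R K) g id h).
pose g' (p : X * R) := g p.1; pose h' (p : X * R) : FunSp R K := upd (h p.1) k p.2.
apply: (measurable_fun_fubini_tonelli_F (m2 := mu) (fun p => iint s (g' p) (h' p))).
  apply: IH => //.
  - by apply: (measurable_comp2 (Z := FunSp R K) g (fun p => p.1.1) snd) => //; exact: measurableT_comp.
  - by move=> p f; exact: g0.
  - by apply: (measurable_upd (X := (X * R)%type) (fun p => h p.1) k snd) => //; exact: (measurableT_comp mh measurable_fst).
by move=> p; apply: iint_ge0 => f; exact: g0.
Qed.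

Lemma measurable_iint_upd s (g : (K -> R) -> \bar R) f k :
  measurable_fun setT (g : FunSp R K -> _) -> (forall f, 0 <= g f)%E ->
  measurable_fun setT (fun x => iint s g (upd f k x) : \bar R).
Proof.
move=> mg g0; apply: (@measurable_iint _ R s (fun=> g)) => //.
  exact: measurableT_comp.
exact: (measurable_upd (X := R) (cst f) k id).
Qed.

Lemma eq_iint s g g' f : (forall f, g f = g' f) -> iint s g f = iint s g' f.
Proof. by move=> /funext ->. Qed.

Lemma iint_swap d (X : measurableType d) (m : {sigma_finite_measure set X -> \bar R}) s
    (g : X -> (K -> R) -> \bar R) f :
  measurable_fun setT (fun p : X * FunSp R K => g p.1 p.2 : \bar R) ->
  (forall x f, 0 <= g x f)%E ->
  (\int[m]_x iint s (g x) f = iint s (fun f => \int[m]_x g x f) f)%E.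
Proof.
move=> mg g0; elim: s f => //= k s IH f.
rewrite (fubini_tonelli (m1 := m) (m2 := mu) (fun p => iint s (g p.1) (upd f k p.2)))/=; last 2 first.
- pose g' (p : X * R) := g p.1.
  apply: (@measurable_iint _ _ s g') => //.
  - by apply: (measurable_comp2 (Z := FunSp R K) g (fun p => p.1.1) snd) => //; exact: measurableT_comp.
  - by move=> p f'; exact: g0.
  exact: (measurable_upd (X := (X * R)%type) (cst f) k snd).
- by move=> p; exact: iint_ge0.
by apply: eq_integral => x _; exact: IH.
Qed.

(** The first coordinate [k] of [s] is brought to the front of [s'] by moving it past its
    predecessors; each such exchange is Tonelli for two coordinates. *)
Lemma iint_perm s s' g f : uniq s -> perm_eq s s' ->
  measurable_fun setT (g : FunSp R K -> _) -> (forall f, 0 <= g f)%E ->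
  iint s g f = iint s' g f.
Proof.
move=> us ss' mg g0; have us' : uniq s' by rewrite -(perm_uniq ss').
elim: s s' us us' ss' f => [|k s IH] s' us us' ss' f.
  by move: ss'; rewrite perm_sym => /perm_nilP ->.
have ks' : k \in s' by rewrite -(perm_mem ss') mem_head.
have /IH {}IH : uniq s by case/andP: us.
transitivity (iint (k :: rem k s') g f) => /=.
  apply: eq_integral => x _; apply: IH; first exact: rem_uniq.
  by rewrite -(perm_cons k) (permPl ss') perm_to_rem.
elim: s' ks' us' {ss' IH us} f => //= k' s' IH; rewrite inE => + /andP[k's' us'] f.
have [->|kk'] := eqVneq k' k; first by [].
move=> /= ks'.
rewrite (fubini_tonelli (m1 := mu) (m2 := mu)
  (fun p => iint (rem k s') g (upd (upd f k p.1) k' p.2)))/=; last 2 first.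
- apply: (@measurable_iint _ _ (rem k s') (fun=> g)) => //.
    exact: measurableT_comp.
  apply: (measurable_upd (X := (R * R)%type) (fun p => upd f k p.1) k' snd) => //.
  exact: (measurable_upd (X := (R * R)%type) (cst f) k fst (measurable_cst _) measurable_fst).
- by move=> p; exact: iint_ge0.
apply: eq_integral => x _; rewrite -IH //=.
by apply: eq_integral => y _; rewrite updC // eq_sym.
Qed.

Lemma iintZl s (c : \bar R) g f : measurable_fun setT (g : FunSp R K -> _) ->
  (forall f, 0 <= g f)%E -> (0 <= c)%E ->
  (iint s (fun f => c * g f) f = c * iint s g f)%E.
Proof.
move=> mg g0 c0; elim: s f => //= k s IH f.
under eq_integral do rewrite IH.
rewrite ge0_integralZl //; first exact: measurable_iint_upd.
by move=> x _; exact: iint_ge0.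
Qed.

Lemma iintD s g g' f : measurable_fun setT (g : FunSp R K -> _) ->
  measurable_fun setT (g' : FunSp R K -> _) ->
  (forall f, 0 <= g f)%E -> (forall f, 0 <= g' f)%E ->
  (iint s (fun f => g f + g' f) f = iint s g f + iint s g' f)%E.
Proof.
move=> mg mg' g0 g'0; elim: s f => //= k s IH f.
under eq_integral do rewrite IH.
by rewrite ge0_integralD //; (try by move=> x _; exact: iint_ge0);
  exact: measurable_iint_upd.
Qed.

Lemma iint_sum (I : Type) (r : seq I) s (g : I -> (K -> R) -> \bar R) f :
  (forall i, measurable_fun setT (g i : FunSp R K -> _)) ->
  (forall i f, 0 <= g i f)%E ->
  (iint s (fun f => \sum_(i <- r) g i f) f = \sum_(i <- r) iint s (g i) f)%E.
Proof.
move=> mg g0; elim: s f => //= k s IH f.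
under eq_integral do rewrite IH.
rewrite ge0_integral_sum //; last by move=> i x _; exact: iint_ge0.
by move=> i; exact: measurable_iint_upd.
Qed.

Lemma iint_nneseries s (g : nat -> (K -> R) -> \bar R) f :
  (forall i, measurable_fun setT (g i : FunSp R K -> _)) ->
  (forall i f, 0 <= g i f)%E ->
  (iint s (fun f => \sum_(i <oo) g i f) f = \sum_(i <oo) iint s (g i) f)%E.
Proof.
move=> mg g0; elim: s f => //= k s IH f.
under eq_integral do rewrite IH.
rewrite integral_nneseries //; last by move=> i x _; exact: iint_ge0.
by move=> i; exact: measurable_iint_upd.
Qed.

Lemma le_iint s g g' f : measurable_fun setT (g : FunSp R K -> _) ->
  measurable_fun setT (g' : FunSp R K -> _) ->
  (forall f, 0 <= g f)%E -> (forall f, g f <= g' f)%E ->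
  (iint s g f <= iint s g' f)%E.
Proof.
move=> mg mg' g0 gg'; elim: s f => //= k s IH f.
have g'0 f' : (0 <= g' f')%E by exact: le_trans (gg' _).
apply: ge0_le_integral => //; try by move=> x _; exact: iint_ge0.
- exact: measurable_iint_upd.
- exact: measurable_iint_upd.
Qed.

End IteratedIntegral.
Arguments measurable_upd {R K d X} h k y.

Lemma iint_swap2 (R : realType) (K K' : choiceType) s s'
    (g : (K -> R) -> (K' -> R) -> \bar R) f f' :
  measurable_fun setT (fun p : FunSp R K * FunSp R K' => g p.1 p.2 : \bar R) ->
  (forall f f', 0 <= g f f')%E ->
  iint s (fun f => iint s' (g f) f') f = iint s' (fun f' => iint s (g ^~ f') f) f'.
Proof.
move=> mg g0; elim: s f => //= k s IH f.
under eq_integral do rewrite IH.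
pose g1 (p : R * FunSp R K') := g ^~ p.2.
rewrite (iint_swap lebesgue_measure s' (g := fun x f' => iint s (g ^~ f') (upd f k x))) //.
- apply: (@measurable_iint _ _ _ _ s g1).
  + apply: (measurable_comp2 (Y := FunSp R K) (Z := FunSp R K') g
      (fun p : R * FunSp R K' * FunSp R K => p.2) (fun p => p.1.2)).
    * exact: mg.
    * exact: measurable_snd.
    * exact: (measurableT_comp measurable_snd measurable_fst).
  + by move=> p f1; exact: g0.
  + exact: (measurable_upd (X := (R * FunSp R K')%type) (cst f) k fst).
- by move=> x f1; apply: iint_ge0 => f2; exact: g0.
Qed.

(* [iterint] and [intR] both evaluate at a function that vanishes off the integrated coordinates. *)
Lemma iterintE (R : realType) n (g : (nat -> R) -> \bar R) :
  iterint n g = iint (iota 0 n) g (fun=> 0).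
Proof.
(* Generalized over the first integrated index [m]: [iterint] fills the [n] places from [m] on, and
   all other entries stay frozen at [f]. *)
have gen m (f : nat -> R) : iint (iota m n) g f =
    iterint n (fun t => g (fun k => if (k < m)%N then f k else
                                    if (k < m + n)%N then t (k - m)%N else f k)).
  elim: n m f g => [|n IH] m f g /=.
    by congr g; apply/funext => k; rewrite addn0; case: (k < m)%N.
  apply: eq_integral => x _; rewrite IH; congr iterint; apply/funext => t.
  congr g; apply/funext => k; rewrite /upd ltnS addSnnS.
  case: (ltngtP k m) => [//|mk|->].
    by case: ifP => // _; rewrite -(subnSK mk).
  by rewrite subnn -[X in (X < _)%N]addn0 ltn_add2l.
rewrite gen; elim: n g {gen} => [|n IH] g /=; first by congr g; apply/funext => k.
apply: eq_integral => x _.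
rewrite [LHS]IH; congr iterint; apply/funext => t; congr g.
by apply/funext => -[|k] /=; rewrite ?add0n ?ltnS ?subn0.
Qed.

(** The integrand reads only the entries [i u]. Renaming integrated coordinates by [phi] is harmless
    once an entry that is not integrated keeps its frozen value and its new name does not collide
    with a renamed coordinate. *)
Lemma iint_relabel (R : realType) (K K' : choiceType) (U : Type) (i : U -> K)
    (i' : U -> K') (phi : K -> K') (s : seq K) (G : (U -> R) -> \bar R)
    (f : K -> R) (f' : K' -> R) :
  uniq s -> uniq (map phi s) ->
  (forall u, i u \in s -> i' u = phi (i u)) ->
  (forall u, i u \notin s -> f (i u) = f' (i' u) /\ i' u \notin map phi s) ->
  iint s (fun b => G (b \o i)) f = iint (map phi s) (fun b => G (b \o i')) f'.
Proof.
elim: s f f' => [|k s IH] f f' /= us us' is_ ins.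
  by congr G; apply/funext => u; have [] := ins u isT.
move: us us' => /andP[ks us] /andP[pks us'].
apply: eq_integral => x _; apply: IH => // u uis.
  by apply: is_; rewrite inE uis orbT.
have [iuk|iuk] := eqVneq (i u) k.
  have -> : i' u = phi k by rewrite is_ ?iuk ?mem_head.
  by rewrite iuk !upd_same.
have [|fu] := ins u; first by rewrite inE negb_or iuk.
by rewrite inE negb_or => /andP[iu' iu'']; rewrite !upd_other.
Qed.

(** The embedding [i] lets an integral over functions on [U] run over coordinates of a larger type
    [K]; vectors on [rho |: I] or on [J] are thus treated as vectors on [V]. *)
Lemma intRE (R : realType) (U : finType) (K : choiceType) (i : U -> K)
    (g : (U -> R) -> \bar R) (f : K -> R) : injective i ->
  intR g = iint [seq i u | u <- enum U] (fun b => g (b \o i)) f.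
Proof.
move=> inji; rewrite /intR iterintE.
case: (pickP U) => [u0 _|U0].
  have mapE : [seq i (nth u0 (enum U) n) | n <- iota 0 #|U|] =
              [seq i u | u <- enum U].
    by rewrite cardE (map_comp i) -/(mkseq _ _) mkseq_nth.
  rewrite -mapE; apply: (iint_relabel (i := fun u => nat_of_ord (enum_rank u))
    (i' := i) (phi := fun n => i (nth u0 (enum U) n)) g) => //.
  - exact: iota_uniq.
  - by rewrite mapE map_inj_uniq ?enum_uniq.
  - by move=> u _; rewrite nth_enum_rank.
  - by move=> u; rewrite mem_iota /= add0n ltn_ord.
have U0' : #|U| = 0%N by exact: eq_card0.
have -> : enum U = [::] by apply: size0nil; rewrite -cardE.
move: (@enum_rank U); rewrite U0' => r /=.
by congr g; apply/funext => u; have := U0 u.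
Qed.

(** * One-dimensional integrals *)

Section RealFunctions.
Variable R : realType.
Notation mu := (@lebesgue_measure R).

Lemma measurable_invr : measurable_fun setT (@GRing.inv R).
Proof.
(* Inversion is discontinuous at 0. Through the square it becomes a real power of a nonnegative
   number, and the identity also holds at 0, where both sides vanish. *)
rewrite (_ : @GRing.inv R = fun x : R => x * (x ^+ 2) `^ (- 1)); last first.
  apply/funext => x; rewrite powR_inv1 ?sqr_ge0 //.
  have [->|x0] := eqVneq x 0; first by rewrite invr0 mul0r.
  by rewrite expr2 invfM mulrA mulfV ?mul1r.
apply: measurable_funM => //.
have mx : measurable_fun setT (fun x : R => x ^+ 2) by exact: exprn_measurable.
exact: (measurableT_comp (@measurable_powR R (-1)) mx).
Qed.

Lemma measurable_sqrtr : measurable_fun setT (@Num.sqrt R).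
Proof. by apply: continuous_measurable_fun; exact: sqrt_continuous. Qed.

(** The image of Lebesgue measure under a translation agrees with it on half-open intervals, hence
    equals it. *)
Lemma ge0_integral_shift (f : R -> \bar R) (a : R) :
  measurable_fun setT f -> (forall x, 0 <= f x)%E ->
  (\int[mu]_x f (x + a)%R = \int[mu]_x f x)%E.
Proof.
move=> mf f0.
have mp : measurable_fun setT ((fun x : R => x + a) : measurableTypeR R -> measurableTypeR R).
  exact: measurable_funD.
rewrite -(ge0_integral_pushforward mp mu (D := setT) (f := f)) //.
apply: eq_measure_integral => A mA _.
apply/esym/lebesgue_measure_unique => //= _ [[p q]] _ <-; rewrite /pushforward.
rewrite (_ : _ @^-1` _ = `]p - a, q - a]%classic); last first.
  by apply/seteqP; split => x /=; rewrite !in_itv /= ltrBlDr lerBrDr.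
rewrite !lebesgue_measure_itv /= !lte_fin ltrD2r.
by case: ifPn => // _; congr _%:E; ring.
Qed.

(** The integrand may blow up at [a]. The closed half-lines starting at [a + 1/(n+1)] are
    increasing, so monotone convergence passes to the open one, where only the right limit of [F] is
    used. *)
Lemma ge0_FTC_oy (f F : R -> R) a l m :
  (forall x, a < x -> 0 <= f x) -> {in `]a, +oo[, continuous f} ->
  (forall x, a < x -> is_derive x 1 F (f x)) ->
  F x @[x --> +oo] --> l -> F x @[x --> a^'+] --> m ->
  (\int[mu]_(x in `]a, +oo[) (f x)%:E = (l - m)%:E)%E.
Proof.
move=> f0 cf dF Fl Fm.
pose c n : R := a + n.+1%:R^-1.
have ac n : a < c n by rewrite ltrDl.
have step n : (\int[mu]_(x in `[c n, +oo[) (f x)%:E = (l - F (c n))%:E)%E.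
  rewrite (@ge0_continuous_FTC2y R f F (c n) l) //.
  - by move=> x cx; apply: f0; exact: lt_le_trans (ac n) _.
  - apply: continuous_in_subspaceT => x; rewrite inE /= in_itv /= andbT => cx.
    by apply: cf; rewrite in_itv /= andbT; exact: lt_le_trans (ac n) _.
  - by move=> x cx; have := dF x (lt_trans (ac n) cx) => -[].
  - apply: cvg_at_right_filter; apply: differentiable_continuous.
    by apply/derivable1_diffP; have := dF _ (ac n) => -[].
  - move=> x; rewrite in_itv /= andbT => cx; rewrite derive1E.
    by have := dF x (lt_trans (ac n) cx) => -[].
have cvg1 : (\int[mu]_(x in `[c n, +oo[) (f x)%:E)%E @[n --> \oo] --> ((l - m)%:E)%E.
  under eq_fun do rewrite step.
  apply: cvg_EFin; first exact: nearW.
  apply: cvgB; first exact: cvg_cst.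
  have := cvg_at_rightP F a m; case=> + _ => /(_ Fm c); apply; split => //.
  rewrite /c -[X in _ --> X]addr0; apply: cvgD; first exact: cvg_cst.
  exact: cvg_harmonic.
have := @ge0_nondecreasing_set_cvg_integral _ (measurableTypeR R) R (fun n => `[c n, +oo[%classic) (fun x => (f x)%:E) mu.
rewrite (_ : \bigcup_i _ = `]a, +oo[%classic); last first.
  apply/seteqP; split => x /=.
    by move=> [n _ /=]; rewrite !in_itv /= !andbT; exact: lt_le_trans.
  rewrite in_itv /= andbT => ax.
  have e0 : 0 < x - a by rewrite subr_gt0.
  have [n _ /(_ n (leqnn n))] := near_infty_natSinv_lt (PosNum e0).
  move=> nx; have {}nx : n.+1%:R^-1 < x - a by exact: nx.
  by exists n => //=; rewrite in_itv /= andbT -lerBrDl ltW.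
move=> H; apply: (cvg_unique _ _ cvg1); first exact: ereal_hausdorff.
apply: H => //.
- apply/nondecreasing_seqP => n; rewrite subsetEset => x /=.
  rewrite !in_itv /= !andbT; apply: le_trans.
  by rewrite lerD2l lef_pV2 ?posrE // ler_nat.
- move=> n; apply/measurable_EFinP.
  apply: (@measurable_funS _ _ _ _ `]a, +oo[%classic) => //.
    by move=> x /=; rewrite !in_itv /= !andbT; exact: lt_le_trans.
  apply: open_continuous_measurable_fun; first exact: interval_open.
  by move=> x; rewrite inE /=; exact: cf.
- move=> n x /=; rewrite in_itv /= andbT lee_fin => cx; apply: f0.
  exact: lt_le_trans (ac n) _.
Qed.

Lemma integral_patch_oy (f : R -> R) a :
  (\int[mu]_x (if a < x then f x else 0)%:E = \int[mu]_(x in `]a, +oo[) (f x)%:E)%E.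
Proof.
rewrite [RHS]integral_mkcond; apply: eq_integral => x _; rewrite patchE.
by rewrite mem_setE in_itv /= andbT; case: ifP.
Qed.

Lemma integral_expR_oy (b : R) : 0 < b ->
  (\int[mu]_t (if 0 < t then expR (- (b * t)) else 0)%:E = b^-1%:E)%E.
Proof.
move=> b0; rewrite (integral_patch_oy (fun t => expR (- (b * t)))).
have cl : continuous (fun t : R => - (b * t)).
  by move=> x; apply: continuousN; exact: mulrl_continuous.
have ce : continuous (fun t : R => expR (- (b * t))).
  by move=> x; apply: continuous_comp; [exact: cl|exact: continuous_expR].
pose F t := - (b^-1 * expR (- (b * t))).
have dF (x : R) : 0 < x -> is_derive x 1 F (expR (- (b * x))).
  move=> x0; rewrite /F; apply: is_derive_eq; rewrite /GRing.scale /=.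
  by field; exact: lt0r_neq0.
have Fl : F x @[x --> +oo] --> 0.
  rewrite -oppr0 -[X in - X](mulr0 b^-1); apply: cvgN; apply: cvgMr.
  by apply: (cvg_comp _ _ _ (@cvgr_expR R)); exact: gt0_cvgMry.
have Fm : F x @[x --> 0^'+] --> - b^-1.
  apply: cvg_at_right_filter; rewrite (_ : - b^-1 = F 0); last first.
    by rewrite /F mulr0 oppr0 expR0 mulr1.
  by apply: cvgN; apply: cvgMr; exact: ce.
rewrite (ge0_FTC_oy _ _ dF Fl Fm) ?sub0r ?opprK // => x _.
Qed.

(** [E] is the distribution function of the standard normal law divided by the peak of its density,
    which supplies the limits. The sum [E x + E (- x)] has derivative 0; its constant value is read
    off at infinity. *)
Lemma gauss_primitive : exists E : R -> R, [/\ forall x : R, is_derive x 1 E (expR (- (x ^+ 2) / 2)),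
  E x @[x --> -oo] --> 0, E x @[x --> +oo] --> Num.sqrt (2 * pi) & E 0 + E 0 = Num.sqrt (2 * pi)].
Proof.
pose P : probability (measurableTypeR R) R := @normal_prob R 0 1.
pose X : {RV P >-> R} := HB.pack (idfun : measurableTypeR R -> R)
  (isMeasurableFun.Build _ _ _ _ (idfun : measurableTypeR R -> R) (@measurable_id _ _ setT)).
pose c := @normal_peak R 1.
have c0 : 0 < c by exact: normal_peak_gt0.
have cE : c^-1 = Num.sqrt (2 * pi).
  by rewrite /c /normal_peak invrK expr1n mul1r mulr_natl.
have cdfE r : cdf X r = (\int[mu]_(x in `]-oo, r]) (normal_pdf 0 1 x)%:E)%E by [].
pose F r := (\int[mu]_(x in `]-oo, r]) (normal_pdf 0 1 x))%R.
have cdfF r : (F r)%:E = cdf X r.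
  by rewrite cdfE /F /Rintegral fineK // -cdfE fin_num_measure.
have dF (x : R) : is_derive x 1 F (normal_pdf 0 1 x).
  have [||||d1 d2] := @continuous_FTC1 R (normal_pdf 0 1) -oo%O x (x + 1).
  - by rewrite ltrDl.
  - apply: (integrableS _ _ (@subsetT _ _)) => //; exact: integrable_normal_pdf.
  - exact: ltNye.
  - by apply: continuous_normal_pdf; exact: oner_neq0.
  - by constructor; [exact: d1|rewrite -derive1E; exact: d2].
have pdfE (x : R) : normal_pdf 0 1 x = c * expR (- (x ^+ 2) / 2).
  rewrite normal_pdfE ?oner_neq0 // /normal_fun subr0 expr1n.
  by congr (_ * expR (_ / _)).
suff [E [dE Em Ep]] : exists E : R -> R, [/\ forall x : R, is_derive x 1 E (expR (- (x ^+ 2) / 2)),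
    E x @[x --> -oo] --> 0 & E x @[x --> +oo] --> Num.sqrt (2 * pi)].
  exists E; split => //.
  pose S (x : R) := E x + E (- x).
  have dS (x : R) : is_derive x 1 S 0.
    have d1 := @is_derive1_comp R E -%R x _ _ (dE (- x)) (is_deriveNid x 1).
    apply: is_derive_eq; rewrite sqrrN; ring.
  have S0 x : S x = S 0 by exact: is_derive_0_is_cst.
  have Sp : S x @[x --> +oo] --> Num.sqrt (2 * pi) + 0.
    apply: cvgD => //; apply: (cvg_comp _ _ _ Em).
    by apply/cvgNry; rewrite opprK; exact: cvg_id.
  rewrite (_ : E 0 + E 0 = S 0); last by rewrite /S oppr0.
  rewrite -[RHS]addr0; apply: (cvg_unique _ _ Sp); first exact: Rhausdorff.
  by rewrite (_ : S = cst (S 0)); [exact: cvg_cst|apply/funext => x; exact: S0].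
exists (fun x => c^-1 * F x); split.
- move=> x; apply: is_derive_eq; rewrite /GRing.scale /= pdfE.
  by field; exact: lt0r_neq0.
- have -> : (fun x => c^-1 * F x) = (fun x => c^-1 * fine (cdf X x)).
    by apply/funext => x; rewrite -cdfF.
  rewrite -(mulr0 c^-1); apply: cvgMr.
  have := @fine_cvg _ _ (-oo)%R _ _ 0 (cvg_cdfNy0 X).
  exact.
- have -> : (fun x => c^-1 * F x) = (fun x => c^-1 * fine (cdf X x)).
    by apply/funext => x; rewrite -cdfF.
  rewrite -cE -[X in _ --> X]mulr1; apply: cvgMr.
  have := @fine_cvg _ _ (+oo)%R _ _ 1 (cvg_cdfy1 X).
  exact.
Qed.

(** With [u = sqrt h], the exponent [a^2 u^2 + th^2 / u^2] equals [(a u - th/u)^2 + 2 a th] and also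
    [(a u + th/u)^2 - 2 a th]. The derivatives of the two arguments [w1] and [w2] add up to
    [2 a / u], so the combination [F] of the two Gaussian primitives has the integrand as its
    derivative. *)
Lemma integral_inverse_gauss (a th c : R) : 0 < a -> 0 <= th ->
  (\int[mu]_x (let h := 2 * x - c in
     if 0 < h then (Num.sqrt h)^-1 * expR (- (a ^+ 2 * h + th ^+ 2 / h) / 2) else 0)%:E
   = (Num.sqrt (2 * pi) / (2 * a) * expR (- (a * th)))%:E)%E.
Proof.
move=> a0 th0; have [E [dE Em Ep E0]] := gauss_primitive.
pose f (x : R) := (Num.sqrt (2 * x - c))^-1 *
  expR (- (a ^+ 2 * (2 * x - c) + th ^+ 2 / (2 * x - c)) / 2).
have cx0 (x : R) : (0 < 2 * x - c) = (c / 2 < x).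
  by rewrite ltr_pdivrMr // mulrC subr_gt0.
under eq_integral do rewrite /= cx0 -/(f _).
rewrite integral_patch_oy.
pose u (x : R) := Num.sqrt (2 * x - c).
pose w1 x := a * u x - th / u x; pose w2 x := a * u x + th / u x.
pose F x := (expR (- (a * th)) * E (w1 x) + expR (a * th) * E (w2 x)) / (2 * a).
have u0 x : c / 2 < x -> 0 < u x by rewrite -cx0 sqrtr_gt0.
have uu x : c / 2 < x -> 2 * x - c = u x ^+ 2.
  by rewrite -cx0 => cx; rewrite sqr_sqrtr // ltW.
have du x : c / 2 < x -> is_derive x 1 u (u x)^-1.
  move=> cx.
  have d1 : is_derive (2 * x - c) 1 Num.sqrt (2 * Num.sqrt (2 * x - c))^-1.
    by apply: is_derive1_sqrt; rewrite uu // exprn_gt0 // u0.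
  have d2 : is_derive x 1 (fun x : R => 2 * x - c) 2.
    by apply: is_derive_eq; rewrite /GRing.scale /=; ring.
  have d3 := @is_derive1_comp R Num.sqrt (fun x => 2 * x - c) x _ _ d1 d2.
  apply: is_derive_eq; rewrite -/(u x).
  by have := u0 _ cx; move=> /lt0r_neq0 ?; field.
have dv x : c / 2 < x -> is_derive x 1 (fun y => (u y)^-1) (- (u x) ^- 3).
  move=> cx; have d := @is_deriveV R u x (u x)^-1 1 (lt0r_neq0 (u0 _ cx)) (du _ cx).
  apply: is_derive_eq; rewrite /GRing.scale /=.
  by have := u0 _ cx; move=> /lt0r_neq0 ?; field.
have dw1 x : c / 2 < x -> is_derive x 1 w1 (a / u x + th / u x ^+ 3).
  move=> cx; have d1 := du _ cx; have d2 := dv _ cx.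
  apply: is_derive_eq; rewrite /GRing.scale /=.
  by have := u0 _ cx; move=> /lt0r_neq0 ?; field.
have dw2 x : c / 2 < x -> is_derive x 1 w2 (a / u x - th / u x ^+ 3).
  move=> cx; have d1 := du _ cx; have d2 := dv _ cx.
  apply: is_derive_eq; rewrite /GRing.scale /=.
  by have := u0 _ cx; move=> /lt0r_neq0 ?; field.
have fE x : c / 2 < x -> u x * f x = expR (- (a ^+ 2 * u x ^+ 2 + th ^+ 2 / u x ^+ 2) / 2).
  by move=> cx; rewrite /f -/(u x) mulrA mulfV ?mul1r ?lt0r_neq0 ?u0 // uu.
have e1 x : c / 2 < x -> expR (- (a * th)) * expR (- (w1 x ^+ 2) / 2) = u x * f x.
  move=> cx; rewrite fE // -expRD; congr expR; rewrite /w1.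
  by have := u0 _ cx; move=> /lt0r_neq0 ?; field.
have e2 x : c / 2 < x -> expR (a * th) * expR (- (w2 x ^+ 2) / 2) = u x * f x.
  move=> cx; rewrite fE // -expRD; congr expR; rewrite /w2.
  by have := u0 _ cx; move=> /lt0r_neq0 ?; field.
have dF x : c / 2 < x -> is_derive x 1 F (f x).
  move=> cx.
  have d1 := @is_derive1_comp R E w1 x _ _ (dE (w1 x)) (dw1 x cx).
  have d2 := @is_derive1_comp R E w2 x _ _ (dE (w2 x)) (dw2 x cx).
  apply: is_derive_eq; rewrite /GRing.scale /=.
  rewrite mulr0 add0r ![_ * (expR _ * _)]mulrA e1 // e2 //.
  have un := lt0r_neq0 (u0 _ cx); have an := lt0r_neq0 a0.
  field.
  by rewrite un an.
have uy (A : R) : \forall x \near +oo, A <= u x.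
  near=> x; have [A0|A0] := leP A 0; first exact: le_trans A0 (sqrtr_ge0 _).
  rewrite -(gtr0_norm A0) -sqrtr_sqr; apply: ler_wsqrtr.
  have : (A ^+ 2 + c) / 2 <= x by near: x; apply: nbhs_pinfty_ge; exact: num_real.
  by rewrite ler_pdivrMr // mulrC; lra.
have u0r (e : R) : 0 < e -> \forall x \near (c / 2)^'+, u x <= e.
  move=> e0; near=> x.
  rewrite -(gtr0_norm e0) -sqrtr_sqr; apply: ler_wsqrtr.
  have : x < c / 2 + e ^+ 2 / 2.
    by near: x; apply: nbhs_right_lt; rewrite ltrDl divr_gt0 // exprn_gt0.
  by lra.
have Fl : F x @[x --> +oo] --> (expR (- (a * th)) * Num.sqrt (2 * pi)
    + expR (a * th) * Num.sqrt (2 * pi)) / (2 * a).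
  apply: cvgMl; apply: cvgD; apply: cvgMr; apply: (cvg_comp _ _ _ Ep).
    apply/cvgryPge => A; near=> x.
    have ux1 : 1 <= u x by near: x; exact: uy.
    have uxA : (A + th) / a <= u x by near: x; exact: uy.
    have : th / u x <= th by rewrite ler_pdivrMr ?ler_peMr // (lt_le_trans _ ux1).
    by rewrite ler_pdivrMr // in uxA; rewrite /w1; lra.
  apply/cvgryPge => A; near=> x.
  have uxA : A / a <= u x by near: x; exact: uy.
  have : 0 <= th / u x by rewrite divr_ge0 // sqrtr_ge0.
  by rewrite ler_pdivrMr // in uxA; rewrite /w2; lra.
have Fm : F x @[x --> (c / 2)^'+] --> (expR (a * th) * Num.sqrt (2 * pi)) / (2 * a).
  (* For [th = 0] both arguments tend to 0 at the left end and the limit is [E 0 + E 0]; for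
     [th > 0] they tend to minus and plus infinity. *)
  apply: cvgMl; rewrite le_eqVlt in th0; case/orP: th0 => [/eqP th0|th0].
    rewrite -th0 mulr0 oppr0 expR0 mul1r.
    have w1E : w1 = fun x => a * u x.
      by apply/funext => x; rewrite /w1 -th0 mul0r subr0.
    have w2E : w2 = w1.
      by apply/funext => x; rewrite /w2 /w1 -th0 mul0r oppr0.
    have w0 : w1 x @[x --> (c / 2)^'+] --> 0.
      rewrite w1E -(mulr0 a); apply: cvgMr; apply: cvg_at_right_filter.
      rewrite -[X in _ --> X](_ : u (c / 2) = 0); last first.
        by rewrite /u mulrC divfK // subrr sqrtr0.
      apply: continuous_comp; last exact: sqrt_continuous.
      by apply: cvgB; [exact: mulrl_continuous|exact: cvg_cst].
    have cE : {for 0, continuous E}.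
      apply: differentiable_continuous; apply/derivable1_diffP.
      by have := dE 0 => -[].
    have Ew : E (w1 x) @[x --> (c / 2)^'+] --> E 0 by apply: continuous_cvg w0.
    rewrite -E0 w2E; apply: cvgD; rewrite -[X in _ --> X]mul1r; exact: cvgMr.
  rewrite -[X in _ --> X]add0r -(mulr0 (expR (- (a * th)))); apply: cvgD; apply: cvgMr.
    apply: (cvg_comp _ _ _ Em); apply/cvgrNyPle => A; near=> x.
    have ux1 : u x <= 1 by near: x; exact: u0r.
    have uxA : u x <= th / (a + `|A|).
      by near: x; apply: u0r; rewrite divr_gt0 // ltr_pwDl.
    have ux : 0 < u x by apply: u0; near: x; exact: nbhs_right_gt.
    have : a + `|A| <= th / u x.
      rewrite ler_pdivlMr //; move: uxA; rewrite ler_pdivlMr ?ltr_pwDl //.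
      by rewrite mulrC.
    have : a * u x <= a by rewrite ler_piMr // ltW.
    have : - A <= `|A| by rewrite -normrN ler_norm.
    by rewrite /w1; lra.
  apply: (cvg_comp _ _ _ Ep); apply/cvgryPge => A; near=> x.
  have uxA : u x <= th / (1 + `|A|).
    by near: x; apply: u0r; rewrite divr_gt0 // ltr_pwDl.
  have ux : 0 < u x by apply: u0; near: x; exact: nbhs_right_gt.
  have : 1 + `|A| <= th / u x.
    rewrite ler_pdivlMr //; move: uxA; rewrite ler_pdivlMr ?ltr_pwDl //.
    by rewrite mulrC.
  have : 0 <= a * u x by rewrite mulr_ge0 // ltW.
  have : A <= `|A| by exact: ler_norm.
  by rewrite /w2; lra.
rewrite (ge0_FTC_oy _ _ dF Fl Fm).
- by congr _%:E; field; rewrite lt0r_neq0.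
- move=> x cx; rewrite /f mulr_ge0 ?expR_ge0 // invr_ge0 sqrtr_ge0 //.
- move=> x; rewrite in_itv /= andbT => cx.
  have [h0 hn0] : 0 < 2 * x - c /\ 2 * x - c != 0.
    by rewrite cx0; split => //; rewrite lt0r_neq0 // cx0.
  have ch : {for x, continuous (fun x : R => 2 * x - c)}.
    by apply: cvgB; [exact: mulrl_continuous|exact: cvg_cst].
  rewrite /continuous_at /f; apply: cvgM.
    apply: cvgV; first by rewrite lt0r_neq0 // sqrtr_gt0.
    by apply: continuous_comp => //; exact: sqrt_continuous.
  apply: continuous_cvg; first exact: continuous_expR.
  apply: cvgMl; apply: cvgN; apply: cvgD; apply: cvgMr => //.
  exact: cvgV.
Unshelve. all: by end_near.
Qed.

End RealFunctions.

(** * Summation over the number of loops in a holding time *)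

Section LoopResummation.
Variable R : realType.
Notation mu := (@lebesgue_measure R).
Local Open Scope ereal_scope.

(** One more loop, at time [t] before [u]: the elementary convolution step that turns [(w u)^j / j!]
    into the next term of the exponential series. *)
Lemma integral_loop_monomial (w u : R) (j : nat) : (0 <= w)%R -> (0 < u)%R ->
  \int[mu]_t (if (0 < t < u)%R then (w * (exp_coeff (w * (u - t))%R j))%R else 0%R)%:E =
  (exp_coeff (w * u)%R j.+1)%:E.
Proof.
move=> w0 u0; pose f t := (w * (exp_coeff (w * (u - t)) j))%R.
have cf : continuous f.
  move=> t; apply: cvgMr; rewrite /exp_coeff /=; apply: cvgMl.
  apply: (@continuous_comp _ _ _ (fun t => w * (u - t))%R (fun x => x ^+ j)%R).
    by apply: cvgMr; apply: cvgB; [exact: cvg_cst|exact: cvg_id].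
  exact: exprn_continuous.
transitivity (\int[mu]_(t in `]0%R, u[) (f t)%:E).
  rewrite [RHS]integral_mkcond; apply: eq_integral => t _; rewrite patchE.
  by rewrite mem_setE in_itv /=; case: ifP.
rewrite -(@integral_itv_bndoo R 0%R u (fun t => (f t)%:E) true false); last first.
  apply/measurable_EFinP; apply: (@measurable_funTS _ _ _ _ `]0%R, u[%classic).
  exact: continuous_measurable_fun.
pose F t := (- (exp_coeff (w * (u - t)) j.+1))%R.
have dF (t : R) : is_derive t 1%R F (f t).
  have d1 : is_derive t 1%R (fun x : R => w * (u - x))%R (- w)%R.
    by apply: is_derive_eq; rewrite /GRing.scale /=; ring.
  have d2 := @is_deriveX _ R _ j.+1 t 1%R _ d1.
  have d3 := @is_deriveZ _ R R _ (- (j.+1`!%:R)^-1)%R t 1%R _ d2.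
  rewrite (_ : F = - (j.+1`!%:R)^-1 \*: ((fun x : R => w * (u - x)) ^+ j.+1))%R; last first.
    apply/funext => x; rewrite /F /exp_coeff /=.
    by rewrite exprfctE /GRing.scale /= mulNr mulrC.
  apply: is_derive_eq; rewrite /GRing.scale /= /f /exp_coeff /= factS natrM.
  have jn : (j.+1%:R != 0 :> R)%R by rewrite pnatr_eq0.
  have fn : (j`!%:R != 0 :> R)%R by rewrite pnatr_eq0 -lt0n fact_gt0.
  by move: jn fn; move: (j.+1%:R)%R (j`!%:R)%R => p q p0 q0; field; rewrite p0 q0.
rewrite (@continuous_FTC2 _ f F 0%R u) //.
- rewrite -EFinB; congr _%:E; rewrite /F /exp_coeff /= subrr mulr0 expr0n /=.
  by rewrite subr0 mul0r oppr0 sub0r opprK.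
- by apply: continuous_subspaceT.
- have cF : continuous F.
    move=> t; apply: differentiable_continuous; apply/derivable1_diffP.
    by have [] := dF t.
  split; first by move=> t _; have [] := dF t.
    by apply: cvg_at_right_filter; exact: cF.
  by apply: cvg_at_left_filter; exact: cF.
- by move=> t _; rewrite derive1E; have [] := dF t.
Qed.

(** A renewal inequality: from elapsed time [s], either a loop at rate [w] restarts [c], or the jump
    weight [k] is collected. Iterating it [M] times bounds the contributions of fewer than [M] loops
    by [c s], and these contributions sum to the exponential. *)
Lemma le_loop_resummation (w : R) (c k : R -> \bar R) : (0 <= w)%R ->
  measurable_fun setT c -> measurable_fun setT k ->
  (forall s, 0 <= c s) -> (forall s, 0 <= k s) ->
  (forall s, \int[mu]_t (if (0 < t)%R then w%:E * c (s + t)%R + k (s + t)%R else 0) <= c s) ->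
  forall s, \int[mu]_t (if (0 < t)%R then (expR (w * t))%:E * k (s + t)%R else 0) <= c s.
Proof.
move=> w0 mc mk c0 k0 Hc.
(* The contribution of exactly [j] loops, whose times integrate to [(w t)^j / j!]. *)
pose T j s := \int[mu]_t (if (0 < t)%R then (exp_coeff (w * t)%R j)%:E * k (s + t)%R else 0).
have ec0 j (x : R) : (0 <= x -> 0 <= exp_coeff x j)%R by exact: exp_coeff_ge0.
have mec j : measurable_fun setT (fun t : R => exp_coeff (w * t)%R j).
  rewrite /exp_coeff /=; apply: measurable_funM => //.
  by apply: measurable_funX; exact: measurable_funM.
have mpos d (X : measurableType d) (t : X -> R) (g : X -> \bar R) :
    measurable_fun setT t -> measurable_fun setT g ->
    measurable_fun setT (fun x => if (0 < t x)%R then g x else 0 : \bar R).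
  move=> mt mg; apply: measurable_fun_ifT => //.
  exact: measurable_fun_ltr.
have mT2 j : measurable_fun setT (fun p : R * R =>
    if (0 < p.2)%R then (exp_coeff (w * p.2)%R j)%:E * k (p.1 + p.2)%R else 0 : \bar R).
  apply: mpos => //; apply: emeasurable_funM.
    by apply/measurable_EFinP; exact: (measurableT_comp (mec j) measurable_snd).
  by apply: (measurableT_comp mk); exact: measurable_funD.
have T2_0 j (p : R * R) :
    0 <= if (0 < p.2)%R then (exp_coeff (w * p.2)%R j)%:E * k (p.1 + p.2)%R else 0 : \bar R.
  case: ifPn => // p0; rewrite mule_ge0 // lee_fin ec0 // mulr_ge0 // ltW //.
have T0 j s : 0 <= T j s by apply: integral_ge0 => t _; exact: (T2_0 j (s, t)).
have mT j : measurable_fun setT (T j).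
  exact: (measurable_fun_fubini_tonelli_F (m2 := mu) _ (mT2 j) (T2_0 j)).
have mshift (s : R) (g : R -> \bar R) : measurable_fun setT g ->
    measurable_fun setT (fun t : R => g (s + t)%R).
  by move=> mg; apply: (measurableT_comp mg); exact: measurable_funD.
(* Decomposition at the time [t] of the first loop; the jump occurs at [u > t], and Tonelli over the
   pairs [t < u] leaves [T j] started at [s + t]. *)
have TS j s : T j.+1 s = \int[mu]_t (if (0 < t)%R then w%:E * T j (s + t)%R else 0).
  pose G (p : R * R) := if (0 < p.1 < p.2)%R
    then (w * exp_coeff (w * (p.2 - p.1)) j)%:E * k (s + p.2)%R else 0.
  have mG : measurable_fun setT G.
    apply: measurable_fun_ifT => //.
      by apply: measurable_and; exact: measurable_fun_ltr.
    apply: emeasurable_funM.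
      apply/measurable_EFinP; apply: measurable_funM => //.
      by apply: (measurableT_comp (mec j)); exact: measurable_funB.
    by apply: (measurableT_comp mk); exact: measurable_funD.
  have G0 p : 0 <= G p.
    rewrite /G; case: ifPn => // /andP[p1 p2]; rewrite mule_ge0 // lee_fin mulr_ge0 //.
    by rewrite ec0 // mulr_ge0 // subr_ge0 ltW.
  transitivity (\int[mu]_u \int[mu]_t G (t, u)).
    apply: eq_integral => u _; rewrite /G /=; case: ifPn => u0; last first.
      rewrite integral0_eq // => t _; case: ifPn => // /andP[t0 tu].
      by rewrite (lt_trans t0 tu) in u0.
    rewrite -(integral_loop_monomial j w0 u0) muleC -ge0_integralZl //.
    - apply: eq_integral => t _; case: ifP => _; rewrite ?mule0 //.
      by rewrite muleC.
    - apply/measurable_EFinP; apply: measurable_fun_ifT => //.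
        by apply: measurable_and; exact: measurable_fun_ltr.
      apply: measurable_funM => //; apply: (measurableT_comp (mec j)).
      exact: measurable_funB.
    - move=> t _; case: ifPn => // /andP[t0 tu].
      by rewrite lee_fin mulr_ge0 // ec0 // mulr_ge0 // subr_ge0 ltW.
  rewrite -(fubini_tonelli (m1 := mu) (m2 := mu) G) //.
  apply: eq_integral => t _; case: ifPn => t0; last first.
    by rewrite integral0_eq // => u _; rewrite /G /= (negbTE t0).
  rewrite /T -ge0_integralZl //; last 2 first.
  - exact: (measurableT_comp (mT2 j) (measurable_pair1 (s + t)%R)).
  - by move=> u _; exact: (T2_0 j (s + t, u)%R).
  rewrite -[RHS](ge0_integral_shift (- t)%R).
  - apply: eq_integral => u _; rewrite /G /= t0 /= subr_gt0 addrA.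
    case: ifP => _; rewrite ?mule0 //.
    rewrite muleA -EFinM; congr (_ * k _); ring.
  - apply: emeasurable_funM => //.
    exact: (measurableT_comp (mT2 j) (measurable_pair1 (s + t)%R)).
  - by move=> u; rewrite mule_ge0 //; exact: (T2_0 j (s + t, u)%R).
have claim M s : \sum_(j < M) T j s <= c s.
  elim: M s => [|M IH] s; first by rewrite big_ord0.
  rewrite big_ord_recl; apply: le_trans (Hc s).
  have -> : \int[mu]_t (if (0 < t)%R then w%:E * c (s + t)%R + k (s + t)%R else 0) =
      T 0%N s + \int[mu]_t (if (0 < t)%R then w%:E * c (s + t)%R else 0).
    rewrite /T -ge0_integralD //.
    - apply: eq_integral => t _; case: ifP => _; rewrite ?adde0 //.
      by rewrite /exp_coeff /= expr0 divr1 mul1e addeC.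
    - by move=> t _; exact: (T2_0 0%N (s, t)).
    - exact: (measurableT_comp (mT2 0%N) (measurable_pair1 s)).
    - by move=> t _; case: ifP => // _; rewrite mule_ge0.
    - by apply: mpos => //; apply: emeasurable_funM => //; exact: mshift.
  apply: leeD => //.
  under eq_bigr do rewrite TS.
  rewrite -ge0_integral_sum //; last 2 first.
  - by move=> j; apply: mpos => //; apply: emeasurable_funM => //; exact: mshift.
  - by move=> j t _; case: ifP => // _; rewrite mule_ge0.
  apply: ge0_le_integral => //.
  - by move=> t _; apply: sume_ge0 => j _; case: ifP => // _; rewrite mule_ge0.
  - apply: emeasurable_sum => j.
    by apply: mpos => //; apply: emeasurable_funM => //; exact: mshift.
  - by apply: mpos => //; apply: emeasurable_funM => //; exact: mshift.
  - move=> t _; case: ifP => _; last by rewrite big1.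
    by rewrite -ge0_sume_distrr //; apply: lee_wpmul2l => //; exact: IH.
move=> s.
apply: (@le_trans _ _ (\sum_(j <oo) T j s)).
  rewrite /T -integral_nneseries //; last 2 first.
  - by move=> j; exact: (measurableT_comp (mT2 j) (measurable_pair1 s)).
  - by move=> j t _; exact: (T2_0 j (s, t)).
  apply: ge0_le_integral => //.
  - by move=> t _; case: ifP => // _; rewrite mule_ge0 // lee_fin expR_ge0.
  - apply: mpos => //; apply: emeasurable_funM; last exact: mshift.
    apply/measurable_EFinP; apply: (measurableT_comp (@measurable_expR R)).
    exact: measurable_funM.
  - apply: ge0_emeasurable_sum; first by move=> j t _ _; exact: (T2_0 j (s, t)).
    by move=> j _; exact: (measurableT_comp (mT2 j) (measurable_pair1 s)).
  - move=> t _; case: ifPn => [t0|_]; last by rewrite eseries0.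
    have wt0 : (0 <= w * t)%R by rewrite mulr_ge0 // ltW.
    case: (k (s + t)%R) (k0 (s + t)%R) => [r r0| _|//].
      under eq_eseriesr do rewrite muleC.
      rewrite nneseriesZl; last by move=> j _; rewrite lee_fin ec0.
      rewrite muleC; apply: lee_wpmul2l => //.
      rewrite (_ : expR (w * t) = limn (series (exp_coeff (w * t)%R))) //.
      rewrite -EFin_lim; last exact: is_cvg_series_exp_coeff.
      rewrite (_ : _ \o _ = fun n => \sum_(0 <= i < n) (exp_coeff (w * t)%R i)%:E) //.
      by apply/funext => n; rewrite /series /= sumEFin.
    (* Where [k] is infinite, the term without loops is already infinite. *)
    apply: (@le_trans _ _ (\sum_(0 <= j < 1) (exp_coeff (w * t)%R j)%:E * +oo)).
      by rewrite big_nat1 /exp_coeff /= expr0 divr1 mul1e leey.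
    by apply: nneseries_lim_ge => j _ _; rewrite mule_ge0 // lee_fin ec0.
apply: lime_le; first by apply: is_cvg_nneseries => j _ _; exact: T0.
by apply: nearW => M; rewrite big_mkord; exact: claim.
Qed.
End LoopResummation.

(** * Elimination of vertices *)

Section Elimination.
Variables (R : realType) (V : finType).
Implicit Types (W M : V -> V -> R) (b x : V -> R) (s : seq V).

(* Schur complement of the vertex [v] with pivot [h], acting on the weights *)
Definition elim (v : V) (h : R) (W : V -> V -> R) : V -> V -> R :=
  fun i j => W i j + W i v * W v j / h.

Definition pivot W b v : R := 2 * b v - W v v.

Fixpoint elimS s b W : V -> V -> R :=
  if s is v :: s' then elimS s' b (elim v (pivot W b v) W) else W.

(** Boolean form of positive definiteness of the block [s] of [Hb W b] (see [posdefS_piv]); being a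
    conjunction of inequalities between rational expressions in [b], it is measurable. *)
Fixpoint pivS s b W : bool :=
  if s is v :: s' then (0 < pivot W b v) && pivS s' b (elim v (pivot W b v) W) else true.

(** For [eta >= 0], the reciprocal inverse Gaussian density of the pivot [h = 2 b - W v v], taken
    with respect to [b]; the exponent is minus half the square of [sqrt h - eta / sqrt h]. *)
Definition igauss (eta h : R) : R :=
  Num.sqrt (2 / pi) * ((Num.sqrt h)^-1 * expR (- (h - 2 * eta + eta ^+ 2 / h) / 2)).

(* The density of [nu^W] factored along the elimination of the vertices of [s] (see [nu_densE]). *)
Fixpoint nuS s W b : R :=
  if s is v :: s' then
    let h := pivot W b v in
    if 0 < h then igauss (\sum_(j <- s') W v j) h * nuS s' (elim v h W) b else 0
  else 1.

Definition quadS s M x : R := \sum_(i <- s) \sum_(j <- s) x i * M i j * x j.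

Definition posdefS s M : Prop := forall x, (exists2 i, i \in s & x i != 0) -> 0 < quadS s M x.

Lemma elim_sym v h W : (forall i j, W i j = W j i) -> forall i j, elim v h W i j = elim v h W j i.
Proof. by move=> Ws i j; rewrite /elim Ws (Ws i v) (Ws v j) [W v i * _]mulrC. Qed.

Lemma elim_ge0 v h W : 0 < h -> (forall i j, 0 <= W i j) -> forall i j, 0 <= elim v h W i j.
Proof.
by move=> h0 W0 i j; rewrite /elim addr_ge0 // divr_ge0 ?mulr_ge0 // ltW.
Qed.

Lemma elimS_sym s b W : (forall i j, W i j = W j i) ->
  forall i j, elimS s b W i j = elimS s b W j i.
Proof. by elim: s W => //= v s IH W Ws; apply: IH; exact: elim_sym. Qed.

Lemma elimS_ge0 s b W : pivS s b W -> (forall i j, 0 <= W i j) ->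
  forall i j, 0 <= elimS s b W i j.
Proof.
by elim: s W => //= v s IH W /andP[h0 ps] W0; apply: IH => //; exact: elim_ge0.
Qed.

Lemma Hb_elim v h W b i j : i != v -> j != v -> h = pivot W b v ->
  Hb (elim v h W) b i j = Hb W b i j - Hb W b i v * Hb W b v j / h.
Proof.
move=> iv jv ->; rewrite /Hb /elim (negbTE iv) (eq_sym v) (negbTE jv) !mulr0 !mul0r !sub0r.
by rewrite mulrNN; ring.
Qed.

(* completing the square in the coordinate [v] *)
Lemma quadS_cons v s W b x : v \notin s -> (forall i j, W i j = W j i) ->
  pivot W b v != 0 ->
  quadS (v :: s) (Hb W b) x =
  pivot W b v * (x v - (\sum_(j <- s) W v j * x j) / pivot W b v) ^+ 2 +
  quadS s (Hb (elim v (pivot W b v) W) b) x.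
Proof.
move=> vs Ws; set h := pivot W b v => h0; set S := \sum_(j <- s) W v j * x j.
have Hvj j : j \in s -> Hb W b v j = - W v j.
  move=> js; have /negbTE vj : v != j by apply: contraNneq vs => ->.
  by rewrite /Hb vj mulr0 mul0r sub0r.
have Hjv j : j \in s -> Hb W b j v = - W v j.
  move=> js; have /negbTE vj : j != v by apply: contraNneq vs => <-.
  by rewrite /Hb vj mulr0 mul0r sub0r Ws.
have E1 : \sum_(j <- s) x v * Hb W b v j * x j = - (x v * S).
  rewrite /S mulr_sumr -sumrN; apply: eq_big_seq => j js.
  by rewrite Hvj //; ring.
have E2 : \sum_(i <- s) x i * Hb W b i v * x v = - (x v * S).
  rewrite /S mulr_sumr -sumrN; apply: eq_big_seq => j js.
  by rewrite Hjv //; ring.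
have E3 : quadS s (Hb (elim v h W) b) x = quadS s (Hb W b) x - S ^+ 2 / h.
  rewrite /quadS expr2 /S mulr_suml mulr_suml -sumrB; apply: eq_big_seq => i is_.
  rewrite mulr_sumr mulr_suml -sumrB; apply: eq_big_seq => j js.
  rewrite (@Hb_elim v h) ?Hvj ?Hjv //; last 2 first.
  - by apply: contraNneq vs => <-.
  - by apply: contraNneq vs => <-.
  by ring.
rewrite E3 {1}/quadS big_cons big_cons E1.
under [X in _ + X = _]eq_bigr do rewrite big_cons.
rewrite big_split /= E2 -/(quadS s (Hb W b) x).
have -> : Hb W b v v = h by rewrite /Hb eqxx mulr1.
by field.
Qed.

(** Completing the square separates the coordinate [v] from a form in the other coordinates, so
    positivity can be tested one pivot at a time. *)
Lemma posdefS_piv s W b : uniq s -> (forall i j, W i j = W j i) ->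
  (posdefS s (Hb W b) <-> pivS s b W).
Proof.
elim: s W => [|v s IH] W /=; first by move=> _ _; split=> // _ x [i].
move=> /andP[vs us] Ws; split.
  move=> pd.
  have h0 : 0 < pivot W b v.
    have := pd (fun i => (i == v)%:R); rewrite /quadS => /(_ _).
    rewrite big_cons big_cons eqxx !mul1r !mulr1.
    rewrite big1_seq; last first.
      move=> j /andP[_ js]; rewrite (_ : (j == v) = false) ?mulr0 //.
      by apply/negbTE; apply: contraNneq vs => <-.
    rewrite big1_seq; last first.
      move=> i /andP[_ is_]; rewrite big1 // => j _.
      rewrite (_ : (i == v) = false) ?mul0r //.
      by apply/negbTE; apply: contraNneq vs => <-.
    rewrite !addr0 /Hb eqxx mulr1 => -> //.
    by exists v; rewrite ?mem_head // eqxx oner_neq0.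
  rewrite h0; apply/(IH _ us); first exact: elim_sym.
  move=> x [i is_ xi0].
  (* The value at [v] is the one that makes the completed square vanish. *)
  pose y j := if j == v then (\sum_(j <- s) W v j * x j) / pivot W b v else x j.
  have ys j : j \in s -> y j = x j.
    by move=> js; rewrite /y (_ : (j == v) = false) //; apply/negbTE; apply: contraNneq vs => <-.
  have := pd y; rewrite quadS_cons ?lt0r_neq0 // => /(_ _).
  rewrite (_ : y v - _ = 0); last first.
    rewrite {1}/y eqxx; apply/eqP; rewrite subr_eq0; apply/eqP; congr (_ / _).
    by apply: eq_big_seq => j js; rewrite ys.
  rewrite expr0n mulr0 add0r.
  rewrite (_ : quadS s _ y = quadS s (Hb (elim v (pivot W b v) W) b) x); last first.
    by apply: eq_big_seq => j js; apply: eq_big_seq => k ks; rewrite !ys.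
  by apply; exists i; rewrite ?inE ?is_ ?orbT // ys.
move=> /andP[h0 ps] x [i is_ xi0]; rewrite quadS_cons ?lt0r_neq0 //.
have pd := (IH _ us (elim_sym v (pivot W b v) Ws)).2 ps.
case: (pselect (exists2 j, j \in s & x j != 0)) => [xs|nxs].
  by rewrite ltr_wpDl ?pd // mulr_ge0 ?sqr_ge0 // ltW.
have xs0 j : j \in s -> x j = 0.
  by move=> js; apply/eqP/negPn/negP => xj; apply: nxs; exists j.
have iv : i = v.
  move: is_; rewrite inE => /orP[/eqP //|/xs0 xi]; by rewrite xi eqxx in xi0.
rewrite ltr_pwDl //.
  rewrite big1_seq ?mul0r ?subr0; last by move=> j /andP[_ /xs0 ->]; rewrite mulr0.
  by rewrite mulr_gt0 // lt0r sqr_ge0 andbT expf_eq0 /= -iv.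
rewrite /quadS big1_seq // => j /andP[_ js]; rewrite big1 // => k _.
by rewrite xs0 // !mul0r.
Qed.

(** A block of [M] along an ordered tuple, which allows expanding a determinant one vertex at a
    time; [subM] fixes the enumeration instead. *)
Definition mxT n (t : n.-tuple V) M : 'M[R]_n := \matrix_(i, j) M (tnth t i) (tnth t j).

(** Multiplication on the right by a unit upper triangular block matrix clears the first row and
    leaves the Schur complement. *)
Lemma det_mxT_cons n v (t : n.-tuple V) M : M v v != 0 ->
  \det (mxT (cons_tuple v t) M) =
  M v v * \det (mxT t (fun i j => M i j - M i v * M v j / M v v)).
Proof.
move=> a0; set a := M v v in a0 *.
pose r : 'rV[R]_n := \row_j M v (tnth t j); pose c : 'cV[R]_n := \col_i M (tnth t i) v.
have EA : (mxT (cons_tuple v t) M : 'M[R]_(1 + n)) = block_mx a%:M r c (mxT t M).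
  apply/matrixP => i j; rewrite !mxE !(tnth_nth v).
  case: splitP => i' ii'; rewrite !mxE; case: splitP => j' jj'; rewrite !mxE ?(tnth_nth v) ii' jj' /=.
  - by rewrite !ord1.
  - by rewrite ord1.
  - by rewrite ord1.
  - by [].
have EB : block_mx a%:M r c (mxT t M) *m block_mx 1%:M (- a^-1 *: r) 0 1%:M =
    block_mx a%:M 0 c (mxT t (fun i j => M i j - M i v * M v j / M v v)).
  rewrite mulmx_block !mulmx1 !mulmx0 !addr0; congr block_mx.
    by rewrite -scalemxAr mul_scalar_mx scalerA mulNr mulVf // scaleN1r addNr.
  rewrite -scalemxAr; apply/matrixP => i j; rewrite !mxE big_ord1 !mxE -/a.
  by field.
have := congr1 (fun A => \det A) EB.
by rewrite det_mulmx det_ublock !det1 !mulr1 det_lblock det_scalar expr1 -EA.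
Qed.

Lemma det_mxT_perm n (t t' : n.-tuple V) M : perm_eq t t' ->
  \det (mxT t M) = \det (mxT t' M).
Proof.
move=> /tuple_permP [p tE].
have tt i : tnth t i = tnth t' (p i).
  have -> : t = [tuple tnth t' (p i) | i < n] by apply: val_inj.
  by rewrite tnth_mktuple.
have -> : mxT t M = row_perm p (col_perm p (mxT t' M)).
  by apply/matrixP => i j; rewrite !mxE !tt.
rewrite row_permE col_permE !det_mulmx !det_perm odd_permV mulrCA.
by rewrite -signr_addb addbb mulr1.
Qed.

Lemma posdef_mxT n (t : n.-tuple V) M : uniq t -> posdef (mxT t M) <-> posdefS t M.
Proof.
move=> ut.
have quadE (v : 'cV[R]_n) x : (forall i, x (tnth t i) = v i ord0) ->
    (v^T *m mxT t M *m v) ord0 ord0 = quadS t M x.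
  move=> xv; rewrite /quadS big_tuple mxE.
  under eq_bigr => j _ do rewrite mxE mulr_suml.
  rewrite exchange_big /=; apply: eq_bigr => i _; rewrite big_tuple.
  by apply: eq_bigr => j _; rewrite !mxE !xv.
split=> pd.
  move=> x [i /tnthP [k ->] xk].
  pose v : 'cV[R]_n := \col_i x (tnth t i).
  rewrite -(quadE v); last by move=> j; rewrite mxE.
  apply: pd; apply: contraNneq xk => v0.
  by have := congr1 (fun A : 'cV_n => A k ord0) v0; rewrite /v !mxE => ->.
move=> v v0.
pose x u := if [pick i | tnth t i == u] is Some i then v i ord0 else 0.
have xv i : x (tnth t i) = v i ord0.
  rewrite /x; case: pickP => [j /eqP /(tuple_uniqP _ ut) -> //|/(_ i)].
  by rewrite eqxx.
rewrite (quadE v x xv); apply: pd.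
have /existsP [i vi] : [exists i, v i ord0 != 0].
  apply: contraNT v0; rewrite negb_exists => /forallP v0.
  by apply/eqP/matrixP => i j; rewrite ord1 mxE; apply/eqP/negPn; exact: v0.
by exists (tnth t i); rewrite ?mem_tnth // xv.
Qed.

Lemma nuS_piv0 s W b : ~~ pivS s b W -> nuS s W b = 0.
Proof.
elim: s W => //= v s IH W; rewrite negb_and; case: ifP => //= _ ps.
by rewrite IH ?mulr0.
Qed.

(** Each elimination splits one pivot off the determinant and one square off the quadratic form at
    the all-ones vector; together they are one factor [igauss]. *)
Lemma det_gt0_piv n (t : n.-tuple V) W b : uniq t -> (forall i j, W i j = W j i) ->
  pivS t b W -> 0 < \det (mxT t (Hb W b)) /\
  nuS t W b = Num.sqrt (2 / pi) ^+ n * expR (- (quadS t (Hb W b) (fun=> 1)) / 2) /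
    Num.sqrt (\det (mxT t (Hb W b))).
Proof.
elim: n t W => [|n IH] t W.
  rewrite tuple0 /= => _ _ _; rewrite det_mx00 ltr01; split => //.
  by rewrite /quadS big_nil oppr0 mul0r expR0 sqrtr1 divr1 mulr1.
case/tupleP: t => v t; set h := pivot W b v => /= /andP[vt ut] Ws /andP[h0 ps].
have [d0 nuE] := IH t _ ut (elim_sym v h Ws) ps.
have dE : \det (mxT [tuple of v :: t] (Hb W b)) = h * \det (mxT t (Hb (elim v h W) b)).
  have hE : Hb W b v v = h by rewrite /Hb eqxx mulr1.
  rewrite det_mxT_cons ?hE ?lt0r_neq0 //; congr (_ * \det _).
  have tv i : tnth t i != v by apply: contraNneq vt => <-; exact: mem_tnth.
  by apply/matrixP => i j; rewrite !mxE (@Hb_elim v h).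
rewrite dE mulr_gt0 //; split => //.
rewrite -/h h0 nuE quadS_cons ?lt0r_neq0 // -/h [Num.sqrt (h * _)]sqrtrM ?ltW //.
rewrite /igauss; under eq_bigr do rewrite -[W v _]mulr1.
set S := \sum_(j <- t) _; set Q := quadS t _ _.
have -> : - (h * (1 - S / h) ^+ 2 + Q) / 2 = - (h - 2 * S + S ^+ 2 / h) / 2 + - Q / 2.
  by field; rewrite lt0r_neq0.
rewrite expRD [_ ^+ n.+1]exprS invfM; ring.
Qed.

(** As [s] is an arbitrary enumeration of [V], this also shows that [nuS] does not depend on the
    order of elimination, which permits eliminating [I] before [J]. *)
Lemma nu_densE s W b : perm_eq s (enum V) -> (forall i j, W i j = W j i) ->
  nu_dens W b = nuS s W b.
Proof.
move=> sV Ws; have us : uniq s by rewrite (perm_uniq sV) enum_uniq.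
rewrite /nu_dens.
pose t0 := enum_tuple (finset.setT : {set V}).
have HE : subM finset.setT (Hb W b) = mxT t0 (Hb W b).
  by apply/matrixP => i j; rewrite !mxE !(tnth_nth (enum_default i)) -!enum_val_nth.
have t0s : perm_eq t0 s.
  by rewrite perm_sym (perm_trans sV) //= enum_setT -enumT.
have ut0 : uniq t0 by rewrite (perm_uniq t0s).
have st : size s == #|(finset.setT : {set V})| by rewrite -(perm_size t0s) size_tuple.
pose t : #|(finset.setT : {set V})|.-tuple V := Tuple st.
have pdE : posdef (subM finset.setT (Hb W b)) <-> pivS s b W.
  rewrite HE (posdef_mxT _ ut0) -(posdefS_piv b us Ws) /posdefS.
  have qE x : quadS t0 (Hb W b) x = quadS s (Hb W b) x.
    rewrite /quadS (perm_big _ t0s); apply: eq_bigr => i _.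
    by rewrite (perm_big _ t0s).
  split=> pd x [i is_ xi]; [rewrite -qE|rewrite qE]; apply: pd; exists i => //.
    by rewrite (perm_mem t0s).
  by rewrite -(perm_mem t0s).
case: asboolP => [/pdE ps|nps]; last first.
  by rewrite nuS_piv0 //; apply/negP => /pdE.
have [_ ->] := @det_gt0_piv _ t W b us Ws ps.
rewrite HE (det_mxT_perm _ (t0s : perm_eq t0 t)) ; congr (_ ^+ _ * expR (- _ / _) / _).
  by rewrite cardsT.
rewrite /quadS /= (perm_big _ sV) big_enum /=; apply: eq_bigr => i _.
rewrite (perm_big _ sV) big_enum /=; apply: eq_bigr => j _.
by rewrite mul1r mulr1.
Qed.

Lemma posdef_subMP (S : {set V}) W b : (forall i j, W i j = W j i) ->
  posdef (subM S (Hb W b)) <-> pivS (enum S) b W.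
Proof.
move=> Ws; rewrite -(posdefS_piv b (enum_uniq S) Ws).
rewrite -(@posdef_mxT _ (enum_tuple S)) ?enum_uniq //.
suff -> : subM S (Hb W b) = mxT (enum_tuple S) (Hb W b) by [].
by apply/matrixP => i j; rewrite !mxE !(tnth_nth (enum_default i)) -!enum_val_nth.
Qed.

(** [X] is the column of [inv (H_ss) W_s] at [j], obtained by back substitution. Stating it as a
    linear system avoids matrices later on, and nonnegativity is visible at each substitution. *)
Lemma elimS_solve s b W j : uniq s -> (forall i k, W i k = W k i) ->
  (forall i k, 0 <= W i k) -> pivS s b W -> j \notin s ->
  exists X : V -> R, [/\ forall a, a \in s -> 0 <= X a,
    forall a, a \in s -> 2 * b a * X a = W a j + \sum_(c <- s) W a c * X c &
    forall i, i \notin s -> elimS s b W i j = W i j + \sum_(c <- s) W i c * X c].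
Proof.
elim: s W => [|v s IH] W /=.
  by move=> _ _ _ _ _; exists (fun=> 0); split => // i _; rewrite big_nil addr0.
move=> /andP[vs us] Ws W0 /andP[h0 ps]; set h := pivot W b v in h0 ps *.
rewrite inE negb_or => /andP[jv js].
have [X [X0 Xeq XE]] := IH _ us (elim_sym v h Ws) (elim_ge0 v h0 W0) ps js.
(* The row of [v] in the system, solved for its own unknown. *)
pose Y v' := if v' == v then (W v j + \sum_(c <- s) W v c * X c) / h else X v'.
have Yv : Y v = (W v j + \sum_(c <- s) W v c * X c) / h by rewrite /Y eqxx.
have Ys a : a \in s -> Y a = X a.
  by move=> as_; rewrite /Y ifN //; apply: contraNneq vs => <-.
have sumY i : \sum_(c <- v :: s) W i c * Y c = W i v * Y v + \sum_(c <- s) W i c * X c.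
  rewrite big_cons; congr (_ + _); apply: eq_big_seq => c cs.
  by rewrite Ys.
have sumE i : \sum_(c <- s) elim v h W i c * X c =
    \sum_(c <- s) W i c * X c + W i v / h * \sum_(c <- s) W v c * X c.
  rewrite mulr_sumr -big_split /=; apply: eq_bigr => c _; rewrite /elim; ring.
exists Y; split.
- move=> a; rewrite inE => /orP[/eqP ->|as_]; last by rewrite Ys // X0.
  rewrite Yv divr_ge0 ?(ltW h0) // addr_ge0 // big_seq sumr_ge0 // => c cs.
  by rewrite mulr_ge0 // X0.
- move=> a; rewrite inE sumY => /orP[/eqP ->|as_].
    have -> : 2 * b v = h + W v v by rewrite /h /pivot subrK.
    by rewrite Yv; field; rewrite lt0r_neq0.
  rewrite Ys // Xeq // sumE Yv /elim; ring.
- move=> i; rewrite inE negb_or => /andP[iv is_].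
  rewrite XE // sumE sumY Yv /elim; ring.
Qed.

(** The quadratic form vanishes on the difference of two solutions. *)
Lemma solve_unique s b W (Y Z : V -> R) : posdefS s (Hb W b) -> uniq s ->
  (forall a, a \in s -> 2 * b a * Y a - \sum_(c <- s) W a c * Y c =
                        2 * b a * Z a - \sum_(c <- s) W a c * Z c) ->
  forall a, a \in s -> Y a = Z a.
Proof.
move=> pd us YZ a as_; apply/eqP/negPn/negP => neq.
have neq' : Y a - Z a != 0 by rewrite subr_eq0.
have := pd (fun c => Y c - Z c) (ex_intro2 _ _ a as_ neq').
have -> : quadS s (Hb W b) (fun c => Y c - Z c) = 0.
  rewrite /quadS big_seq big1 // => i is_.
  have -> : \sum_(j <- s) (Y i - Z i) * Hb W b i j * (Y j - Z j) =
     (Y i - Z i) * ((2 * b i * Y i - \sum_(c <- s) W i c * Y c) -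
                    (2 * b i * Z i - \sum_(c <- s) W i c * Z c)).
    have D1 (T : V -> R) : \sum_(j <- s) 2 * (i == j)%:R * b i * T j = 2 * b i * T i.
      rewrite (bigD1_seq i) //= eqxx big1 ?addr0 ?mulr1 // => j ji.
      by rewrite eq_sym (negbTE ji) mulr0 !mul0r.
    rewrite -(D1 Y) -(D1 Z) -!sumrB mulr_sumr; apply: eq_bigr => j _.
    by rewrite /Hb; ring.
  by rewrite YZ // subrr mulr0.
by rewrite ltxx.
Qed.

(** The solution [X] of the elimination solves the matrix system as well, and positive definiteness
    makes the matrix invertible, so [X] is the column that the inverse produces. *)
Lemma WJ_elimS (I J : {set V}) W b (i j : {x : V | x \in J}) : (forall v, v \in J -> v \notin I) ->
  (forall i k, W i k = W k i) -> (forall i k, 0 <= W i k) ->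
  posdef (subM I (Hb W b)) ->
  WJ W I b i j = elimS (enum I) b W (val i) (val j).
Proof.
move=> dIJ Ws W0 pd.
have ps : pivS (enum I) b W by apply/posdef_subMP.
have nI (k : {x : V | x \in J}) : val k \notin enum I.
  by rewrite mem_enum dIJ //; exact: valP.
have [X [_ Xeq ->]] := elimS_solve (enum_uniq I) Ws W0 ps (nI j); last exact: nI.
have sumI (f : V -> R) : \sum_(c <- enum I) f c = \sum_(c < #|I|) f (enum_val c).
  by rewrite big_enum /= big_enum_val.
rewrite /WJ; congr (_ + _); rewrite sumI; apply: eq_bigr => a _.
set H := subM I (Hb W b) in pd *.
have uH : H \in unitmx.
  apply/negPn/negP; rewrite -row_free_unit -kermx_eq0 => /rowV0Pn [v /sub_kermxP vH v0].
  have := pd v^T; rewrite -trmx_eq0 trmxK v0 => /(_ isT).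
  by rewrite vH mul0mx mxE ltxx.
pose x : 'cV[R]_#|I| := \col_c X (enum_val c).
pose w : 'cV[R]_#|I| := \col_c W (enum_val c) (val j).
have Hx : H *m x = w.
  apply/matrixP => c k; rewrite !mxE.
  have := Xeq (enum_val c); rewrite mem_enum enum_valP sumI => /(_ isT) E.
  rewrite (eq_bigr (fun d => 2 * (c == d)%:R * b (enum_val c) * X (enum_val d)
      - W (enum_val c) (enum_val d) * X (enum_val d))); last first.
    by move=> d _; rewrite !mxE /Hb (inj_eq enum_val_inj); ring.
  rewrite sumrB (bigD1 c) //= eqxx big1 ?addr0 ?mulr1; last first.
    by move=> d dc; rewrite eq_sym (negbTE dc) mulr0 !mul0r.
  by rewrite E addrK.
have xE : x = invmx H *m w by rewrite -Hx mulKmx.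
have := congr1 (fun A : 'cV_#|I| => A a ord0) xE; rewrite /x !mxE => ->.
rewrite mulr_sumr; apply: eq_bigr => c _; rewrite !mxE; ring.
Qed.

End Elimination.

Lemma eq_iint_on (R : realType) (K : choiceType) (s : seq K) (g g' : (K -> R) -> \bar R) f :
  (forall b, (forall k, k \notin s -> b k = f k) -> g b = g' b) -> iint s g f = iint s g' f.
Proof.
elim: s f => [|k s IH] f gg' /=; first exact: gg'.
apply: eq_integral => x _; apply: IH => b bf; apply: gg' => k'.
by rewrite inE negb_or => /andP[k'k k's]; rewrite bf // upd_other.
Qed.

(** * Measurability of the elimination in weights and potential *)

Section DensityMeasurability.
Variables (R : realType) (V : finType) (d : measure_display) (X : measurableType d).
Implicit Types (W : X -> V -> V -> R) (b : X -> V -> R).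

Definition mweights W := forall i j, measurable_fun setT (fun x => W x i j).
Definition mpoint b := forall i, measurable_fun setT (fun x => b x i).

Lemma measurable_pivot W b v : mweights W -> mpoint b ->
  measurable_fun setT (fun x => pivot (W x) (b x) v).
Proof. by move=> mW mb; apply: measurable_funB => //; apply: measurable_funM. Qed.

Lemma measurable_div (f g : X -> R) : measurable_fun setT f -> measurable_fun setT g ->
  measurable_fun setT (fun x => f x / g x).
Proof.
move=> mf mg; apply: measurable_funM => //.
exact: (measurableT_comp (@measurable_invr R)).
Qed.

Lemma measurable_elim W v (h : X -> R) : mweights W -> measurable_fun setT h ->
  mweights (fun x => elim v (h x) (W x)).
Proof.
move=> mW mh i j; apply: measurable_funD => //.
by apply: measurable_div => //; exact: measurable_funM.
Qed.

Lemma measurable_igauss (e h : X -> R) : measurable_fun setT e -> measurable_fun setT h ->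
  measurable_fun setT (fun x => igauss (e x) (h x)).
Proof.
move=> me mh; apply: measurable_funM => //; apply: measurable_funM.
  apply: (measurableT_comp (@measurable_invr R)).
  exact: (measurableT_comp (@measurable_sqrtr R)).
apply: (measurableT_comp (@measurable_expR R)); apply: measurable_funM => //.
apply: measurable_funN; apply: measurable_funD.
  by apply: measurable_funB => //; exact: measurable_funM.
by apply: measurable_div => //; exact: measurable_funX.
Qed.

Lemma measurable_nuS s W b : mweights W -> mpoint b ->
  measurable_fun setT (fun x => nuS s (W x) (b x)).
Proof.
elim: s W => [|v s IH] W mW mb /=; first exact: measurable_cst.
have mp := measurable_pivot v mW mb.
apply: measurable_fun_ifT => //; first exact: measurable_fun_ltr.
apply: measurable_funM.
  by apply: measurable_igauss => //; apply: measurable_sum => j.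
by apply: IH => //; exact: measurable_elim.
Qed.

Lemma measurable_elimS s W b : mweights W -> mpoint b ->
  mweights (fun x => elimS s (b x) (W x)).
Proof.
elim: s W => [|v s IH] W mW mb //=; apply: IH => //.
by apply: measurable_elim => //; exact: measurable_pivot.
Qed.

Lemma measurable_pivS s W b : mweights W -> mpoint b ->
  measurable_fun setT (fun x => pivS s (b x) (W x)).
Proof.
elim: s W => [|v s IH] W mW mb /=; first exact: measurable_cst.
have mp := measurable_pivot v mW mb.
apply: measurable_and; first exact: measurable_fun_ltr.
by apply: IH => //; exact: measurable_elim.
Qed.

End DensityMeasurability.

(** * Laplace transform and marginals of [nu] *)

Section Laplace.
Variables (R : realType) (V : finType).
Implicit Types (W : V -> V -> R) (a b : V -> R) (s r : seq V).

Lemma igauss_ge0 (e h : R) : 0 <= igauss e h.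
Proof.
by rewrite /igauss !mulr_ge0 ?sqrtr_ge0 ?invr_ge0 ?sqrtr_ge0 ?expR_ge0.
Qed.

Lemma nuS_ge0 s W b : 0 <= nuS s W b.
Proof.
elim: s W => //= v s IH W; case: ifP => // _.
by rewrite mulr_ge0 ?igauss_ge0.
Qed.

Definition energy W a s : R :=
  (\sum_(i <- s) \sum_(j <- s) W i j * (a i * a j - 1)) / 2.

(** With [a v = sqrt (1 + l v)] this is the expectation of [exp (- sum_v l v * b v)] under [nu] (see
    [iint_laplace]). *)
Definition laplace W a s : R := \prod_(v <- s) (a v)^-1 * expR (- energy W a s).

Lemma energy_elim v h W a s : (forall i j, W i j = W j i) ->
  energy (elim v h W) a s =
  energy W a s + ((\sum_(j <- s) W v j * a j) ^+ 2 - (\sum_(j <- s) W v j) ^+ 2) / h / 2.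
Proof.
move=> Ws; rewrite /energy -[RHS]mulrDl; congr (_ / 2).
rewrite !expr2 !mulr_suml -sumrB mulr_suml -big_split /=; apply: eq_bigr => i _.
rewrite !mulr_sumr -sumrB mulr_suml -big_split /=; apply: eq_bigr => j _.
by rewrite /elim (Ws i v); ring.
Qed.

Lemma energy_cons v W a s : (forall i j, W i j = W j i) ->
  energy W a (v :: s) = energy W a s + W v v * (a v ^+ 2 - 1) / 2
    + (a v * (\sum_(j <- s) W v j * a j) - \sum_(j <- s) W v j).
Proof.
move=> Ws; rewrite /energy big_cons big_cons.
under [X in _ + X]eq_bigr do rewrite big_cons.
rewrite big_split /=.
have -> : \sum_(j <- s) W v j * (a v * a j - 1) =
    a v * (\sum_(j <- s) W v j * a j) - \sum_(j <- s) W v j.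
  by rewrite mulr_sumr -sumrB; apply: eq_bigr => j _; ring.
have -> : \sum_(i <- s) W i v * (a i * a v - 1) =
    a v * (\sum_(j <- s) W v j * a j) - \sum_(j <- s) W v j.
  by rewrite mulr_sumr -sumrB; apply: eq_bigr => j _; rewrite Ws; ring.
by field.
Qed.

Lemma measurable_expdot (c : V -> R) s :
  measurable_fun setT (fun b : FunSp R V => expR (- \sum_(v <- s) c v * b v)).
Proof.
apply: (measurableT_comp (@measurable_expR R)); apply: measurable_funN.
apply: measurable_sum => v; apply: measurable_funM => //.
exact: measurable_eval.
Qed.

(** The inner integral is, by induction, the transform for the weights with [v] eliminated. Its
    energy exceeds that of [W] by [(th^2 - eta^2) / (2 h)]; the part with [eta] cancels against
    [igauss], and the integral over the pivot is [integral_inverse_gauss] with parameters [a v] and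
    [th]. *)
Lemma iint_laplace s W a f : uniq s -> (forall i j, W i j = W j i) ->
  (forall i j, 0 <= W i j) -> (forall v, 0 < a v) ->
  iint s (fun b => (nuS s W b * expR (- \sum_(v <- s) (a v ^+ 2 - 1) * b v))%:E) f =
  (laplace W a s)%:E.
Proof.
elim: s W f => [|v s IH] W f.
  by move=> _ _ _ _; rewrite /= /laplace /energy !big_nil mul0r oppr0 expR0 mulr1.
move=> /= /andP[vs us] Ws W0 a0.
set eta := \sum_(j <- s) W v j; set th := \sum_(j <- s) W v j * a j.
pose C := Num.sqrt (2 / pi) * expR (eta - (a v ^+ 2 - 1) * (W v v / 2) - energy W a s)
  * \prod_(j <- s) (a j)^-1.
have th0 : 0 <= th by apply: sumr_ge0 => j _; rewrite mulr_ge0 // ltW.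
have P0 : 0 <= \prod_(j <- s) (a j)^-1 by apply: prodr_ge0 => j _; rewrite invr_ge0 ltW.
have C0 : 0 <= C by rewrite /C !mulr_ge0 ?sqrtr_ge0 ?expR_ge0.
transitivity (\int[lebesgue_measure]_x (C%:E * (let h := (2 * x - W v v)%R in
   if (0 < h)%R then ((Num.sqrt h)^-1 * expR (- (a v ^+ 2 * h + th ^+ 2 / h) / 2))%R else 0%R)%:E))%E.
  apply: eq_integral => x _.
  pose h := 2 * x - W v v.
  have piv b : (forall k, k \notin s -> b k = upd f v x k) -> pivot W b v = h /\ b v = x.
    by move=> bE; rewrite /pivot bE // upd_same.
  rewrite /= -/h; case: ifPn => h0; last first.
    rewrite (@eq_iint_on _ _ _ _ (fun=> 0%E)); last first.
      by move=> b /piv [-> _]; rewrite (negbTE h0) mul0r.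
    rewrite mule0; have /= := @iintZl R V s 0%E (fun=> 0%E) (upd f v x).
    by under eq_iint do rewrite mul0e; move=> -> //; rewrite mul0e.
  rewrite (@eq_iint_on _ _ _ _ (fun b => ((igauss eta h * expR (- ((a v ^+ 2 - 1) * x)))%:E *
    (nuS s (elim v h W) b * expR (- \sum_(v <- s) (a v ^+ 2 - 1) * b v))%:E)%E)); last first.
    move=> b /piv [-> bv]; rewrite h0 big_cons bv opprD expRD -EFinM; congr _%:E.
    ring.
  rewrite iintZl; last 3 first.
  - apply/measurable_EFinP; apply: measurable_funM; last exact: measurable_expdot.
    by apply: measurable_nuS => [i j|i]; [exact: measurable_cst|exact: measurable_eval].
  - by move=> b; rewrite lee_fin mulr_ge0 ?nuS_ge0 ?expR_ge0.
  - by rewrite lee_fin mulr_ge0 ?igauss_ge0 ?expR_ge0.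
  rewrite IH //; last 2 first.
  - exact: elim_sym.
  - exact: elim_ge0.
  rewrite -!EFinM; congr _%:E; rewrite /laplace energy_elim // -/th -/eta /igauss /C.
  rewrite [LHS](_ : _ = Num.sqrt (2 / pi) * (Num.sqrt h)^-1 * \prod_(j <- s) (a j)^-1 *
    (expR (- (h - 2 * eta + eta ^+ 2 / h) / 2) * expR (- ((a v ^+ 2 - 1) * x)) *
     expR (- (energy W a s + (th ^+ 2 - eta ^+ 2) / h / 2)))); last by ring.
  rewrite [RHS](_ : _ = Num.sqrt (2 / pi) * (Num.sqrt h)^-1 * \prod_(j <- s) (a j)^-1 *
    (expR (eta - (a v ^+ 2 - 1) * (W v v / 2) - energy W a s) *
     expR (- (a v ^+ 2 * h + th ^+ 2 / h) / 2))); last by ring.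
  rewrite -!expRD; congr (_ * expR _).
  have -> : W v v = 2 * x - h by rewrite /h; ring.
  by field; rewrite lt0r_neq0.
rewrite ge0_integralZl //; last 2 first.
- apply/measurable_EFinP; apply: measurable_fun_ifT => //.
  + by apply: measurable_fun_ltr => //; apply: measurable_funB => //; exact: measurable_funM.
  + have mh : measurable_fun setT (fun x : R => 2 * x - W v v).
      by apply: measurable_funB => //; exact: measurable_funM.
    apply: measurable_funM.
      apply: (measurableT_comp (@measurable_invr R)).
      exact: (measurableT_comp (@measurable_sqrtr R)).
    apply: (measurableT_comp (@measurable_expR R)); apply: measurable_funM => //.
    apply: measurable_funN; apply: measurable_funD; first exact: measurable_funM.
    exact: measurable_div.
- by move=> x _ /=; case: ifP => // _; rewrite lee_fin mulr_ge0 ?expR_ge0 // invr_ge0 sqrtr_ge0.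
rewrite integral_inverse_gauss // -EFinM; congr _%:E.
rewrite /laplace energy_cons // -/th -/eta big_cons /C.
have sq : Num.sqrt (2 / pi) * Num.sqrt (2 * pi) = 2 :> R.
  rewrite -sqrtrM ?divr_ge0 ?pi_ge0 //.
  have pn : pi != 0 :> R by rewrite gt_eqF // pi_gt0.
  rewrite (_ : 2 / pi * (2 * pi) = 2 ^+ 2); last by rewrite mulrCA -mulrA mulVf // mulr1 expr2.
  by rewrite sqrtr_sqr ger0_norm.
rewrite [LHS](_ : _ = (Num.sqrt (2 / pi) * Num.sqrt (2 * pi)) / 2 * (a v)^-1 *
   \prod_(j <- s) (a j)^-1 * (expR (eta - (a v ^+ 2 - 1) * (W v v / 2) - energy W a s) *
   expR (- (a v * th)))); last by field; rewrite lt0r_neq0.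
rewrite sq divff // mul1r -expRD; congr (_ * expR _); ring.
Qed.

(* Marginal density of [nuS (s ++ r) W] on the coordinates in [s] (see [iint_nuM]). *)
Fixpoint nuM s r W b : R :=
  if s is v :: s' then
    let h := pivot W b v in
    if 0 < h then igauss (\sum_(j <- s' ++ r) W v j) h * nuM s' r (elim v h W) b else 0
  else 1.

Lemma nuM_ge0 s r W b : 0 <= nuM s r W b.
Proof.
elim: s W => //= v s IH W; case: ifP => // _.
by rewrite mulr_ge0 ?igauss_ge0.
Qed.

Lemma nuS_cat s r W b : nuS (s ++ r) W b = nuM s r W b * nuS r (elimS s b W) b.
Proof.
elim: s W => [|v s IH] W /=; first by rewrite mul1r.
by case: ifP => _; rewrite ?mul0r // IH mulrA.
Qed.

Lemma nuM_piv0 s r W b : ~~ pivS s b W -> nuM s r W b = 0.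
Proof.
elim: s W => //= v s IH W; rewrite negb_and; case: ifP => //= _ ps.
by rewrite IH ?mulr0.
Qed.

Lemma pivS_cat s r W b : pivS (s ++ r) b W = pivS s b W && pivS r b (elimS s b W).
Proof. by elim: s W => //= v s IH W; rewrite IH andbA. Qed.

Lemma eq_on_elim s W b b' : {in s, b =1 b'} ->
  (elimS s b W = elimS s b' W) * (pivS s b W = pivS s b' W).
Proof.
elim: s W => //= v s IH W bb'; rewrite /pivot bb' ?mem_head //.
have bs : {in s, b =1 b'} by move=> x xs; apply: bb'; rewrite inE xs orbT.
by rewrite !(IH _ bs).
Qed.

Lemma eq_on_nuM s r W b b' : {in s, b =1 b'} -> nuM s r W b = nuM s r W b'.
Proof.
elim: s W => //= v s IH W bb'; rewrite /pivot bb' ?mem_head //.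
have bs : {in s, b =1 b'} by move=> x xs; apply: bb'; rewrite inE xs orbT.
by rewrite (IH _ bs).
Qed.

Lemma measurable_nuM d (X : measurableType d) s r (W : X -> V -> V -> R) (b : X -> V -> R) :
  mweights W -> mpoint b -> measurable_fun setT (fun x => nuM s r (W x) (b x)).
Proof.
elim: s W => [|v s IH] W mW mb /=; first exact: measurable_cst.
have mp := measurable_pivot v mW mb.
apply: measurable_fun_ifT => //; first exact: measurable_fun_ltr.
apply: measurable_funM.
  by apply: measurable_igauss => //; apply: measurable_sum => j.
by apply: IH => //; exact: measurable_elim.
Qed.

(** The density is [nuM] in the coordinates of [s] times the density for the eliminated weights in
    those of [r]. As [G] depends on [s] only, the integral over [r] is a Laplace transform. *)
Lemma iint_marginal s r W a (G : (V -> R) -> \bar R) f : uniq (s ++ r) ->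
  (forall i j, W i j = W j i) -> (forall i j, 0 <= W i j) -> (forall v, 0 < a v) ->
  (forall b, 0 <= G b)%E ->
  (forall b b', {in s, b =1 b'} -> G b = G b') ->
  (iint (s ++ r) (fun b => (nuS (s ++ r) W b)%:E * (G b *
      (expR (- \sum_(v <- r) (a v ^+ 2 - 1) * b v))%:E)) f =
   iint s (fun b => (nuM s r W b)%:E * (G b * (laplace (elimS s b W) a r)%:E)) f)%E.
Proof.
move=> usr Ws W0 a0 G0 Gs; rewrite iint_cat; apply: eq_iint => b.
have sr k : k \in s -> k \notin r.
  move: usr; rewrite cat_uniq => /and3P[_ /hasPn h _] ks.
  by apply/negP => /h; rewrite ks.
have ur : uniq r by move: usr; rewrite cat_uniq => /and3P[].
rewrite (@eq_iint_on _ _ _ _ (fun b' => ((nuM s r W b)%:E * G b) *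
   (nuS r (elimS s b W) b' * expR (- \sum_(v <- r) (a v ^+ 2 - 1) * b' v))%:E)%E); last first.
  move=> b' bb'; have {}bb' : {in s, b' =1 b} by move=> k ks; rewrite bb' // sr.
  rewrite nuS_cat (eq_on_nuM _ _ bb') (Gs _ _ bb') (eq_on_elim _ bb').
  by rewrite !EFinM -!muleA; congr (_ * _)%E; rewrite muleCA.
have mg : measurable_fun setT (fun b' : FunSp R V => (nuS r (elimS s b W) b' *
    expR (- \sum_(v <- r) (a v ^+ 2 - 1) * b' v))%:E).
  apply/measurable_EFinP; apply: measurable_funM; last exact: measurable_expdot.
  by apply: measurable_nuS => [i j|i]; [exact: measurable_cst|exact: measurable_eval].
rewrite iintZl //; last 2 first.
- by move=> b'; rewrite lee_fin mulr_ge0 ?nuS_ge0 ?expR_ge0.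
- by rewrite mule_ge0 // lee_fin nuM_ge0.
(* The eliminated weights are known to be nonnegative only when all pivots are positive; otherwise
   both sides vanish. *)
have [ps|nps] := boolP (pivS s b W); last by rewrite nuM_piv0 // !mul0e.
rewrite iint_laplace ?muleA //.
- exact: elimS_sym.
- exact: elimS_ge0.
Qed.

Lemma laplace1 W s : laplace W (fun=> 1) s = 1.
Proof.
rewrite /laplace /energy !big1 //; last by move=> i _; rewrite invr1.
  by rewrite mul0r oppr0 expR0 mulr1.
by move=> i _; rewrite big1 // => j _; rewrite mulr1 subrr mulr0.
Qed.

(** The case [a = 1], where the transform is a total mass and equals 1. *)
Lemma iint_nuM s r W (G : (V -> R) -> \bar R) f : uniq (s ++ r) ->
  (forall i j, W i j = W j i) -> (forall i j, 0 <= W i j) ->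
  (forall b, 0 <= G b)%E -> (forall b b', {in s, b =1 b'} -> G b = G b') ->
  (iint (s ++ r) (fun b => (nuS (s ++ r) W b)%:E * G b) f =
   iint s (fun b => (nuM s r W b)%:E * G b) f)%E.
Proof.
move=> usr Ws W0 G0 Gs.
have := @iint_marginal s r W (fun=> 1) G f usr Ws W0 (fun=> ltr01) G0 Gs.
under eq_iint => b.
  rewrite big1; last by move=> v _; rewrite expr1n subrr mul0r.
  rewrite oppr0 expR0 mule1; over.
by move=> ->; apply: eq_iint => b; rewrite laplace1 mule1.
Qed.

(** [nuM] sees [r] only through the row sums over [r], and this persists under elimination: the new
    row sum at [i] is the old one plus a multiple of the row sum at [v]. *)
Lemma nuM_lump s r r' W W' b : uniq s -> {in s & s, W =2 W'} ->
  {in s, forall i, \sum_(j <- r) W i j = \sum_(j <- r') W' i j} ->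
  nuM s r W b = nuM s r' W' b.
Proof.
elim: s W W' => //= v s IH W W' /andP[vs us] WW' WWr.
have vv : v \in v :: s by exact: mem_head.
have sv i : i \in s -> i \in v :: s by rewrite inE orbC => ->.
rewrite /pivot WW' //; set h := 2 * b v - W' v v; case: ifP => // _.
congr (igauss _ _ * _).
  by rewrite !big_cat WWr //=; congr (_ + _); apply: eq_big_seq => j /sv jv; exact: WW'.
apply: IH => // [i j /sv is_ /sv js|i /sv is_]; first by rewrite /elim !WW'.
by rewrite /elim !big_split /= WWr // -!mulr_suml -!mulr_sumr WWr // WW'.
Qed.

Lemma nuS_map (U : finType) (i : U -> V) (s : seq U) (W' : V -> V -> R) (W : U -> U -> R) b :
  (forall u u', W u u' = W' (i u) (i u')) ->
  nuS s W (b \o i) = nuS (map i s) W' b.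
Proof.
elim: s W W' => //= u s IH W W' WW'.
rewrite /pivot /= WW' big_map (eq_bigr (fun j => W' (i u) (i j))) //.
by rewrite (IH _ (elim (i u) (2 * b (i u) - W' (i u) (i u)) W')) // => j k; rewrite /elim !WW'.
Qed.

End Laplace.

Lemma eq_on_pivS (R : realType) (V : finType) (s : seq V) (b : V -> R) (W W' : V -> V -> R) :
  {in s & s, W =2 W'} -> pivS s b W = pivS s b W'.
Proof.
elim: s W W' => //= v s IH W W' WW'.
have vv : v \in v :: s by exact: mem_head.
have sv i : i \in s -> i \in v :: s by rewrite inE orbC => ->.
rewrite /pivot WW' //; congr andb; apply: IH => i j /sv is_ /sv js.
by rewrite /elim !WW'.
Qed.

(** * Path space *)

Section FiniteDecomposition.
Local Open Scope ereal_scope.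

Lemma measure_fin_partition d (T : measurableType d) (R : realType) (I : finType)
    (mu : {measure set T -> \bar R}) (F : I -> set T) (E : set T) :
  measurable E -> (forall i, measurable (F i)) ->
  (forall w, E w -> exists i, F i w) -> (forall i j w, F i w -> F j w -> i = j) ->
  mu E = \sum_i mu (E `&` F i).
Proof.
move=> mE mF cov dis.
rewrite [in LHS](_ : E = \bigcup_(i in [set: I]) (E `&` F i)); last first.
  apply/seteqP; split=> [w Ew|w [i _ []] //].
  by have [i Fi] := cov w Ew; exists i.
rewrite measure_fin_bigcup //.
- rewrite (fsbigE (index_enum I)) ?index_enum_uniq //.
    by apply: eq_bigl => i; rewrite in_setT.
  by move=> i _; rewrite mem_index_enum.
- exact: finite_finset.
- by move=> i j _ _ [w [[_ Fi] [_ Fj]]]; exact: dis Fi Fj.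
- by move=> i _; exact: measurableI.
Qed.

End FiniteDecomposition.

Section PathSpace.
Variables (R : realType) (V : finType) (v0 : V).
Notation PS := (PathSp R v0).
Implicit Types (x : nat -> V) (B : nat -> set R) (n k : nat).

Lemma measurable_cylset n x B : (forall k, measurable (B k)) ->
  measurable (cylset (v0 := v0) n x B : set PS).
Proof. by move=> mB; apply: sub_gen_smallest; exists n, x, B. Qed.

Definition prefix_set n (t : n.+1.-tuple V) : set PS :=
  [set w | forall k, (k <= n)%N -> w.1 k = nth v0 t k].

Lemma prefix_setE n (t : n.+1.-tuple V) :
  prefix_set t = cylset (v0 := v0) n (nth v0 t) (fun=> setT).
Proof. by apply/seteqP; split=> w /= => [h|[]]. Qed.

Lemma measurable_prefix n (t : n.+1.-tuple V) : measurable (prefix_set t).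
Proof. by rewrite prefix_setE; exact: measurable_cylset. Qed.

Lemma prefix_cover n (w : PS) : exists t : n.+1.-tuple V, prefix_set t w.
Proof.
have st : size (mkseq w.1 n.+1) == n.+1 by rewrite size_mkseq.
by exists (Tuple st) => k kn /=; rewrite nth_mkseq.
Qed.

Lemma prefix_disjoint n (t t' : n.+1.-tuple V) (w : PS) :
  prefix_set t w -> prefix_set t' w -> t = t'.
Proof.
move=> tw t'w; apply: val_inj; apply: (@eq_from_nth _ v0); first by rewrite !size_tuple.
by move=> k; rewrite size_tuple ltnS => kn; rewrite -tw // -t'w.
Qed.

Lemma measure_prefix_partition (mu : {measure set PS -> \bar R}) n (E : set PS) :
  measurable E -> mu E = (\sum_(t : n.+1.-tuple V) mu (E `&` prefix_set t))%E.
Proof.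
move=> mE; apply: measure_fin_partition => //.
- exact: measurable_prefix.
- by move=> w _; exact: prefix_cover.
- by move=> t t' w; exact: prefix_disjoint.
Qed.

Lemma measurable_position k v : measurable [set w : PS | w.1 k = v].
Proof.
rewrite (_ : [set _ | _] = \bigcup_(t in [set t : k.+1.-tuple V | nth v0 t k = v]) prefix_set t).
  by apply: fin_bigcup_measurable => [|t _]; [exact: finite_finset|exact: measurable_prefix].
apply/seteqP; split=> w /=.
  by move=> wk; have [t tw] := prefix_cover k w; exists t => //=; rewrite -tw.
by move=> [t /= tk tw]; rewrite tw.
Qed.

Lemma measurable_holding k : measurable_fun setT (fun w : PS => w.2 k).
Proof.
move=> _ B mB; rewrite setTI.
rewrite (_ : _ @^-1` _ = \bigcup_(t in [set: k.+2.-tuple V])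
  cylset (v0 := v0) k.+1 (nth v0 t) (fun j => if j == k then B else setT)).
  apply: fin_bigcup_measurable => [|t _]; first exact: finite_finset.
  by apply: measurable_cylset => j; case: ifP.
apply/seteqP; split=> w /=.
  move=> wk; have [t tw] := prefix_cover k.+1 w; exists t => //; split=> // j jk.
  by case: eqP => [->|].
by move=> [t _ [_ /(_ k (ltnSn k))]]; rewrite eqxx.
Qed.

Lemma measurable_toPathSp d (Y : measurableType d) (f : Y -> PS) :
  (forall k v, measurable [set y | (f y).1 k = v]) ->
  (forall k, measurable_fun setT (fun y => (f y).2 k)) ->
  measurable_fun setT f.
Proof.
move=> m1 m2; apply: (@measurability _ _ _ PS setT f (@cyl R V v0)) => //.
move=> _ [_ [n [x [B [mB ->]]]] <-]; rewrite setTI.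
rewrite (_ : _ @^-1` _ = (\bigcap_(k in `I_n.+1) [set y | (f y).1 k = x k]) `&`
    (\bigcap_(k in `I_n) ((fun y => (f y).2 k) @^-1` B k))).
  apply: measurableI; apply: fin_bigcap_measurable => //; try exact: finite_II.
  by move=> k _; rewrite -[X in measurable X]setTI; exact: m2.
by apply/seteqP; split=> y /=.
Qed.

Lemma cyl_setI : setI_closed (@cyl R V v0).
Proof.
move=> _ _ [n [x [B [mB ->]]]] [m [y [C [mC ->]]]].
have [agree|nagree] := pselect (forall k, (k <= n)%N -> (k <= m)%N -> x k = y k).
  exists (maxn n m), (fun k => if (k <= n)%N then x k else y k),
    (fun k => (if (k < n)%N then B k else setT) `&` (if (k < m)%N then C k else setT)).
  split; first by move=> k; apply: measurableI; case: ifP.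
  apply/seteqP; split=> w /=.
    move=> [[wx wB] [wy wC]]; split=> k.
      by rewrite leq_max; case: ifP => [/wx -> //|_ /= /wy].
    by move=> _; split; case: ifP => // kn; [exact: wB|exact: wC].
  move=> [wz wD]; split; split=> k kn.
  - by rewrite wz ?leq_max ?kn.
  - by have := wD k; rewrite leq_max kn => /(_ isT) [].
  - rewrite wz ?leq_max ?kn ?orbT //; case: ifP => // kn'; exact: agree.
  - by have := wD k; rewrite leq_max kn orbT => /(_ isT) [].
(* Incompatible positions give the empty set. Length 1 is the shortest at which a holding time is
   read, so the constraint [set0] makes the cylinder empty. *)
exists 1%N, x, (fun=> set0); split=> //; apply/seteqP; split=> w /=.
  move=> [[wx _] [wy _]]; exfalso; apply: nagree => k kn km.
  by rewrite -wx // wy.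
by move=> [_ /(_ 0%N isT)].
Qed.

Lemma cyl_unique (la mu : probability PS R) :
  (forall n x B, (forall k, measurable (B k)) ->
    la (cylset (v0 := v0) n x B) = mu (cylset (v0 := v0) n x B)) ->
  forall A, measurable A -> la A = mu A.
Proof.
move=> lamu; apply: (@dynkin_induction _ PS (@cyl R V v0)) => //.
- exact: cyl_setI.
- by rewrite !probability_setT.
- by move=> _ [n [x [B [mB ->]]]]; exact: lamu.
- by move=> S mS lS; rewrite !probability_setC // lS.
- move=> F mF tF lF; rewrite !measure_bigcup //.
  by apply: eq_eseriesr => n _; exact: lF.
Qed.

(** Induction on the number [j] of holding times that may be constrained. Without constraints the
    prefixes of a given length partition the space, and dominated masses with the same total
    coincide. A constraint and its complement add up to the unconstrained cylinder, so equality
    there forces equality in both inequalities. *)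
Lemma cyl_le_eq (la mu : probability PS R) :
  (forall n x B, (forall k, measurable (B k)) ->
    (la (cylset (v0 := v0) n x B) <= mu (cylset (v0 := v0) n x B))%E) ->
  forall A, measurable A -> la A = mu A.
Proof.
move=> lemu; apply: cyl_unique.
suff H j : forall n x B, (forall k, measurable (B k)) ->
    (forall k, (j <= k)%N -> B k = setT) ->
    la (cylset (v0 := v0) n x B) = mu (cylset (v0 := v0) n x B).
  move=> n x B mB.
  pose B' k := if (k < n)%N then B k else setT.
  have -> : cylset (v0 := v0) n x B = cylset (v0 := v0) n x B'.
    by apply/seteqP; split=> w /= [wx wB]; split=> // k kn; have := wB k kn; rewrite /B' kn.
  apply: (H n) => [k|k nk]; first by rewrite /B'; case: ifP.
  by rewrite /B' ltnNge nk.
elim: j => [|j IH] n x B mB BT.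
  have {BT} -> : B = fun=> setT by apply/funext => k; exact: BT.
  have st : size (mkseq x n.+1) == n.+1 by rewrite size_mkseq.
  pose t0 : n.+1.-tuple V := Tuple st.
  have -> : cylset (v0 := v0) n x (fun=> setT) = prefix_set t0.
    apply/seteqP; split=> w /=.
      by move=> [wx _] k kn; rewrite nth_mkseq // wx.
    by move=> wx; split=> // k kn; rewrite wx // nth_mkseq.
  have le t : (la (prefix_set t) <= mu (prefix_set t) :> \bar R)%E.
    by rewrite prefix_setE; exact: lemu.
  apply/eqP; rewrite eq_le le /= leNgt; apply/negP => lt0.
  have Ela : (1 = \sum_(t : n.+1.-tuple V) la (setT `&` prefix_set t))%E.
    by rewrite -[LHS](probability_setT la); exact: measure_prefix_partition.
  have Emu : (1 = \sum_(t : n.+1.-tuple V) mu (setT `&` prefix_set t))%E.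
    by rewrite -[LHS](probability_setT mu); exact: measure_prefix_partition.
  have : (1 < 1 :> \bar R)%E; last by rewrite ltxx.
  rewrite {1}Ela {1}Emu (bigD1 t0) //= [X in (_ < X)%E](bigD1 t0) //=.
  apply: lte_leD.
  - apply/sum_fin_numP => t _ _; rewrite fin_num_measure //.
    by apply: measurableI => //; exact: measurable_prefix.
  - by rewrite !setTI.
  - by apply: lee_sum => t _; rewrite !setTI.
(* For [j >= n] the cylinder does not read the holding time [j], and its constraint can be replaced
   by the full set. *)
have [jn|nj] := ltnP j n; last first.
  pose B' k := if k == j then setT else B k.
  have -> : cylset (v0 := v0) n x B = cylset (v0 := v0) n x B'.
    apply/seteqP; split=> w /= [wx wB]; split=> // k kn; have := wB k kn;
    by rewrite /B'; case: eqP => // kj; move: kn; rewrite kj ltnNge nj.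
  apply: IH => [k|k jk]; first by rewrite /B'; case: ifP.
  by rewrite /B'; case: eqP => // kj; apply: BT; rewrite ltn_neqAle eq_sym jk andbT; apply/eqP.
pose Bc k := if k == j then ~` B j else B k.
pose BT' k := if k == j then setT else B k.
have mBc k : measurable (Bc k) by rewrite /Bc; case: ifP => // _; exact: measurableC.
have mBT k : measurable (BT' k) by rewrite /BT'; case: ifP.
have EU : cylset (v0 := v0) n x BT' = cylset (v0 := v0) n x B `|` cylset (v0 := v0) n x Bc.
  apply/seteqP; split=> w /=.
    move=> [wx wB]; have [Bj|nBj] := pselect (B j (w.2 j)); [left|right]; split=> // k kn;
    have := wB k kn; rewrite /BT' /Bc; case: eqP => // ->; by [].
  by move=> [[wx wB]|[wx wB]]; split=> // k kn; have := wB k kn; rewrite /BT' /Bc; case: eqP.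
have dis : cylset (v0 := v0) n x B `&` cylset (v0 := v0) n x Bc = set0.
  apply/seteqP; split=> // w /= [[_ wB] [_ wBc]].
  by have := wBc j jn; rewrite /Bc eqxx; apply; exact: wB.
have ET : la (cylset (v0 := v0) n x BT') = mu (cylset (v0 := v0) n x BT').
  apply: IH => // k jk; rewrite /BT'; case: eqP => // kj; apply: BT.
  by rewrite ltn_neqAle eq_sym jk andbT; apply/eqP.
move: ET; rewrite EU !measureU //; try exact: measurable_cylset.
move=> ET; apply/eqP; rewrite eq_le lemu //= leNgt; apply/negP => lt0.
have : (la (cylset (v0 := v0) n x B) + la (cylset (v0 := v0) n x Bc) <
        mu (cylset (v0 := v0) n x B) + mu (cylset (v0 := v0) n x Bc))%E.
  apply: lte_leD => //; last exact: lemu.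
  by rewrite fin_num_measure //; exact: measurable_cylset.
by rewrite ET ltxx.
Qed.

End PathSpace.

(** * Hitting indices; measurability of restriction and loop removal *)

Lemma hit_next_eq (p : pred nat) l m : (l < m)%N -> p m ->
  (forall i, (l < i < m)%N -> ~~ p i) -> Defs.next p l = m.
Proof.
move=> lm pm np; rewrite /Defs.next; case: pselect => [h|]; last by case; exists m; rewrite lm.
case: ex_minnP => m' /andP[lm' pm'] mmin; apply/eqP; rewrite eqn_leq mmin ?lm //=.
by rewrite leqNgt; apply/negP => m'm; move: (np m'); rewrite lm' m'm pm' => /(_ isT).
Qed.

(** The second alternative is the default value; with it each level set of [next] is a countable
    combination of events on single positions. *)
Lemma hit_nextP (p : pred nat) l m : Defs.next p l = m <->
  ((l < m)%N && p m /\ (forall i, (l < i < m)%N -> ~~ p i)) \/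
  (m = l.+1 /\ forall i, (l < i)%N -> ~~ p i).
Proof.
split=> [<-|[[/andP[lm pm] np]|[-> np]]]; last 2 first.
- exact: hit_next_eq.
- rewrite /Defs.next; case: pselect => // h; exfalso; case: h => m' /andP[lm pm].
  by move: (np m' lm); rewrite pm.
rewrite /Defs.next; case: pselect => [h|nh]; last first.
  by right; split=> // i li; apply/negP => pi; apply: nh; exists i; rewrite li.
case: ex_minnP => m' lpm' mmin; left; split=> // i /andP[li im'].
by apply/negP => pi; move: (mmin i); rewrite li pi leqNgt im' => /(_ isT).
Qed.

Section RestrictionMeasurability.
Variables (R : realType) (V : finType) (v0 : V).
Notation PS := (PathSp R v0).

Lemma measurable_next d (Y : measurableType d) (p : Y -> nat -> bool) l m :
  (forall i, measurable [set y | p y i]) -> measurable [set y | Defs.next (p y) l = m].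
Proof.
move=> mp.
have mnp i : measurable [set y | ~~ p y i].
  rewrite (_ : [set y | _] = ~` [set y | p y i]); first exact: measurableC.
  by apply/seteqP; split=> y /= /negP.
rewrite (_ : [set y | _] =
  ([set y | (l < m)%N] `&` [set y | p y m] `&` \bigcap_(i in [set i | (l < i < m)%N]) [set y | ~~ p y i])
  `|` ([set y | m = l.+1] `&` \bigcap_(i in [set i | (l < i)%N]) [set y | ~~ p y i])).
  have mcst (P : Prop) : measurable [set y : Y | P].
    have [HP|nP] := pselect P.
      by rewrite (_ : [set _ | _] = setT) //; apply/seteqP; split.
    by rewrite (_ : [set _ | _] = set0) //; apply/seteqP; split.
  apply: measurableU; apply: measurableI; rewrite ?setTI //; try exact: bigcap_measurableType.
  exact: measurableI.
apply/seteqP; split=> y /=.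
  by move/hit_nextP => [[/andP[lm pm] np]|[ml np]]; [left|right]; split.
move=> [[[lm pm] np]|[ml np]]; apply/hit_nextP; [left|right]; split => //; first by rewrite lm.
Qed.

Lemma measurable_tauJ (J : {set V}) k m :
  measurable [set w : PS | tauJ J w.1 k = m].
Proof.
elim: k m => [|k IH] m /=.
  have [->|m0] := eqVneq m 0%N.
    by rewrite (_ : [set _ | _] = setT) //; apply/seteqP; split.
  rewrite (_ : [set _ | _] = set0) //; apply/seteqP; split=> // w /= m0'.
  by rewrite -m0' in m0.
rewrite (_ : [set _ | _] = \bigcup_l ([set w : PS | tauJ J w.1 k = l] `&`
  [set w : PS | Defs.next (fun j => w.1 j \in J) l = m])).
  apply: bigcupT_measurable => l; apply: measurableI => //.
  apply: (@measurable_next _ PS (fun w j => w.1 j \in J)) => i.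
  rewrite (_ : [set _ | _] = \bigcup_(v in [set v | v \in J]) [set w : PS | w.1 i = v]).
    apply: fin_bigcup_measurable => [|v _]; first exact: finite_finset.
    exact: measurable_position.
  by apply/seteqP; split=> w /= => [|[v vJ ->]] //; exists (w.1 i).
by apply/seteqP; split=> w /= => [wm|[l _ [<-]]] //; exists (tauJ J w.1 k).
Qed.

Lemma measurable_sigmaN k m : measurable [set w : PS | sigmaN w.1 k = m].
Proof.
elim: k m => [|k IH] m /=.
  have [->|m0] := eqVneq m 0%N.
    by rewrite (_ : [set _ | _] = setT) //; apply/seteqP; split.
  rewrite (_ : [set _ | _] = set0) //; apply/seteqP; split=> // w /= m0'.
  by rewrite -m0' in m0.
rewrite (_ : [set _ | _] = \bigcup_l ([set w : PS | sigmaN w.1 k = l] `&`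
  [set w : PS | Defs.next (fun j => w.1 j != w.1 l) l = m])).
  apply: bigcupT_measurable => l; apply: measurableI => //.
  apply: (@measurable_next _ PS (fun w j => w.1 j != w.1 l)) => i.
  rewrite (_ : [set _ | _] = \bigcup_(v in [set: V]) ([set w : PS | w.1 i = v] `&`
     ~` [set w : PS | w.1 l = v])).
    apply: fin_bigcup_measurable => [|v _]; first exact: finite_finset.
    by apply: measurableI; [|apply: measurableC]; exact: measurable_position.
  apply/seteqP; split=> w /=.
    by move=> wil; exists (w.1 i) => //; split=> // e; rewrite e eqxx in wil.
  by move=> [v _ [<- ne]]; apply/eqP => e; apply: ne; rewrite e.
by apply/seteqP; split=> w /= => [wm|[l _ [<-]]] //; exists (sigmaN w.1 k).
Qed.

Lemma measurable_nat_sel (N : PS -> nat) (g : nat -> PS -> R) :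
  (forall m, measurable [set w | N w = m]) -> (forall m, measurable_fun setT (g m)) ->
  measurable_fun setT (fun w => g (N w) w).
Proof.
move=> mN mg _ B mB; rewrite setTI.
rewrite (_ : _ @^-1` _ = \bigcup_m ([set w | N w = m] `&` (g m @^-1` B))).
  apply: bigcupT_measurable => m; apply: measurableI => //.
  by rewrite -[X in measurable X]setTI; exact: mg.
by apply/seteqP; split=> w /= => [gB|[m _ [<-]]] //; exists (N w).
Qed.

Lemma measurable_nat_sel_pos (N : PS -> nat) v :
  (forall m, measurable [set w | N w = m]) -> measurable [set w : PS | w.1 (N w) = v].
Proof.
move=> mN; rewrite (_ : [set _ | _] = \bigcup_m ([set w | N w = m] `&` [set w : PS | w.1 m = v])).
  by apply: bigcupT_measurable => m; apply: measurableI => //; exact: measurable_position.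
by apply/seteqP; split=> w /= => [gB|[m _ [<-]]] //; exists (N w).
Qed.

Lemma measurable_restrJ (J : {set V}) (d : {x : V | x \in J}) :
  measurable_fun setT (restrJ d : PS -> PathSp R d).
Proof.
apply: measurable_toPathSp => [k v|k] /=.
  rewrite (_ : [set _ | _] = \bigcup_(u in [set u : V | insubd d u = v])
     [set w : PS | w.1 (tauJ J w.1 k) = u]).
    apply: fin_bigcup_measurable => [|u _]; first exact: finite_finset.
    by apply: measurable_nat_sel_pos => m; exact: measurable_tauJ.
  by apply/seteqP; split=> w /= => [e|[u <- ->]] //; exists (w.1 (tauJ J w.1 k)).
apply: (measurable_nat_sel (N := fun w => tauJ J w.1 k) (g := fun m w => w.2 m)) => m.
  exact: measurable_tauJ.
exact: measurable_holding.
Qed.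

Lemma measurable_rmloops : measurable_fun setT (@rmloops R V v0 : PS -> PS).
Proof.
apply: measurable_toPathSp => [k v|k] /=.
  by apply: measurable_nat_sel_pos => m; exact: measurable_sigmaN.
apply: (measurable_nat_sel (N := fun w => sigmaN w.1 k)
  (g := fun m w => \sum_(m <= l < sigmaN w.1 k.+1) w.2 l)) => m.
  exact: measurable_sigmaN.
apply: (measurable_nat_sel (N := fun w => sigmaN w.1 k.+1)
  (g := fun m' w => \sum_(m <= l < m') w.2 l)) => m'.
  exact: measurable_sigmaN.
by apply: measurable_sum => l; exact: measurable_holding.
Qed.

End RestrictionMeasurability.

(** * Telescoping of the step densities *)

Section Telescoping.
Variables (R : realType) (U : finType).
Implicit Types (W : U -> U -> R) (x : nat -> U) (t : nat -> R).

Definition loca x t n v : R := Num.sqrt (1 + loc x t n v).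

Lemma locS x t n v : loc x t n.+1 v = loc x t n v + (x n == v)%:R * t n.
Proof.
rewrite /loc big_mkcond big_ord_recr /= -big_mkcond /=; congr (_ + _).
by case: eqP; rewrite ?mul1r ?mul0r.
Qed.

Lemma loc_ge0 x t n v : (forall k, (k < n)%N -> 0 < t k) -> 0 <= loc x t n v.
Proof. by move=> t0; apply: sumr_ge0 => m _; rewrite ltW // t0. Qed.

Lemma perm_laplace W a s s' : perm_eq s s' -> laplace W a s = laplace W a s'.
Proof.
move=> ss'; rewrite /laplace (perm_big _ ss') /=.
have -> // : energy W a s = energy W a s'.
rewrite /energy (perm_big _ ss') /=; congr (_ / _); apply: eq_bigr => i _; exact: perm_big.
Qed.

(** [dens] with the local times as an argument [l], so that a path can also be processed from its
    first step on. *)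
Definition stepd W (l : U -> R) (i j : U) (s : R) : R :=
  if 0 < s then
    (if j != i then W i j / 2 * Num.sqrt (1 + l j) / Num.sqrt (1 + l i + s) else W i i / 2) *
    expR (- (\sum_(v | v != i)
               W i v * Num.sqrt (1 + l v) *
                 (Num.sqrt (1 + l i + s) - Num.sqrt (1 + l i))
             + W i i * s / 2))
  else 0.

Lemma stepd_ge0 W l i j s : (forall i j, 0 <= W i j) -> 0 <= stepd W l i j s.
Proof.
move=> W0; rewrite /stepd; case: ifP => // tk; rewrite mulr_ge0 ?expR_ge0 //.
by case: ifP => _; rewrite ?divr_ge0 ?mulr_ge0 ?sqrtr_ge0.
Qed.

Lemma measurable_stepd d (X : measurableType d) (W : X -> U -> U -> R) (l : X -> U -> R) i j
    (s : X -> R) : mweights W ->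
  (forall v, measurable_fun setT (fun w => l w v)) -> measurable_fun setT s ->
  measurable_fun setT (fun w => stepd (W w) (l w) i j (s w)).
Proof.
move=> mW ml ms.
have msq (f : X -> R) : measurable_fun setT f -> measurable_fun setT (fun w => Num.sqrt (f w)).
  by move=> mf; exact: (measurableT_comp (@measurable_sqrtr R)).
have m1l v : measurable_fun setT (fun w => 1 + l w v) by exact: measurable_funD.
have m1ls : measurable_fun setT (fun w => 1 + l w i + s w) by exact: measurable_funD.
rewrite /stepd; apply: measurable_fun_ifT => //; first exact: measurable_fun_ltr.
apply: measurable_funM.
  case: (j != i); last exact: measurable_funM.
  apply: measurable_div; last exact: msq.
  by apply: measurable_funM; [exact: measurable_funM|exact: msq].
apply: (measurableT_comp (@measurable_expR R)); apply: measurable_funN.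
apply: measurable_funD; last by apply: measurable_funM => //; exact: measurable_funM.
under eq_fun do rewrite big_mkcond; apply: measurable_sum => v.
case: (v != i) => //; apply: measurable_funM.
  by apply: measurable_funM => //; exact: msq.
by apply: measurable_funB; exact: msq.
Qed.

Lemma measurable_loc d (X : measurableType d) x (t : X -> nat -> R) n v :
  (forall k, measurable_fun setT (fun w => t w k)) -> measurable_fun setT (fun w => loc x (t w) n v).
Proof.
move=> mt; rewrite /loc; under eq_fun do rewrite big_mkcond.
by apply: measurable_sum => m; case: (x m == v).
Qed.

Lemma measurable_dens d (X : measurableType d) (W : X -> U -> U -> R) (x : nat -> U)
    (t : X -> nat -> R) k : mweights W -> (forall k, measurable_fun setT (fun w => t w k)) ->
  measurable_fun setT (fun w => dens (W w) x (t w) k).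
Proof.
move=> mW mt.
exact: (@measurable_stepd _ X W (fun w => loc x (t w) k) (x k) (x k.+1) (fun w => t w k) mW
  (fun v => measurable_loc x k v mt) (mt k)).
Qed.

Lemma prod_dens_ge0 W x (B : nat -> set R) n t : (forall i j, 0 <= W i j) ->
  0 <= \prod_(k < n) (\1_(B k) (t k) * dens W x t k).
Proof.
move=> W0; apply: prodr_ge0 => k _; rewrite mulr_ge0 ?indicE ?ler0n //.
exact: (stepd_ge0 (loc x t k)).
Qed.

(** A step at [i] changes only [a i], whose square grows by [t n]. The survival exponent is the
    resulting increment of the energy, and the factor [a j / a' i] moves the boundary term from [i]
    to [j] while updating the product of inverses. *)
Lemma prod_dens W x t n : (forall i j, W i j = W j i) ->
  (forall k, (k < n)%N -> 0 < t k) ->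
  \prod_(k < n) dens W x t k = \prod_(k < n) (W (x k) (x k.+1) / 2) *
    (loca x t n (x n) * laplace W (loca x t n) (enum U)).
Proof.
move=> Ws; elim: n => [|n IH] t0.
  have l0 v : loca x t 0 v = 1 by rewrite /loca /loc big_ord0 addr0 sqrtr1.
  have -> : loca x t 0 = fun=> 1 by apply/funext.
  by rewrite !big_ord0 laplace1 !mulr1.
rewrite big_ord_recr /= IH; last by move=> k kn; apply: t0; rewrite ltnS ltnW.
rewrite [in RHS]big_ord_recr /= -[LHS]mulrA -[RHS]mulrA; congr (_ * _).
have tn0 : 0 < t n by exact: t0.
have l0 v : 0 <= loc x t n v by apply: loc_ge0 => k kn; apply: t0; rewrite ltnS ltnW.
set a := loca x t n; set a' := loca x t n.+1.
set i := x n; set j := x n.+1.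
have a_gt0 v : 0 < a v by rewrite sqrtr_gt0 ltr_wpDr.
have a'ne v : v != i -> a' v = a v.
  by move=> vi; rewrite /a' /a /loca locS -/i eq_sym (negbTE vi) mul0r addr0.
have a'i : a' i = Num.sqrt (1 + loc x t n i + t n).
  by rewrite /a' /loca locS -/i eqxx mul1r addrA.
have a'i0 : 0 < a' i by rewrite a'i sqrtr_gt0 -addrA ltr_pwDl // addr_ge0 // ltW.
have a'2 : a' i ^+ 2 = a i ^+ 2 + t n.
  by rewrite a'i !sqr_sqrtr // ?addr_ge0 // ltW.
pose r := rem i (enum U).
have pr : perm_eq (enum U) (i :: r) by apply: perm_to_rem; rewrite mem_enum.
have ir v : v \in r -> v != i by rewrite mem_rem_uniq ?enum_uniq // inE => /andP[].
have rE (f : U -> R) : \sum_(v | v != i) f v = \sum_(v <- r) f v.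
  by rewrite /r rem_filter ?enum_uniq // big_filter big_enum_cond; apply: eq_bigl.
rewrite !(perm_laplace _ _ pr) /laplace !energy_cons // !big_cons.
have -> : energy W a' r = energy W a r.
  rewrite /energy; congr (_ / _); apply: eq_big_seq => k kr; apply: eq_big_seq => l lr.
  by rewrite !a'ne // ir.
have -> : \prod_(v <- r) (a' v)^-1 = \prod_(v <- r) (a v)^-1.
  by apply: eq_big_seq => v vr; rewrite a'ne // ir.
have -> : \sum_(v <- r) W i v * a' v = \sum_(v <- r) W i v * a v.
  by apply: eq_big_seq => v vr; rewrite a'ne // ir.
rewrite /dens -/i -/j tn0 rE -a'i.
have -> : \sum_(v <- r) W i v * Num.sqrt (1 + loc x t n v) * (a' i - Num.sqrt (1 + loc x t n i)) =
    (\sum_(v <- r) W i v * a v) * (a' i - a i) by rewrite mulr_suml.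
rewrite -/(loca x t n j) -/a; set S := \sum_(v <- r) W i v * a v.
set T := \sum_(v <- r) W i v; set P := \prod_(v <- r) _; set E := energy _ _ _.
(* Loops and jumps take the same form: at a loop the ratio is 1, and at a jump the local time of [j]
   is unchanged during the step. *)
have -> : (if j != i then W i j / 2 * a j / a' i else W i i / 2) = W i j / 2 * (a' j / a' i).
  case: eqVneq => [->|ji] /=; first by rewrite divff ?mulr1 // lt0r_neq0.
  by rewrite (a'ne j ji) -mulrA.
rewrite [LHS](_ : _ = (W i j / 2 * (a' j / a' i) * P) *
  (expR (- (E + W i i * (a i ^+ 2 - 1) / 2 + (a i * S - T))) *
   expR (- (S * (a' i - a i) + W i i * t n / 2)))); last first.
  by field; rewrite !lt0r_neq0.
rewrite [RHS](_ : _ = (W i j / 2 * (a' j / a' i) * P) *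
  expR (- (E + W i i * (a' i ^+ 2 - 1) / 2 + (a' i * S - T)))); last first.
  by field; rewrite !lt0r_neq0.
rewrite -expRD; congr (_ * expR _); rewrite a'2; by field.
Qed.

Lemma prod_dens0 W x t n k : (k < n)%N -> ~~ (0 < t k) -> \prod_(k < n) dens W x t k = 0.
Proof.
move=> kn tk; rewrite (bigD1 (Ordinal kn)) //= {1}/dens (negbTE tk) mul0r //.
Qed.

End Telescoping.

(** * The vrjp as a mixture of path weights *)

Section Mixture.
Variables (R : realType) (V U : finType) (i : U -> V).
Hypothesis inji : injective i.
Variables (W : V -> V -> R).
Hypothesis Ws : forall j k, W j k = W k j.
Hypothesis W0 : forall j k, 0 <= W j k.

(* The square root is the boundary term left over when the step densities telescope. *)
Definition path_weight (W : V -> V -> R) (b : V -> R) (x : nat -> V) (B : nat -> set R)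
    n (t : nat -> R) : R :=
  \prod_(k < n) (\1_(B k) (t k) * (0 < t k)%R%:R * (W (x k) (x k.+1) / 2) *
                 expR (- (b (x k) * t k))) * Num.sqrt (1 + loc x t n (x n)).

Lemma sum_loc (r : seq V) (x : nat -> V) t n (b : V -> R) : uniq r ->
  (forall k, (k < n)%N -> x k \in r) ->
  \sum_(v <- r) loc x t n v * b v = \sum_(k < n) b (x k) * t k.
Proof.
move=> ur xr; rewrite /loc; under eq_bigr do rewrite mulr_suml.
rewrite (exchange_big_dep xpredT) //=; apply: eq_bigr => k _.
rewrite big_mkcond (bigD1_seq (x k)) ?xr //= eqxx big1 ?addr0 1?mulrC // => v.
by rewrite eq_sym => /negbTE ->.
Qed.

Lemma measurable_path_weight d (X : measurableType d) (W' : X -> V -> V -> R)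
    (b : X -> V -> R) (x : nat -> V) (B : nat -> set R) n (t : X -> nat -> R) :
  (forall k, measurable (B k)) -> mweights W' -> mpoint b ->
  (forall k, measurable_fun setT (fun w => t w k)) ->
  measurable_fun setT (fun w => path_weight (W' w) (b w) x B n (t w)).
Proof.
move=> mB mW mb mt; apply: measurable_funM.
  apply: measurable_prod => k _; apply: measurable_funM.
    apply: measurable_funM; last exact: measurable_funM.
    apply: measurable_funM.
      exact: (measurableT_comp (measurable_indic (mB k)) (mt k)).
    rewrite (_ : (fun _ => _) = (fun w => if 0 < t w k then 1 else 0 : R)); last first.
      by apply/funext => w; case: ifP.
    by apply: measurable_fun_ifT => //; exact: measurable_fun_ltr.
  apply: (measurableT_comp (@measurable_expR R)).
  by apply: measurable_funN; exact: measurable_funM.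
apply: (measurableT_comp (@measurable_sqrtr R)); apply: measurable_funD => //.
exact: measurable_loc.
Qed.

Lemma path_weight_ge0 W' b x B n t : (forall j k, 0 <= W' j k) -> 0 <= path_weight W' b x B n t.
Proof.
move=> W'0; rewrite mulr_ge0 ?sqrtr_ge0 //; apply: prodr_ge0 => k _.
by rewrite !mulr_ge0 ?expR_ge0 ?invr_ge0 // ?ler0n // indicE ler0n.
Qed.

Lemma laplace_map (W' : V -> V -> R) a s :
  laplace (fun u u' => W' (i u) (i u')) (a \o i) s = laplace W' a (map i s).
Proof.
rewrite /laplace big_map.
have -> // : energy (fun u u' => W' (i u) (i u')) (a \o i) s = energy W' a (map i s).
rewrite /energy big_map; congr (_ / _).
by apply: eq_bigr => u _; rewrite big_map.
Qed.

Lemma iint0 (K : choiceType) s (f : K -> R) : iint s (fun=> 0%E) f = 0%E.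
Proof. by elim: s f => //= k s IH f; under eq_integral do rewrite IH; rewrite integral0. Qed.

(** For fixed holding times the exponentials combine to [exp (- sum_v l v * b v)] over the image of
    [U], so the integral over these coordinates is a Laplace transform of the eliminated weights,
    and telescoping read backwards yields step densities. With [s] empty this represents the process
    on [V], with [s] enumerating [I] the mixture on [J]. *)
Lemma iint_mixture s n (y : nat -> U) (B : nat -> set R) f :
  (forall k, measurable (B k)) -> uniq (s ++ map i (enum U)) ->
  (iint (s ++ map i (enum U)) (fun b => (nuS (s ++ map i (enum U)) W b)%:E *
     iterint n (fun t => (path_weight (elimS s b W) b (i \o y) B n t)%:E)) f =
   iint s (fun b => (nuM s (map i (enum U)) W b)%:E *
     iterint n (fun t => (\prod_(k < n)
       (\1_(B k) (t k) * dens (fun u u' => elimS s b W (i u) (i u')) y t k))%:E)) f)%E.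
Proof.
move=> mB us; set r := map i (enum U).
(* Absolute values in [e] and [a] make these quantities nonnegative everywhere; they change nothing
   where the pivots and the holding times are positive. *)
pose e (b : V -> R) j k := `|elimS s b W j k|.
pose G (t : nat -> R) b : R := \prod_(k < n) (\1_(B k) (t k) * (0 < t k)%R%:R *
   (e b (i (y k)) (i (y k.+1)) / 2)) * loca y t n (y n).
pose a (t : nat -> R) v := Num.sqrt (1 + `|loc (i \o y) t n v|).
pose D b (t : nat -> R) := \prod_(k < n)
       (\1_(B k) (t k) * dens (fun u u' => elimS s b W (i u) (i u')) y t k).
have a0 t v : 0 < a t v by rewrite sqrtr_gt0 ltr_pwDl.
have a2 t v : a t v ^+ 2 - 1 = `|loc (i \o y) t n v|.
  by rewrite sqr_sqrtr ?addr_ge0 // addrC addKr.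
have ioy (t : nat -> R) k : loc (i \o y) t n (i k) = loc y t n k.
  by rewrite /loc; apply: eq_bigl => m /=; rewrite (inj_eq inji).
have G0 t b : 0 <= G t b.
  rewrite /G mulr_ge0 ?sqrtr_ge0 //; apply: prodr_ge0 => k _.
  by rewrite !mulr_ge0 ?invr_ge0 ?normr_ge0 ?ler0n // ?indicE ?ler0n.
have eE b : pivS s b W -> forall j k, e b j k = elimS s b W j k.
  by move=> ps j k; rewrite /e ger0_norm // elimS_ge0.
have nuS0 b : ~~ pivS s b W -> nuS (s ++ r) W b = 0.
  by move=> ps; rewrite nuS_piv0 // pivS_cat (negbTE ps).
have tpos (t : nat -> R) : (forall k, (k < n)%N -> 0 < t k) \/ exists2 k, (k < n)%N & ~~ (0 < t k).
  have [h|h] := pselect (exists2 k, (k < n)%N & ~~ (0 < t k)); [by right|left].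
  by move=> k kn; apply/negPn/negP => tk; apply: h; exists k.
have mWm : mweights (fun b : FunSp R V => elimS s b W).
  apply: measurable_elimS; first by move=> j k; exact: measurable_cst.
  by move=> v; exact: measurable_eval.
have pwE t b : nuS (s ++ r) W b * path_weight (elimS s b W) b (i \o y) B n t =
    nuS (s ++ r) W b * (G t b * expR (- \sum_(v <- r) (a t v ^+ 2 - 1) * b v)).
  have [ps|nps] := boolP (pivS s b W); last by rewrite nuS0 // !mul0r.
  congr (_ * _); rewrite /path_weight /G.
  have [tp|[k kn tk]] := tpos t; last first.
    by rewrite (bigD1 (Ordinal kn)) //= (negbTE tk) mulr0 !mul0r
      (bigD1 (Ordinal kn)) //= (negbTE tk) mulr0 !mul0r.
  rewrite ioy -/(loca y t n (y n)) big_split /= -expR_sum mulrAC.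
  have -> : \sum_(v <- r) (a t v ^+ 2 - 1) * b v = \sum_(k < n) b ((i \o y) k) * t k.
    rewrite -(@sum_loc r); last 2 first.
    - by rewrite map_inj_uniq ?enum_uniq.
    - by move=> k _; apply: map_f; rewrite mem_enum.
    by apply: eq_bigr => v _; rewrite a2 ger0_norm // loc_ge0.
  rewrite sumrN; congr (_ * _ * _); apply: eq_bigr => k _.
  by rewrite /= eE.
have DE t b : nuM s r W b * (G t b * laplace (elimS s b W) (a t) r) = nuM s r W b * D b t.
  have [ps|nps] := boolP (pivS s b W); last by rewrite nuM_piv0 // !mul0r.
  congr (_ * _); rewrite /D big_split /=.
  have [tp|[k kn tk]] := tpos t; last first.
    rewrite (prod_dens0 _ _ kn tk) mulr0 /G (bigD1 (Ordinal kn)) //=.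
    by rewrite (negbTE tk) mulr0 !mul0r.
  rewrite prod_dens //; last by move=> j k; exact: elimS_sym.
  have -> : laplace (elimS s b W) (a t) r =
      laplace (fun u u' => elimS s b W (i u) (i u')) (loca y t n) (enum U).
    rewrite /r -laplace_map; congr laplace; apply/funext => u /=.
    by rewrite /a ioy ger0_norm // loc_ge0.
  have GE : \prod_(k < n) (\1_(B k) (t k) * (0 < t k)%R%:R * (e b (i (y k)) (i (y k.+1)) / 2)) =
      \prod_(k < n) \1_(B k) (t k) * \prod_(k < n) (elimS s b W (i (y k)) (i (y k.+1)) / 2).
    by rewrite -big_split /=; apply: eq_bigr => k _; rewrite tp ?ltn_ord // mulr1 !eE.
  by rewrite /G GE -!mulrA.
have mnuS : measurable_fun setT (fun p : FunSp R V * FunSp R nat => nuS (s ++ r) W p.1).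
  apply: measurable_nuS => [j k|v]; first exact: measurable_cst.
  exact: (measurableT_comp (measurable_eval v) measurable_fst).
have mnuM : measurable_fun setT (fun p : FunSp R V * FunSp R nat => nuM s r W p.1).
  apply: measurable_nuM => [j k|v]; first exact: measurable_cst.
  exact: (measurableT_comp (measurable_eval v) measurable_fst).
have mt k : measurable_fun setT (fun p : FunSp R V * FunSp R nat => p.2 k).
  exact: (measurableT_comp (measurable_eval k) measurable_snd).
have mb v : measurable_fun setT (fun p : FunSp R V * FunSp R nat => p.1 v).
  exact: (measurableT_comp (measurable_eval v) measurable_fst).
have mW2 : mweights (fun p : FunSp R V * FunSp R nat => elimS s p.1 W).
  by move=> j k; exact: (measurableT_comp (mWm j k) measurable_fst).
have pw0 b t : pivS s b W -> 0 <= path_weight (elimS s b W) b (i \o y) B n t.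
  by move=> ps; apply: path_weight_ge0 => j k; exact: elimS_ge0.
have D0 b t : 0 <= nuM s r W b * D b t.
  rewrite -DE; apply: mulr_ge0; first exact: nuM_ge0.
  apply: mulr_ge0; first exact: G0.
  apply: mulr_ge0; last exact: expR_ge0.
  by apply: prodr_ge0 => v _; rewrite invr_ge0; exact: ltW (a0 t v).
have L0 b t : 0 <= nuS (s ++ r) W b * path_weight (elimS s b W) b (i \o y) B n t.
  rewrite pwE; apply: mulr_ge0; first exact: nuS_ge0.
  apply: mulr_ge0; [exact: G0|exact: expR_ge0].
transitivity (iint (s ++ r) (fun b => iint (iota 0 n) (fun t =>
    (nuS (s ++ r) W b * path_weight (elimS s b W) b (i \o y) B n t)%:E) (fun=> 0)) f).
  apply: eq_iint => b; rewrite iterintE.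
  have [ps|nps] := boolP (pivS s b W); last first.
    rewrite nuS0 // mul0e; under eq_iint do rewrite mul0r.
    by rewrite iint0.
  rewrite -iintZl ?lee_fin ?nuS_ge0 //; last by move=> t; rewrite lee_fin pw0.
  apply/measurable_EFinP.
  refine (@measurable_path_weight _ (FunSp R nat) (fun=> elimS s b W) (fun=> b) (i \o y) B n (fun t => t) _ _ _ _) => //.
  by move=> k; exact: measurable_eval.
rewrite iint_swap2; last 2 first.
- apply/measurable_EFinP; apply: measurable_funM => //.
  exact: measurable_path_weight.
- by move=> b t; rewrite lee_fin.
transitivity (iint (iota 0 n) (fun t => iint s (fun b => (nuM s r W b * D b t)%:E) f) (fun=> 0)).
  apply: eq_iint => t.
  under eq_iint => b do rewrite pwE EFinM (EFinM (G t b)).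
  rewrite (@iint_marginal R V s r W (a t) (fun b => (G t b)%:E) f) //.
  - by apply: eq_iint => b; rewrite -!EFinM DE.
  - by move=> b; rewrite lee_fin.
  - move=> b b' bb'; rewrite /G /e; congr (_ * _)%:E.
    by apply: eq_bigr => k _; rewrite (eq_on_elim _ bb').
rewrite -(@iint_swap2 _ _ _ s (iota 0 n) (fun b t => (nuM s r W b * D b t)%:E)); last 2 first.
- apply/measurable_EFinP; apply: measurable_funM => //.
  apply: measurable_prod => k _; apply: measurable_funM.
    exact: (measurableT_comp (measurable_indic (mB k)) (mt k)).
  by apply: measurable_dens => // u u'; exact: mW2.
- by move=> b t; rewrite lee_fin.
apply: eq_iint => b; rewrite iterintE.
have [ps|nps] := boolP (pivS s b W); last first.
  rewrite nuM_piv0 // mul0e; under eq_iint do rewrite mul0r.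
  by rewrite iint0.
have D0' t : 0 <= D b t by apply: prod_dens_ge0 => u u'; exact: elimS_ge0.
rewrite -iintZl //; last by rewrite lee_fin nuM_ge0.
apply/measurable_EFinP; apply: measurable_prod => k _; apply: measurable_funM.
  have mk : measurable_fun [set: FunSp R nat] (fun t => t k) by exact: measurable_eval.
  exact: (measurableT_comp (measurable_indic (mB k)) mk).
refine (@measurable_dens _ _ _ (FunSp R nat) (fun=> (fun u u' => elimS s b W (i u) (i u'))) y (fun t => t) k _ _) => //.
by move=> m; exact: measurable_eval.
Qed.

End Mixture.

(** * Restriction *)

Section NeumannSeries.
Variables (R : realType) (V : finType).

Lemma posdefS_diag (s : seq V) (M : V -> V -> R) u : uniq s -> posdefS s M -> u \in s -> 0 < M u u.
Proof.
move=> us pd uS; have := pd (fun i => (i == u)%:R); rewrite /quadS => /(_ _).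
rewrite (bigD1_seq u) //= (bigD1_seq u) //= eqxx mul1r mulr1.
rewrite big1 ?addr0; last by move=> j /negbTE ->; rewrite mulr0.
rewrite big1 ?addr0; last by move=> i /negbTE iu; rewrite big1 // => j _; rewrite iu !mul0r.
by apply; exists u; rewrite // eqxx oner_neq0.
Qed.

Variables (s : seq V) (W : V -> V -> R) (b : V -> R) (j : V) (X : V -> R).
Hypotheses (us : uniq s) (W0 : forall i k, 0 <= W i k) (pd : posdefS s (Hb W b)).
Hypothesis X0 : forall a, a \in s -> 0 <= X a.
Hypothesis Xeq : forall a, a \in s -> 2 * b a * X a = W a j + \sum_(c <- s) W a c * X c.

Lemma b_gt0 u : u \in s -> 0 < b u.
Proof.
move=> uS; have := posdefS_diag us pd uS; rewrite /Hb eqxx mulr1 subr_gt0 => h.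
by have := le_lt_trans (W0 u u) h; rewrite pmulr_rgt0.
Qed.

(** Total weight of the paths from [u] to [j] through [s] with at most [M] steps. Each step carries
    a jump factor [W / 2] and an integrated holding time [1 / b], whence the divisor [2 * b u]. *)
Fixpoint neumann M (u : V) : R :=
  if M is M'.+1 then (W u j + \sum_(c <- s) W u c * neumann M' c) / (2 * b u) else 0.

Lemma neumann_ge0 M u : u \in s -> 0 <= neumann M u.
Proof.
elim: M u => //= M IH u uS; apply: divr_ge0; last by rewrite mulr_ge0 // ltW // b_gt0.
by rewrite addr_ge0 // big_seq sumr_ge0 // => c cs; rewrite mulr_ge0 // IH.
Qed.

Lemma neumann_nd M u : u \in s -> neumann M u <= neumann M.+1 u.
Proof.
elim: M u => [|M IH] u uS; first exact: neumann_ge0.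
rewrite /= ler_pM2r ?invr_gt0 ?mulr_gt0 ?b_gt0 // lerD2l.
by rewrite big_seq [leRHS]big_seq ler_sum // => c cs; rewrite ler_wpM2l // IH.
Qed.

Lemma neumann_le M u : u \in s -> neumann M u <= X u.
Proof.
elim: M u => [|M IH] u uS /=; first exact: X0.
rewrite ler_pdivrMr ?mulr_gt0 ?b_gt0 // [leRHS]mulrC Xeq // lerD2l.
by rewrite big_seq [leRHS]big_seq ler_sum // => c cs; rewrite ler_wpM2l // IH.
Qed.

(** The partial sums increase and stay below [X]; their limits solve the system of [X], whose
    solution is unique by positive definiteness. *)
Lemma neumann_cvg u : u \in s -> neumann M u @[M --> \oo] --> X u.
Proof.
have nd v : v \in s -> nondecreasing_seq (fun M => neumann M v).
  by move=> vs; apply/nondecreasing_seqP => M; exact: neumann_nd.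
have cv v : v \in s -> cvgn (fun M => neumann M v).
  move=> vs; apply: nondecreasing_is_cvgn; first exact: nd.
  by exists (X v) => _ [M _ <-]; exact: neumann_le.
pose L v := limn (fun M => neumann M v).
move=> uS; have -> : X u = L u; last exact: cv.
apply: (solve_unique pd us _ uS) => a as_; rewrite Xeq // addrK.
have lim1 : neumann M.+1 a @[M --> \oo] --> L a by rewrite (cvg_shiftS (fun M => neumann M a)); exact: cv.
have lim2 : (W a j + \sum_(c <- s) W a c * neumann M c) / (2 * b a) @[M --> \oo] -->
    (W a j + \sum_(c <- s) W a c * L c) / (2 * b a).
  apply: cvgMl; apply: cvgD; first exact: cvg_cst.
  rewrite big_seq; under eq_fun do rewrite big_seq.
  apply: cvg_big => [|c cs]; first exact: add_continuous.
  by apply: cvgMr; exact: cv.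
have -> : L a = (W a j + \sum_(c <- s) W a c * L c) / (2 * b a).
  exact: (cvg_unique _ lim1 lim2).
rewrite mulrC divfK; last by rewrite mulf_neq0 // lt0r_neq0 // b_gt0.
by rewrite addrK.
Qed.

End NeumannSeries.

(** * Path weights as nested integrals over holding times *)

Section PathSum.
Variables (R : realType) (V : finType) (b : V -> R) (z : V).
Notation mu := (@lebesgue_measure R).
Implicit Types (W : V -> V -> R) (x y : nat -> V) (B : nat -> set R) (n N : nat).

Definition stail T (f : nat -> T) : nat -> T := fun k => f k.+1.

Definition hold (v : V) (A : set R) (g : R -> \bar R) : \bar R :=
  (\int[mu]_s ((\1_A s * (0 < s)%R%:R * expR (- (b v * s)))%:E * g s))%E.

Definition accrue (v : V) (a s : R) : R := a + (v == z)%:R * s.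

(* The path weight, with [a] the local time already spent at the final vertex [z]: no other local
   time enters. *)
Fixpoint pwr W n x B (a : R) : \bar R :=
  if n is n'.+1 then
    hold (x 0%N) (B 0%N) (fun s => (W (x 0%N) (x 1%N) / 2)%:E *
      pwr W n' (stail x) (stail B) (accrue (x 0%N) a s))%E
  else (Num.sqrt (1 + a))%:E.

Lemma hold_weight_ge0 v A s : 0 <= \1_A s * (0 < s)%R%:R * expR (- (b v * s)) :> R.
Proof. by rewrite !mulr_ge0 ?expR_ge0 ?ler0n // indicE ler0n. Qed.

Lemma hold_ge0 v A g : (forall s, 0 <= g s)%E -> (0 <= hold v A g)%E.
Proof.
by move=> g0; apply: integral_ge0 => s _; rewrite mule_ge0 // lee_fin hold_weight_ge0.
Qed.

Lemma measurable_hold_weight v A : measurable A ->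
  measurable_fun setT (fun s : R => \1_A s * (0 < s)%R%:R * expR (- (b v * s))).
Proof.
move=> mA; apply: measurable_funM.
  apply: measurable_funM; first exact: measurable_indic.
  rewrite (_ : (fun _ => _) = (fun w => if 0 < w then 1 else 0 : R)); last first.
    by apply/funext => w; case: ifP.
  by apply: measurable_fun_ifT => //; exact: measurable_fun_ltr.
apply: (measurableT_comp (@measurable_expR R)).
by apply: measurable_funN; exact: measurable_funM.
Qed.

Lemma measurable_hold_integrand v A (g : R -> \bar R) : measurable A -> measurable_fun setT g ->
  measurable_fun setT (fun s : R => (\1_A s * (0 < s)%R%:R * expR (- (b v * s)))%:E * g s)%E.
Proof.
by move=> mA mg; apply: emeasurable_funM => //; apply/measurable_EFinP; exact: measurable_hold_weight.
Qed.

Lemma measurable_hold v A (g : R -> \bar R) : measurable A -> measurable_fun setT g ->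
  (forall s, 0 <= g s)%E ->
  measurable_fun setT (fun a => hold v A (fun s => g (accrue v a s))).
Proof.
move=> mA mg g0.
apply: (measurable_fun_fubini_tonelli_F (m2 := mu) (fun p : R * R =>
  (\1_A p.2 * (0 < p.2)%R%:R * expR (- (b v * p.2)))%:E * g (accrue v p.1 p.2))%E).
  apply: emeasurable_funM.
    apply/measurable_EFinP.
    exact: (measurableT_comp (measurable_hold_weight v mA) measurable_snd).
  apply: (measurableT_comp mg); apply: measurable_funD => //.
  exact: measurable_funM.
by move=> p; rewrite mule_ge0 // lee_fin hold_weight_ge0.
Qed.

Lemma measurable_accrue v (g : R -> \bar R) a : measurable_fun setT g ->
  measurable_fun setT (fun s => g (accrue v a s)).
Proof.
by move=> mg; apply: (measurableT_comp mg); apply: measurable_funD => //; exact: measurable_funM.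
Qed.

Lemma le_hold v A (g g' : R -> \bar R) : measurable A -> measurable_fun setT g ->
  measurable_fun setT g' -> (forall s, 0 <= g s)%E -> (forall s, g s <= g' s)%E ->
  (hold v A g <= hold v A g')%E.
Proof.
move=> mA mg mg' g0 gg'; apply: ge0_le_integral => //.
- by move=> s _; rewrite mule_ge0 // lee_fin hold_weight_ge0.
- exact: measurable_hold_integrand.
- exact: measurable_hold_integrand.
- by move=> s _; rewrite lee_wpmul2l // lee_fin hold_weight_ge0.
Qed.

Lemma hold_cst v (c : \bar R) : 0 < b v -> (0 <= c)%E -> (hold v setT (fun=> c) = (b v)^-1%:E * c)%E.
Proof.
move=> b0 c0; rewrite /hold ge0_integralZr //.
- rewrite -(integral_expR_oy b0); congr (_ * _)%E; apply: eq_integral => s _.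
  by rewrite indicT mul1r; case: ifP => _; rewrite ?mul1r ?mul0r.
- by apply/measurable_EFinP; exact: measurable_hold_weight.
Qed.

Lemma hold_nneseries v A (g : nat -> R -> \bar R) : measurable A ->
  (forall N, measurable_fun setT (g N)) -> (forall N s, 0 <= g N s)%E ->
  (hold v A (fun s => \sum_(N <oo) g N s) = \sum_(N <oo) hold v A (g N))%E.
Proof.
move=> mA mg g0; rewrite /hold -integral_nneseries //; last 2 first.
- by move=> N; exact: measurable_hold_integrand.
- by move=> N s _; rewrite mule_ge0 // lee_fin hold_weight_ge0.
by apply: eq_integral => s _; rewrite nneseriesZl.
Qed.

Lemma hold_sum (I : Type) (r : seq I) v A (g : I -> R -> \bar R) : measurable A ->
  (forall i, measurable_fun setT (g i)) -> (forall i s, 0 <= g i s)%E ->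
  (hold v A (fun s => \sum_(N <- r) g N s) = \sum_(N <- r) hold v A (g N))%E.
Proof.
move=> mA mg g0; rewrite /hold -ge0_integral_sum //; last 2 first.
- by move=> N; exact: measurable_hold_integrand.
- by move=> N s _; rewrite mule_ge0 // lee_fin hold_weight_ge0.
by apply: eq_integral => s _; rewrite ge0_sume_distrr.
Qed.

Lemma pwr_ge0 W n x B a : (forall i k, 0 <= W i k) -> (0 <= pwr W n x B a)%E.
Proof.
move=> W0; elim: n x B a => [|n IH] x B a /=; first by rewrite lee_fin sqrtr_ge0.
by apply: hold_ge0 => s; rewrite mule_ge0 // lee_fin divr_ge0.
Qed.

Lemma measurable_pwr W n x B : (forall i k, 0 <= W i k) -> (forall k, measurable (B k)) ->
  measurable_fun setT (pwr W n x B).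
Proof.
move=> W0; elim: n x B => [|n IH] x B mB /=.
  apply/measurable_EFinP; apply: (measurableT_comp (@measurable_sqrtr R)).
  exact: measurable_funD.
have mB' k : measurable (stail B k) by exact: mB.
apply: (@measurable_hold _ _ (fun a => (W (x 0%N) (x 1%N) / 2)%:E * pwr W n (stail x) (stail B) a)%E) => //.
  by apply: emeasurable_funM => //; exact: IH.
by move=> s; rewrite mule_ge0 ?pwr_ge0 // lee_fin divr_ge0.
Qed.

Lemma iterint_pwr W n x B a : (forall i k, 0 <= W i k) -> (forall k, measurable (B k)) ->
  iterint n (fun t => (\prod_(k < n) (\1_(B k) (t k) * (0 < t k)%R%:R * (W (x k) (x k.+1) / 2) *
                 expR (- (b (x k) * t k))) * Num.sqrt (1 + (a + loc x t n z)))%:E) =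
  pwr W n x B a.
Proof.
move=> W0; elim: n x B a => [|n IH] x B a mB /=.
  by rewrite big_ord0 mul1r /loc big_ord0 addr0.
apply: eq_integral => s _.
have mB' k : measurable (stail B k) by exact: mB.
rewrite -(IH (stail x) (stail B)) // muleA -EFinM iterintE [in RHS]iterintE.
rewrite -iintZl.
- apply: eq_iint => t; rewrite -EFinM; congr _%:E.
  rewrite big_ord_recl (_ : a + loc x (scons s t) n.+1 z = accrue (x 0%N) a s + loc (stail x) t n z).
    by rewrite /=; ring.
  rewrite /accrue -addrA; congr (_ + _); rewrite /loc big_mkcond big_ord_recl /=.
  rewrite [in RHS]big_mkcond; congr (_ + _).
  by case: eqP; rewrite ?mul1r ?mul0r.
- apply/measurable_EFinP.
  have mt k : measurable_fun setT (fun t : FunSp R nat => t k) by exact: measurable_eval.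
  apply: measurable_funM.
    apply: measurable_prod => k _; apply: measurable_funM.
      apply: measurable_funM => //.
      apply: measurable_funM; first exact: (measurableT_comp (measurable_indic (mB' k)) (mt k)).
      rewrite (_ : (fun _ => _) = (fun w : FunSp R nat => if 0 < w k then 1 else 0 : R)); last first.
        by apply/funext => w; case: ifP.
      by apply: measurable_fun_ifT => //; exact: measurable_fun_ltr.
    apply: (measurableT_comp (@measurable_expR R)).
    by apply: measurable_funN; exact: measurable_funM.
  apply: (measurableT_comp (@measurable_sqrtr R)); apply: measurable_funD => //.
  by apply: measurable_funD => //; exact: (@measurable_loc _ _ _ (FunSp R nat) _ id).
- move=> t; rewrite lee_fin mulr_ge0 ?sqrtr_ge0 //; apply: prodr_ge0 => k _.
  by rewrite !mulr_ge0 ?expR_ge0 ?invr_ge0 // ?ler0n // indicE ler0n.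
- by rewrite lee_fin mulr_ge0 ?hold_weight_ge0 // divr_ge0.
Qed.

End PathSum.

(** * Sums over the paths with a given trace on [J] *)

Section SkeletonPaths.
Variables (R : realType) (V : finType) (I J : {set V}) (W : V -> V -> R) (b : V -> R) (z v0 : V).
Hypotheses (JI : forall v, (v \in I) = (v \notin J)) (zJ : z \in J).
Hypotheses (Ws : forall i j, W i j = W j i) (W0 : forall i j, 0 <= W i j).
Hypothesis ps : pivS (enum I) b W.
Implicit Types (x y : nat -> V) (B : nat -> set R) (n N : nat).

(* The trace of [x 0], ..., [x N] on [J] is [y 0], ..., [y n], and [x N] is its last point. *)
Fixpoint matches N n x y : bool :=
  if N is N'.+1 then
    if x 0%N \in J then
      if n is n'.+1 then (x 0%N == y 0%N) && matches N' n' (stail x) (stail y) else false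
    else matches N' n (stail x) y
  else (n == 0%N) && (x 0%N == y 0%N).

(** Constraints on a path inherited from constraints on its trace: the [k]-th visit to [J] receives
    [B k], and stays in [I] are free. *)
Fixpoint lift_sets x B l : set R :=
  if l is l'.+1 then lift_sets (stail x) (if x 0%N \in J then stail B else B) l'
  else if x 0%N \in J then B 0%N else setT.

Lemma measurable_lift_sets x B l : (forall k, measurable (B k)) -> measurable (lift_sets x B l).
Proof.
by elim: l x B => [|l IH] x B mB /=; [case: ifP|apply: IH => k; case: ifP => // _; exact: mB].
Qed.

Lemma sum_cons_tuple N (P : seq V -> bool) (F : seq V -> \bar R) :
  (\sum_(t : N.+1.-tuple V | P t) F t = \sum_v \sum_(t : N.-tuple V | P (v :: t)) F (v :: t))%E.
Proof.
rewrite pair_big_dep /= (reindex (fun p : V * N.-tuple V => cons_tuple p.1 p.2)) //=.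
exists (fun t : N.+1.-tuple V => (thead t, behead_tuple t)) => [[v t] _|t _] /=.
  by congr pair; apply: val_inj.
by apply: val_inj; rewrite /= {3}(tuple_eta t).
Qed.

(** The start [v] may lie in [I], in which case the path makes an excursion before it reaches [y 0];
    this is what first-step recursion requires. *)
Definition skel N n y B a v : \bar R :=
  (\sum_(t : N.-tuple V | matches N n (nth v0 (v :: t)) y)
     pwr b z W N (nth v0 (v :: t)) (lift_sets (nth v0 (v :: t)) B) a)%E.

Lemma skel_ge0 N n y B a v : (0 <= skel N n y B a v)%E.
Proof. by apply: sume_ge0 => t _; exact: pwr_ge0. Qed.

Lemma measurable_skel N n y B v : (forall k, measurable (B k)) ->
  measurable_fun setT (fun a => skel N n y B a v).
Proof.
move=> mB; rewrite /skel; under eq_fun do rewrite big_mkcond.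
apply: emeasurable_sum => t; case: (matches _ _ _ _); last exact: measurable_cst.
by apply: measurable_pwr => // k; exact: measurable_lift_sets.
Qed.

Lemma skel0 n y B a v :
  skel 0 n y B a v = if (n == 0%N) && (v == y 0%N) then (Num.sqrt (1 + a))%:E else 0%E.
Proof.
rewrite /skel /=; case: ifP => h; last by rewrite big_pred0.
rewrite (big_pred1 [tuple]) //= => t; by rewrite (tuple0 t); exact/esym/eqP.
Qed.

Definition spread N n y B a v : \bar R := (\sum_u (W v u / 2)%:E * skel N n y B a u)%E.

(** First-step decomposition, common to a start in [J], where the trace advances, and a start in
    [I], where it does not; the last three hypotheses express the difference. *)
Lemma skel_step N n y B a v (A : set R) n' y' B' : measurable A -> (forall k, measurable (B' k)) ->
  (forall t : seq V, matches N.+1 n (nth v0 (v :: t)) y = matches N n' (nth v0 t) y') ->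
  (forall t : seq V, lift_sets (nth v0 (v :: t)) B 0 = A) ->
  (forall t : seq V, stail (lift_sets (nth v0 (v :: t)) B) = lift_sets (nth v0 t) B') ->
  skel N.+1 n y B a v = hold b v A (fun s => spread N n' y' B' (accrue z v a s) v).
Proof.
move=> mA mB' hm hl hs; rewrite /skel.
rewrite (sum_cons_tuple N (fun t => matches N.+1 n (nth v0 (v :: t)) y)
  (fun t => pwr b z W N.+1 (nth v0 (v :: t)) (lift_sets (nth v0 (v :: t)) B) a)).
have mp u (t : N.-tuple V) : measurable_fun setT (fun s : R =>
    (W v u / 2)%:E * pwr b z W N (nth v0 (u :: t)) (lift_sets (nth v0 (u :: t)) B') (accrue z v a s))%E.
  apply: emeasurable_funM => //.
  apply: (@measurable_accrue _ _ z v (pwr b z W N (nth v0 (u :: t)) (lift_sets (nth v0 (u :: t)) B')) a).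
  by apply: measurable_pwr => // k; exact: measurable_lift_sets.
have p0 u (t : N.-tuple V) s : (0 <= 
    (W v u / 2)%:E * pwr b z W N (nth v0 (u :: t)) (lift_sets (nth v0 (u :: t)) B') (accrue z v a s))%E.
  by rewrite mule_ge0 ?pwr_ge0 // lee_fin divr_ge0.
transitivity (\sum_u hold b v A (fun s => (W v u / 2)%:E * skel N n' y' B' (accrue z v a s) u))%E; last first.
  rewrite /spread -hold_sum // => u.
    apply: emeasurable_funM => //.
    by apply: (@measurable_accrue _ _ z v (fun a => skel N n' y' B' a u)); exact: measurable_skel.
  by move=> s; rewrite mule_ge0 ?skel_ge0 // lee_fin divr_ge0.
apply: eq_bigr => u _; rewrite /skel.
transitivity (hold b v A (fun s => \sum_(t : N.-tuple V | matches N n' (nth v0 (u :: t)) y')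
   (W v u / 2)%:E * pwr b z W N (nth v0 (u :: t)) (lift_sets (nth v0 (u :: t)) B') (accrue z v a s)))%E; last first.
  by congr hold; apply/funext => s; rewrite ge0_sume_distrr // => t _; exact: pwr_ge0.
rewrite big_mkcond /=.
transitivity (hold b v A (fun s => \sum_(t : N.-tuple V) if matches N n' (nth v0 (u :: t)) y' then
   (W v u / 2)%:E * pwr b z W N (nth v0 (u :: t)) (lift_sets (nth v0 (u :: t)) B') (accrue z v a s) else 0))%E; last first.
  by congr hold; apply/funext => s; rewrite [RHS]big_mkcond.
rewrite hold_sum //; last 2 first.
- by move=> t; case: (matches _ _ _ _).
- by move=> t s; case: ifP.
apply: eq_bigr => t _; have /= -> := hm (u :: t); case: (matches N n' _ _) => /=.
  by have /= -> := hl (u :: t); have /= -> := hs (u :: t).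
by rewrite /hold; under eq_integral do rewrite mule0; rewrite integral0.
Qed.

Lemma skel_in N n y B a v : (forall k, measurable (B k)) -> v \in J -> v = y 0%N ->
  skel N.+1 n.+1 y B a v =
  hold b v (B 0%N) (fun s => spread N n (stail y) (stail B) (accrue z v a s) v).
Proof.
move=> mB vJ vy; apply: skel_step; first exact: mB.
- by move=> k; exact: mB.
- by move=> t /=; rewrite vJ vy eqxx.
- by move=> t /=; rewrite vJ.
- by move=> t; apply/funext => l; rewrite /stail /= vJ.
Qed.

Lemma skel_out N n y B a v : (forall k, measurable (B k)) -> v \in I ->
  skel N.+1 n y B a v = hold b v setT (fun s => spread N n y B a v).
Proof.
move=> mB vI; have vJ : v \in J = false by apply/negbTE; rewrite -JI.
rewrite (@skel_step N n y B a v setT n y B) //; last 3 first.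
- by move=> t /=; rewrite vJ.
- by move=> t /=; rewrite vJ.
- by move=> t; apply/funext => l; rewrite /stail /= vJ.
(* The final vertex [z] lies in [J], so a stay in [I] adds nothing to its local time. *)
rewrite /accrue; have -> : (v == z) = false by apply/eqP => vz; rewrite vz zJ in vJ.
by congr hold; apply/funext => s; rewrite mul0r addr0.
Qed.

Definition skels n y B a v : \bar R := (\sum_(N <oo) skel N n y B a v)%E.

Lemma skels_ge0 n y B a v : (0 <= skels n y B a v)%E.
Proof. by apply: nneseries_ge0 => *; exact: skel_ge0. Qed.

Lemma measurable_skels n y B v : (forall k, measurable (B k)) ->
  measurable_fun setT (fun a => skels n y B a v).
Proof.
move=> mB; apply: (ge0_emeasurable_sum (h := fun N a => skel N n y B a v) (P := xpredT)).
  by move=> *; exact: skel_ge0.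
by move=> N _; exact: measurable_skel.
Qed.

Lemma spread_ge0 N n y B a v : (0 <= spread N n y B a v)%E.
Proof. by apply: sume_ge0 => u _; rewrite mule_ge0 ?skel_ge0 // lee_fin divr_ge0. Qed.

Lemma measurable_spread N n y B a v : (forall k, measurable (B k)) ->
  measurable_fun setT (fun s => spread N n y B (accrue z v a s) v).
Proof.
move=> mB; apply: emeasurable_sum => u; apply: emeasurable_funM => //.
by apply: (@measurable_accrue _ _ z v (fun a => skel N n y B a u)); exact: measurable_skel.
Qed.

Lemma nneseries_spread n y B a v : (forall k, measurable (B k)) ->
  (\sum_(N <oo) spread N n y B a v = \sum_u (W v u / 2)%:E * skels n y B a u)%E.
Proof.
move=> mB; rewrite /spread nneseries_sum; last first.
  by move=> *; rewrite mule_ge0 ?skel_ge0 // lee_fin divr_ge0.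
by apply: eq_bigr => u _; rewrite nneseriesZl // => *; exact: skel_ge0.
Qed.

Lemma skels_recl n y B a v : skels n y B a v = (skel 0 n y B a v + \sum_(N <oo) skel N.+1 n y B a v)%E.
Proof.
rewrite /skels nneseries_recl //; last by move=> *; exact: skel_ge0.
congr (_ + _)%E; rewrite -(nneseries_addn 1); last by move=> *; exact: skel_ge0.
by under eq_eseriesr do rewrite addn1.
Qed.

Lemma skels_in n y B a v : (forall k, measurable (B k)) -> v \in J -> v = y 0%N ->
  skels n.+1 y B a v = hold b v (B 0%N)
    (fun s => \sum_u (W v u / 2)%:E * skels n (stail y) (stail B) (accrue z v a s) u)%E.
Proof.
move=> mB vJ vy; have mB' k : measurable (stail B k) by exact: mB.
rewrite skels_recl skel0 add0e.
under eq_eseriesr do rewrite skel_in //.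
rewrite -hold_nneseries //; last 2 first.
- by move=> N; exact: measurable_spread.
- by move=> N s; exact: spread_ge0.
by congr hold; apply/funext => s; rewrite nneseries_spread.
Qed.

(** In [I] the holding time is free and integrates to [1 / b v]; what remains is one step of the
    recursion that defines [neumann]. *)
Lemma skels_out n y B a v : (forall k, measurable (B k)) -> v \in I -> y 0%N \in J ->
  0 < b v ->
  skels n y B a v = ((b v)^-1%:E * \sum_u (W v u / 2)%:E * skels n y B a u)%E.
Proof.
move=> mB vI yJ b0; rewrite skels_recl skel0.
have -> : (v == y 0%N) = false by apply/eqP => vy; move: vI; rewrite JI vy yJ.
rewrite andbF add0e; under eq_eseriesr do rewrite skel_out //.
under eq_eseriesr do rewrite hold_cst ?spread_ge0 //.
by rewrite nneseriesZl ?nneseries_spread // => *; exact: spread_ge0.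
Qed.

(** Of all first steps from [v], only the jump to [j] and the jumps into [I] are kept. The
    coefficients [k] are 1 at [j], [h] on [I] and 0 elsewhere. *)
Lemma sum_excursions v j (h : V -> R) (F : V -> \bar R) (c : \bar R) : j \in J -> (0 <= c)%E ->
  (forall u, u \in I -> 0 <= h u) -> (forall u, 0 <= F u)%E ->
  (forall u, u \in I -> (h u)%:E * c <= F u)%E -> (c <= F j)%E ->
  (((W v j + \sum_(u <- enum I) W v u * h u) / 2)%:E * c <= \sum_u (W v u / 2)%:E * F u)%E.
Proof.
move=> jJ c0 h0 F0 hF cF.
pose k u := if u == j then 1 else if u \in I then h u else 0.
have k0 u : 0 <= k u by rewrite /k; case: ifP => // _; case: ifP => // /h0.
have -> : ((W v j + \sum_(u <- enum I) W v u * h u) / 2)%:E = (\sum_u (W v u / 2 * k u)%:E)%E.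
  rewrite sumEFin; congr _%:E.
  rewrite (bigD1 j) //= {1}/k eqxx mulr1 mulrDl mulr_suml big_enum_cond /=; congr (_ + _).
  rewrite big_mkcond [in RHS]big_mkcond /=; apply: eq_bigr => u _; rewrite /k andbT.
  case: (eqVneq u j) => [->|uj] /=; first by rewrite JI jJ.
  by case: ifP => _; rewrite ?mulr0 // mulrAC.
rewrite ge0_sume_distrl; last by move=> u _; rewrite lee_fin mulr_ge0 // divr_ge0.
apply: lee_sum => u _; rewrite EFinM -muleA lee_wpmul2l ?lee_fin ?divr_ge0 // /k.
case: eqP => [->|_]; first by rewrite mul1e.
by case: ifP => [/hF //|_]; rewrite mul0e.
Qed.

(** Each unfolding of [skels] at a vertex of [I] reproduces one step of [neumann], so the first [M]
    steps of an excursion are accounted for. *)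
Lemma skels_neumann n y B a v M : (forall k, measurable (B k)) -> y 0%N \in J -> v \in I ->
  ((neumann (enum I) W b (y 0%N) M v)%:E * skels n y B a (y 0%N) <= skels n y B a v)%E.
Proof.
move=> mB yJ.
have bI u : u \in I -> 0 < b u.
  move=> uI; apply: (b_gt0 (s := enum I) (W := W)) => //; rewrite ?mem_enum ?enum_uniq //.
  by apply/posdefS_piv; rewrite ?enum_uniq.
have N0 M' u : u \in I -> 0 <= neumann (enum I) W b (y 0%N) M' u.
  move=> uI; apply: neumann_ge0; rewrite ?mem_enum ?enum_uniq //.
  by apply/posdefS_piv; rewrite ?enum_uniq.
elim: M v => [|M IH] v vI /=; first by rewrite mul0e skels_ge0.
rewrite [leRHS]skels_out ?bI //.
have -> : (W v (y 0%N) + \sum_(c <- enum I) W v c * neumann (enum I) W b (y 0%N) M c) / (2 * b v) =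
  (b v)^-1 * ((W v (y 0%N) + \sum_(c <- enum I) W v c * neumann (enum I) W b (y 0%N) M c) / 2).
  by rewrite invfM; ring.
rewrite EFinM -muleA lee_wpmul2l ?lee_fin ?invr_ge0 ?(ltW (bI _ vI)) //.
by apply: sum_excursions => //; move=> *; rewrite ?skels_ge0 ?N0 ?IH.
Qed.

(** When [c] is infinite and [d] finite, the hypothesis forces all [u M], hence the limit, to be 0;
    the finite case is ordinary passage to the limit. *)
Lemma lee_cvg_mule (u : nat -> R) (l : R) (c d : \bar R) : u M @[M --> \oo] --> l ->
  (forall M, 0 <= u M) -> (0 <= c)%E -> (forall M, (u M)%:E * c <= d)%E -> (l%:E * c <= d)%E.
Proof.
move=> ul u0 c0 ucd; case: d ucd => [r| |] ucd; last 2 first.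
- exact: leey.
- have := le_trans (mule_ge0 _ c0) (ucd 0%N); rewrite lee_fin => /(_ (u0 0%N)).
  by rewrite leNgt ltNy0.
case: c c0 ucd => [c| |] c0 ucd //.
- rewrite -EFinM lee_fin; have ulc : u M * c @[M --> \oo] --> l * c by exact: cvgMl.
  apply: (cvgr_to_le ulc).
  by near=> M; rewrite -lee_fin EFinM.
- have u00 M : u M = 0.
    apply/eqP; rewrite eq_le u0 andbT leNgt; apply/negP => uM.
    by have := ucd M; rewrite gt0_muley ?lte_fin.
  have -> : l = 0.
    have uE : u = fun=> 0 by apply/funext.
    by apply: (cvg_unique _ ul) => //; rewrite uE; exact: cvg_cst.
  by have := ucd 0%N; rewrite u00 mul0e.
Unshelve. all: end_near. Qed.

(** A step with the Schur complement is a direct jump plus [sum_c W c * X c], and [X] is the limit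
    of the Neumann sums, each of which is dominated by actual excursions. *)
Lemma le_pwr_skels n y B a : (forall k, (k <= n)%N -> y k \in J) -> (forall k, measurable (B k)) ->
  (pwr b z (elimS (enum I) b W) n y B a <= skels n y B a (y 0%N))%E.
Proof.
have pd : posdefS (enum I) (Hb W b) by apply/posdefS_piv; rewrite ?enum_uniq.
elim: n y B a => [|n IH] y B a yJ mB.
  rewrite skels_recl skel0 !eqxx /= leeDl // nneseries_ge0 // => *; exact: skel_ge0.
have mB' k : measurable (stail B k) by exact: mB.
have yJ' k : (k <= n)%N -> stail y k \in J by move=> kn; exact: yJ.
have eW0 i j : 0 <= elimS (enum I) b W i j by exact: elimS_ge0.
rewrite skels_in ?yJ //=; apply: le_hold => //.
- apply: emeasurable_funM => //.
  apply: (@measurable_accrue _ _ z (y 0%N) (pwr b z (elimS (enum I) b W) n (stail y) (stail B)) a).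
  exact: measurable_pwr.
- apply: emeasurable_sum => u; apply: emeasurable_funM => //.
  apply: (@measurable_accrue _ _ z (y 0%N) (fun a => skels n (stail y) (stail B) a u)).
  exact: measurable_skels.
- by move=> s; rewrite mule_ge0 ?pwr_ge0 // lee_fin divr_ge0.
move=> s; set a' := accrue _ _ _ _.
have nI v : v \in J -> v \notin enum I by rewrite mem_enum JI negbK.
have [X [X0 Xeq Xel]] := elimS_solve (enum_uniq I) Ws W0 ps (nI _ (yJ 1%N isT)).
rewrite Xel ?nI ?yJ //.
apply: le_trans (_ : _ <= ((W (y 0%N) (y 1%N) + \sum_(c <- enum I) W (y 0%N) c * X c) / 2)%:E *
   skels n (stail y) (stail B) a' (y 1%N))%E _.
  rewrite lee_wpmul2l ?lee_fin ?IH // divr_ge0 // -Xel ?nI ?yJ //.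
apply: sum_excursions; rewrite ?yJ ?skels_ge0 //.
- by move=> u uI; apply: X0; rewrite mem_enum.
- by move=> u; exact: skels_ge0.
move=> u uI; apply: (@lee_cvg_mule (fun M => neumann (enum I) W b (y 1%N) M u)).
- by apply: neumann_cvg; rewrite ?mem_enum ?enum_uniq.
- by move=> M; apply: neumann_ge0; rewrite ?mem_enum ?enum_uniq.
- exact: skels_ge0.
- by move=> M; apply: (@skels_neumann n (stail y)) => //; exact: yJ'.
Qed.

End SkeletonPaths.

(** * Visit numbers and the trace on [J] *)

Section Skeleton.
Variables (V : finType) (J : {set V}).
Implicit Types (x y : nat -> V) (n N k l : nat).

(** Visits strictly before [l], so that a visit at time [l] has number [visits x l], counted from 0
    as in [tauJ]. *)
Fixpoint visits x l : nat := if l is l'.+1 then ((x 0%N \in J) + visits (stail x) l')%N else 0%N.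

Lemma visitsS x l : visits x l.+1 = (visits x l + (x l \in J))%N.
Proof.
elim: l x => [|l IH] x; first by rewrite /= addn0 add0n.
by rewrite [LHS]/= -/(visits (stail x) l.+1) IH addnA.
Qed.

Lemma lift_setsE (R : realType) x (B : nat -> set R) l : lift_sets J x B l = if x l \in J then B (visits x l) else setT.
Proof.
elim: l x B => [|l IH] x B //=; rewrite IH /stail; case: ifP => // _.
by case: (x 0%N \in J).
Qed.

Lemma matchesP N n x y : y n \in J -> matches J N n x y ->
  [/\ x N = y n, visits x N = n & forall l, (l < N)%N -> x l \in J -> x l = y (visits x l)].
Proof.
elim: N n x y => [|N IH] n x y yJ /=.
  by move=> /andP[/eqP -> /eqP ->].
case: ifPn => xJ.
  case: n yJ => // n yJ /andP[/eqP xy] /(IH _ _ _ yJ) [xN vN vl]; split=> //.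
    by rewrite vN.
  by move=> [|l] //= lN; rewrite xJ; exact: vl.
move=> /(IH _ _ _ yJ) [xN vN vl]; split=> //.
by move=> [|l] /= lN; [rewrite (negbTE xJ)|rewrite (negbTE xJ); exact: vl].
Qed.

Lemma eq_matches N n x x' y : (forall k, (k <= N)%N -> x k = x' k) ->
  matches J N n x y = matches J N n x' y.
Proof.
elim: N n x x' y => [|N IH] n x x' y e /=; first by rewrite e.
by case: n => [|n]; rewrite e // !(IH _ _ (stail x')) // => k kN; exact: e.
Qed.

Lemma eq_lift_sets (R : realType) x x' (B : nat -> set R) l : (forall k, (k <= l)%N -> x k = x' k) ->
  lift_sets J x B l = lift_sets J x' B l.
Proof.
elim: l x x' B => [|l IH] x x' B e /=; first by rewrite e.
by rewrite e // (IH _ (stail x')) // => k kl; exact: e.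
Qed.

(** As [x 0] is in [J], [(visits x l.+1).-1] is the number of the last visit up to and including
    time [l]. *)
Lemma tauJ_visits x l : x 0%N \in J ->
  [/\ (tauJ J x (visits x l.+1).-1 <= l)%N, x (tauJ J x (visits x l.+1).-1) \in J &
      forall i, (tauJ J x (visits x l.+1).-1 < i <= l)%N -> x i \notin J].
Proof.
move=> x0; elim: l => [|l [ml xm nJ]].
  rewrite /= x0 /=; split=> // i /andP[i0]; by rewrite leqNgt i0.
have v0 : (0 < visits x l.+1)%N by rewrite /= x0.
rewrite (visitsS x l.+1); case: (boolP (x l.+1 \in J)) => xl; last first.
  rewrite addn0; split=> // [|i]; first exact: leqW.
  by rewrite [(i <= _)%N]leq_eqVlt => /andP[mi /orP[/eqP -> //|il]]; apply: nJ; rewrite mi.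
have tl : tauJ J x (visits x l.+1 + 1).-1 = l.+1.
  rewrite addn1 -[_.+1.-1](prednK v0) [tauJ _ _ _]/=.
  by apply: hit_next_eq => // i /andP[mi il]; apply: nJ; rewrite mi.
by rewrite tl; split=> // i /andP[li il]; move: (leq_trans li il); rewrite ltnn.
Qed.

Lemma tauJ_visit x l : x 0%N \in J -> x l \in J -> tauJ J x (visits x l) = l.
Proof.
move=> x0 xl; have := tauJ_visits l x0; rewrite visitsS xl addn1 [_.+1.-1]/=.
move=> [ml _ nJ]; apply/eqP; rewrite eqn_leq ml leqNgt; apply/negP => lm.
by have := nJ l; rewrite lm leqnn xl => /(_ isT).
Qed.

Lemma visits_onto x k N : (k < visits x N)%N -> exists l, [/\ (l < N)%N, x l \in J & visits x l = k].
Proof.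
elim: N => // N IH; rewrite visitsS; case: (ltnP k (visits x N)) => [kN _|Nk].
  by have [l [lN xl vl]] := IH kN; exists l; split=> //; exact: leqW.
case: (boolP (x N \in J)) => [xN|_]; last by rewrite addn0 ltnNge Nk.
by rewrite addn1 ltnS => kN; exists N; split=> //; apply/eqP; rewrite eqn_leq Nk kN.
Qed.

End Skeleton.

Section RestrictionEvents.
Variables (R : realType) (V : finType) (J : {set V}) (rho : V) (hrho : rho \in J).
Notation PS := (PathSp R rho).
Notation JT := {x : V | x \in J}.
Notation d := (exist (fun x => x \in J) rho hrho : JT).
Implicit Types (y : nat -> JT) (B : nat -> set R) (n N k l : nat).

(** The step [N] is the [n]-th visit to [J], which is why the events are disjoint for different [N],
    and the first [N] holding times decide all constraints of the cylinder. *)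
Definition skel_event N n y B : set PS :=
  [set w | [/\ w.1 0%N = rho, matches J N n w.1 (val \o y) &
               forall l, (l < N)%N -> lift_sets J w.1 B l (w.2 l)]].

Lemma skel_event_sub N n y B :
  skel_event N n y B `<=` (restrJ d : PS -> PathSp R d) @^-1` cylset (v0 := d) n y B.
Proof.
move=> w [w0 wm wB]; have x0 : w.1 0%N \in J by rewrite w0.
have yJ : (val \o y) n \in J by exact: valP.
have [xN vN vl] := matchesP yJ wm.
have xNJ : w.1 N \in J by rewrite xN.
have tN : tauJ J w.1 n = N by rewrite -vN tauJ_visit.
have hit k : (k < n)%N -> exists l, [/\ (l < N)%N, w.1 l \in J, visits J w.1 l = k & tauJ J w.1 k = l].
  rewrite -{1}vN => /visits_onto [l [lN xl vlk]]; exists l; split=> //.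
  by rewrite -vlk tauJ_visit.
split=> k /= kn.
  apply: val_inj; move: kn; rewrite leq_eqVlt => /orP[/eqP ->|/hit [l [lN xl vk ->]]].
    by rewrite tN xN insubdK //; exact: valP.
  by rewrite insubdK // vl // vk.
have [l [lN xl vk ->]] := hit k kn.
by have := wB l lN; rewrite lift_setsE xl vk.
Qed.

Lemma skel_event_disjoint N N' n y B w :
  skel_event N n y B w -> skel_event N' n y B w -> N = N'.
Proof.
have yJ : (val \o y) n \in J by exact: valP.
move=> [w0 wm _] [_ wm' _]; have x0 : w.1 0%N \in J by rewrite w0.
have [xN vN _] := matchesP yJ wm; have [xN' vN' _] := matchesP yJ wm'.
by rewrite -(@tauJ_visit V J w.1 N) ?xN // vN -vN' tauJ_visit // xN'.
Qed.

Lemma skel_event_prefix N n y B (t : N.+1.-tuple V) :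
  skel_event N n y B `&` prefix_set t =
  if (nth rho t 0 == rho) && matches J N n (nth rho t) (val \o y)
  then cylset (v0 := rho) N (nth rho t) (lift_sets J (nth rho t) B) else set0.
Proof.
case: ifPn => [/andP[/eqP t0 tm]|ntm]; apply/seteqP; split=> w //=.
- move=> [[_ _ wB] wt]; split=> // k kN.
  rewrite -(@eq_lift_sets _ J _ w.1); first exact: wB.
  move=> i ik; apply: wt; exact: leq_trans ik (ltnW kN).
- move=> [wt wB]; split=> //; split; first by rewrite wt.
    by rewrite (@eq_matches _ J N n w.1 (nth rho t)).
  move=> l lN; rewrite (@eq_lift_sets _ J _ w.1 (nth rho t)); first exact: wB.
  move => i il.
  by apply: wt; exact: leq_trans il (ltnW lN).
- move=> [[w0 wm _] wt]; move/negP: ntm; apply; rewrite -wt // w0 eqxx /=.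
  by rewrite -(@eq_matches _ J N n w.1).
Qed.

Lemma measurable_skel_event N n y B : (forall k, measurable (B k)) -> measurable (skel_event N n y B).
Proof.
move=> mB; rewrite (_ : skel_event N n y B =
  \bigcup_(t in [set: N.+1.-tuple V]) (skel_event N n y B `&` prefix_set t)).
  apply: fin_bigcup_measurable => [|t _]; first exact: finite_finset.
  rewrite skel_event_prefix; case: ifP => // _; apply: measurable_cylset => k.
  exact: measurable_lift_sets.
apply/seteqP; split=> w /=; last by move=> [t _ []].
by move=> Ew; have [t wt] := prefix_cover N w; exists t.
Qed.

(** Disjoint events inside the preimage give a lower bound; paths on which some return index is the
    default value of [next] are left aside. *)
Lemma le_skel_events (P : probability PS R) n y B : (forall k, measurable (B k)) ->
  (\sum_(N <oo) \sum_(t : N.-tuple V | matches J N n (nth rho (rho :: t)) (val \o y))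
     P (cylset (v0 := rho) N (nth rho (rho :: t)) (lift_sets J (nth rho (rho :: t)) B))
   <= P ((restrJ d : PS -> PathSp R d) @^-1` cylset (v0 := d) n y B))%E.
Proof.
move=> mB.
have -> : (\sum_(N <oo) \sum_(t : N.-tuple V | matches J N n (nth rho (rho :: t)) (val \o y))
     P (cylset (v0 := rho) N (nth rho (rho :: t)) (lift_sets J (nth rho (rho :: t)) B)))%E =
   (\sum_(N <oo) P (skel_event N n y B))%E.
  apply: eq_eseriesr => N _.
  rewrite (@measure_prefix_partition _ _ _ P N); last exact: measurable_skel_event.
  transitivity (\sum_(t : N.+1.-tuple V | xpredT t) 
     if (nth rho t 0 == rho) && matches J N n (nth rho t) (val \o y)
     then P (cylset (v0 := rho) N (nth rho t) (lift_sets J (nth rho t) B)) else 0)%E; last first.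
    by apply: eq_bigr => t _; rewrite skel_event_prefix; case: ifP => //; rewrite measure0.
  rewrite (sum_cons_tuple N xpredT (fun t =>
     if (nth rho t 0 == rho) && matches J N n (nth rho t) (val \o y)
     then P (cylset (v0 := rho) N (nth rho t) (lift_sets J (nth rho t) B)) else 0%E)).
  rewrite (bigD1 rho) //= [X in _ = (_ + X)%E]big1 ?adde0; last first.
    by move=> v /negbTE vr; rewrite big1 // => t _; rewrite vr.
  by rewrite big_mkcond /=; apply: eq_bigr => t _; rewrite eqxx.
have mE : measurable (\bigcup_N skel_event N n y B).
  by apply: bigcupT_measurable => N; exact: measurable_skel_event.
rewrite -measure_semi_bigcup //; last 2 first.
- by move=> N; exact: measurable_skel_event.
- by move=> N N' _ _ [w [/skel_event_disjoint h /h]].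
apply: le_measure; rewrite ?inE //.
- rewrite -[X in measurable X]setTI; apply: measurable_restrJ => //.
  exact: measurable_cylset.
- by move=> w [N _ /skel_event_sub].
Qed.

End RestrictionEvents.

(** * Mixtures and images of laws on path space *)

Section Kernels.
Variables (R : realType) (V : finType) (v0 : V).
Notation PS := (PathSp R v0).

(** The weight [w] stays attached to [Q] because it will be an indicator that vanishes where [Q] is
    unspecified. Measurability passes from cylinders to all events by Dynkin's argument. *)
Lemma measurable_kernel d (Y : measurableType d) (w : Y -> R) (Q : Y -> probability PS R) :
  measurable_fun setT w -> (forall y, 0 <= w y) ->
  (forall n x B, (forall k, measurable (B k)) ->
    measurable_fun setT (fun y => (w y)%:E * Q y (cylset (v0 := v0) n x B))%E) ->
  forall A, measurable A -> measurable_fun setT (fun y => (w y)%:E * Q y A)%E.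
Proof.
move=> mw w0 mcyl.
apply: (@dynkin_induction _ PS (@cyl R V v0) (fun A => measurable_fun setT (fun y => (w y)%:E * Q y A)%E)) => //.
- exact: cyl_setI.
- under eq_fun do rewrite probability_setT mule1.
  exact/measurable_EFinP.
- by move=> _ [n [x [B [mB ->]]]]; exact: mcyl.
- move=> S mS mQ; rewrite (_ : (fun _ => _) = (fun y => (w y)%:E - (w y)%:E * Q y S)%E).
    by apply: emeasurable_funB => //; exact/measurable_EFinP.
  apply/funext => y; rewrite probability_setC // -[Q y S]fineK ?fin_num_measure //.
  by rewrite -EFinB -!EFinM -EFinB mulrBr mulr1.
- move=> F mF tF mQ; rewrite (_ : (fun _ => _) = (fun y => \sum_(n <oo) (w y)%:E * Q y (F n))%E).
    apply: (ge0_emeasurable_sum (h := fun n y => ((w y)%:E * Q y (F n))%E) (P := xpredT)) => //.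
    by move=> n y _ _; rewrite mule_ge0 ?lee_fin.
  apply/funext => y; rewrite nneseriesZl; last by move=> *; exact: measure_ge0.
  by rewrite measure_semi_bigcup //; exact: bigcupT_measurable.
Qed.

Section Mixture.
Variables (K : choiceType) (s : seq K) (f : K -> R) (w : (K -> R) -> R)
  (Q : (K -> R) -> probability PS R).
Hypothesis w0 : forall b, 0 <= w b.
Hypothesis mQ : forall A, measurable A ->
  measurable_fun setT (fun b : FunSp R K => (w b)%:E * Q b A)%E.
Hypothesis w1 : iint s (fun b => (w b)%:E) f = 1%E.

Definition mixture (A : set PS) : \bar R := iint s (fun b => (w b)%:E * Q b A)%E f.

Let wQ0 b A : (0 <= (w b)%:E * Q b A)%E.
Proof. by rewrite mule_ge0 ?lee_fin. Qed.

Let mixture0 : mixture set0 = 0%E.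
Proof.
rewrite /mixture (_ : (fun _ => _) = fun=> 0%E) ?iint0 //.
by apply/funext => b; rewrite measure0 mule0.
Qed.

Let mixture_ge0 A : (0 <= mixture A)%E.
Proof. exact: iint_ge0. Qed.

Let mixture_sigma_additive : semi_sigma_additive mixture.
Proof.
move=> F mF tF mUF.
rewrite (_ : mixture (\bigcup_n F n) = \sum_(n <oo) mixture (F n))%E.
  by apply: is_cvg_ereal_nneg_natsum => *; exact: mixture_ge0.
rewrite /mixture -iint_nneseries //; last by move=> n; exact: mQ.
apply: eq_iint => b; rewrite nneseriesZl; last by move=> *; exact: measure_ge0.
by rewrite measure_semi_bigcup.
Qed.

HB.instance Definition _ := isMeasure.Build _ _ _ mixture mixture0 mixture_ge0
  mixture_sigma_additive.

Let mixture_setT : mixture setT = 1%E.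
Proof.
by rewrite /mixture -w1; apply: eq_iint => b; rewrite probability_setT mule1.
Qed.

HB.instance Definition _ := Measure_isProbability.Build _ _ _ mixture mixture_setT.

Lemma mixture_probability : exists la : probability PS R, forall A,
  la A = iint s (fun b => (w b)%:E * Q b A)%E f.
Proof. by exists mixture. Qed.

End Mixture.
End Kernels.

Section Image.
Variables (d d' : measure_display) (T : measurableType d) (T' : measurableType d') (R : realType).
Variables (P : probability T R) (h : T -> T').
Hypothesis mh : measurable_fun setT h.

Lemma image_probability : exists la : probability T' R, forall A, la A = P (h @^-1` A).
Proof.
pose X : {mfun T >-> T'} := mfun_Sub (mem_set mh : h \in mfun).
by exists (distribution P X).
Qed.

End Image.

Section IterintLemmas.
Variable R : realType.

Lemma measurable_iterint_weight d0 (Y : measurableType d0) n (g : Y -> (nat -> R) -> R) :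
  measurable_fun setT (fun p : Y * FunSp R nat => g p.1 p.2) -> (forall y t, 0 <= g y t) ->
  measurable_fun setT (fun y => iterint n (fun t => (g y t)%:E)).
Proof.
move=> mg g0; under eq_fun do rewrite iterintE.
apply: (@measurable_iint _ _ _ Y (iota 0 n) (fun y t => (g y t)%:E) (fun=> (fun=> 0))).
- exact/measurable_EFinP.
- by move=> y t; rewrite lee_fin.
- exact: measurable_cst.
Qed.

Lemma iterintZl n (c : R) (g : (nat -> R) -> R) : 0 <= c -> (forall t, 0 <= g t) ->
  measurable_fun setT (g : FunSp R nat -> R) ->
  (iterint n (fun t => (c * g t)%:E) = c%:E * iterint n (fun t => (g t)%:E))%E.
Proof.
move=> c0 g0 mg; rewrite !iterintE -iintZl ?lee_fin //; exact/measurable_EFinP.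
Qed.

End IterintLemmas.

(** * The law of the restriction to [J] *)

Section RestrictedLaw.
Variables (R : realType) (V : finType) (W : V -> V -> R) (I J : {set V}) (rho : V).
Hypotheses (Ws : forall i j, W i j = W j i) (W0 : forall i j, 0 <= W i j).
Hypotheses (JI : forall v, (v \in I) = (v \notin J)) (hrho : rho \in J).
Notation JT := {x : V | x \in J}.
Notation d := (exist (fun x => x \in J) rho hrho : JT).
Notation PS := (PathSp R rho).
Notation PSJ := (PathSp R d).
Let sI := enum I.
Let rJ := [seq val u | u <- enum {: JT}].
Let T := sI ++ rJ.
Variable P : probability PS R.
Hypothesis hP : is_vrjp_law W P.
Variable QJ : (V -> R) -> probability PSJ R.
Hypothesis hQJ : forall b, posdef (subM I (Hb W b)) -> is_vrjp_law (@WJ R V W I J b) (QJ b).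

Lemma mem_rJ v : (v \in rJ) = (v \in J).
Proof.
apply/mapP/idP => [[u _ ->]|vJ]; first exact: valP.
by exists (exist (fun x => x \in J) v vJ); rewrite ?mem_enum.
Qed.

Lemma uniq_T : uniq T.
Proof.
rewrite cat_uniq enum_uniq map_inj_uniq ?enum_uniq ?andbT /=; last exact: val_inj.
by apply/hasPn => v; rewrite mem_rJ mem_enum JI negbK.
Qed.

Lemma perm_T : perm_eq T (enum V).
Proof.
apply: uniq_perm; rewrite ?uniq_T ?enum_uniq // => v.
by rewrite mem_cat mem_rJ !mem_enum JI orNb.
Qed.

Lemma path_iterint_ge0 W' b x B n : (forall j k, 0 <= W' j k) ->
  (0 <= iterint n (fun t => (@path_weight R V W' b x B n t)%:E))%E.
Proof.
by move=> W'0; rewrite iterintE; apply: iint_ge0 => t; rewrite lee_fin path_weight_ge0.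
Qed.

Lemma measurable_path_iterint x B n : (forall k, measurable (B k)) ->
  measurable_fun setT (fun b : FunSp R V => iterint n (fun t => (path_weight W b x B n t)%:E)).
Proof.
move=> mB; apply: (@measurable_iterint_weight R _ (FunSp R V) n (fun b => path_weight W b x B n)).
  refine (@measurable_path_weight _ _ _ (FunSp R V * FunSp R nat)%type (fun=> W) fst x B n snd _ _ _ _) => //.
  - by move=> v; exact: (measurableT_comp (measurable_eval v) measurable_fst).
  - by move=> k; exact: (measurableT_comp (measurable_eval k) measurable_snd).
by move=> b t; exact: path_weight_ge0.
Qed.

(** The mixture representation with no vertex eliminated; independence of the elimination order then
    puts [I] in front. *)
Lemma law_cyl n x B f : (forall k, measurable (B k)) ->
  (P (cylset (v0 := rho) n x B) = (x 0%N == rho)%:R%:E *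
   iint T (fun b => (nuS T W b)%:E * iterint n (fun t => (path_weight W b x B n t)%:E)) f)%E.
Proof.
move=> mB; rewrite hP //; congr (_ * _)%E.
have := @iint_mixture R V V id (@inj_id V) W Ws W0 [::] n x B f mB.
rewrite map_id enum_uniq /= => /(_ isT); rewrite mul1e => <-.
rewrite (@iint_perm _ _ (enum V) T) ?enum_uniq //; last 3 first.
- by have := perm_T; rewrite perm_sym.
- apply: emeasurable_funM; last exact: measurable_path_iterint.
  apply/measurable_EFinP; apply: measurable_nuS => [j k|v]; first exact: measurable_cst.
  exact: measurable_eval.
- by move=> b; rewrite mule_ge0 ?path_iterint_ge0 // lee_fin nuS_ge0.
apply: eq_iint => b; congr (_%:E * _)%E.
by rewrite -!nu_densE // perm_T.
Qed.

Lemma measurable_elimS_FunSp : mweights (fun b : FunSp R V => elimS sI b W).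
Proof.
apply: measurable_elimS; first by move=> j k; exact: measurable_cst.
by move=> v; exact: measurable_eval.
Qed.

Lemma measurable_pivS_FunSp : measurable_fun setT (fun b : FunSp R V => (pivS sI b W)%:R : R).
Proof.
rewrite (_ : (fun _ => _) = (fun b : FunSp R V => if pivS sI b W then 1 else 0)); last first.
  by apply/funext => b; case: pivS.
apply: measurable_fun_ifT => //.
apply: measurable_pivS; first by move=> j k; exact: measurable_cst.
by move=> v; exact: measurable_eval.
Qed.

Lemma measurable_nuS_FunSp : measurable_fun setT (fun b : FunSp R V => nuS T W b).
Proof.
apply: measurable_nuS; first by move=> j k; exact: measurable_cst.
by move=> v; exact: measurable_eval.
Qed.

Lemma QJ_cyl b n y B : pivS sI b W -> (forall k, measurable (B k)) ->
  (QJ b (cylset (v0 := d) n y B) = (y 0%N == d)%:R%:E *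
   iterint n (fun t => (\prod_(k < n)
       (\1_(B k) (t k) * dens (fun u u' : JT => elimS sI b W (val u) (val u')) y t k))%:E))%E.
Proof.
move=> ps mB; have pd : posdef (subM I (Hb W b)) by apply/posdef_subMP.
rewrite hQJ //; congr (_ * iterint n _)%E; apply/funext => t; congr _%:E.
suff -> : @WJ R V W I J b = fun u u' : JT => elimS sI b W (val u) (val u') by [].
apply/funext => u; apply/funext => u'; rewrite WJ_elimS // => v vJ.
by rewrite JI vJ.
Qed.

Let eW0 b : pivS sI b W -> forall j k, 0 <= elimS sI b W j k.
Proof. by move=> ps j k; exact: elimS_ge0. Qed.

(** The guard is 0 where [H_II] is not positive definite; there [QJ b] is unspecified and the
    eliminated weights may be negative. *)
Definition guarded_dens n (y : nat -> JT) (B : nat -> set R) (b : V -> R) (t : nat -> R) : R :=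
  (pivS sI b W)%:R * \prod_(k < n)
    (\1_(B k) (t k) * dens (fun u u' : JT => elimS sI b W (val u) (val u')) y t k).

Lemma measurable_guarded_dens n (y : nat -> JT) B : (forall k, measurable (B k)) ->
  measurable_fun setT (fun p : FunSp R V * FunSp R nat => guarded_dens n y B p.1 p.2).
Proof.
move=> mB; apply: measurable_funM.
  exact: (measurableT_comp measurable_pivS_FunSp measurable_fst).
have m2 k : measurable_fun setT (fun p : FunSp R V * FunSp R nat => p.2 k).
  exact: (measurableT_comp (measurable_eval k) measurable_snd).
apply: measurable_prod => k _; apply: measurable_funM.
  exact: (measurableT_comp (measurable_indic (mB k)) (m2 k)).
apply: measurable_dens => // u u'.
exact: (measurableT_comp (measurable_elimS_FunSp (val u) (val u')) measurable_fst).
Qed.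

Lemma guarded_dens_ge0 n y B b t : 0 <= guarded_dens n y B b t.
Proof.
rewrite /guarded_dens; case: (boolP (pivS sI b W)) => ps; last by rewrite mul0r.
by rewrite mul1r prod_dens_ge0 // => u u'; exact: eW0.
Qed.

Lemma measurable_guarded_iterint n (y : nat -> JT) B : (forall k, measurable (B k)) ->
  measurable_fun setT (fun b : FunSp R V => iterint n (fun t => (guarded_dens n y B b t)%:E)).
Proof.
move=> mB; apply: (@measurable_iterint_weight R _ (FunSp R V) n (guarded_dens n y B)).
  exact: measurable_guarded_dens.
by move=> b t; exact: guarded_dens_ge0.
Qed.

Lemma measurable_QJ A : measurable A ->
  measurable_fun setT (fun b : FunSp R V => (pivS sI b W)%:R%:E * QJ b A)%E.
Proof.
apply: (@measurable_kernel _ _ d _ (FunSp R V) (fun b => (pivS sI b W)%:R)) => //.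
  exact: measurable_pivS_FunSp.
move=> n y B mB.
rewrite (_ : (fun _ => _) = (fun b : FunSp R V => (y 0%N == d)%:R%:E * iterint n (fun t =>
   (guarded_dens n y B b t)%:E))%E).
  by apply: emeasurable_funM => //; exact: measurable_guarded_iterint.
apply/funext => b; case: (boolP (pivS sI b W)) => ps.
  rewrite QJ_cyl // mul1e; congr (_ * iterint _ _)%E.
  by apply/funext => t; rewrite /guarded_dens ps mul1r.
rewrite mul0e (_ : (fun t => _) = fun=> 0%E) ?iterintE ?iint0 ?mule0 //.
by apply/funext => t; rewrite /guarded_dens (negbTE ps) mul0r.
Qed.

Let nuS_pivS b : nuS T W b = nuS T W b * (pivS sI b W)%:R.
Proof.
case: (boolP (pivS sI b W)) => ps; first by rewrite mulr1.
by rewrite nuS_piv0 ?mul0r // pivS_cat (negbTE ps).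
Qed.

Lemma measurable_nuS_QJ A : measurable A ->
  measurable_fun setT (fun b : FunSp R V => (nuS T W b)%:E * QJ b A)%E.
Proof.
move=> mA; rewrite (_ : (fun _ => _) =
    (fun b : FunSp R V => (nuS T W b)%:E * ((pivS sI b W)%:R%:E * QJ b A))%E); last first.
  by apply/funext => b; rewrite {1}nuS_pivS EFinM -muleA.
apply: emeasurable_funM; last exact: measurable_QJ.
by apply/measurable_EFinP; exact: measurable_nuS_FunSp.
Qed.

(** Integrating out [beta_J] turns path weights on [J] into vrjp densities; read from right to left,
    this writes the mixture as an integral of path weights on [J]. *)
Lemma mixture_cyl n y B f : (forall k, measurable (B k)) ->
  (iint T (fun b => (nuS T W b)%:E * QJ b (cylset (v0 := d) n y B)) f =
   (y 0%N == d)%:R%:E * iint T (fun b => (nuS T W b)%:E *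
     iterint n (fun t => (path_weight (elimS sI b W) b (val \o y) B n t)%:E)) f)%E.
Proof.
move=> mB.
pose G b := iterint n (fun t => (guarded_dens n y B b t)%:E).
have G0 b : (0 <= G b)%E.
  by rewrite /G iterintE; apply: iint_ge0 => t; rewrite lee_fin guarded_dens_ge0.
have GE b : pivS sI b W -> G b = iterint n (fun t => (\prod_(k < n)
       (\1_(B k) (t k) * dens (fun u u' : JT => elimS sI b W (val u) (val u')) y t k))%:E).
  by move=> ps; congr iterint; apply/funext => t; rewrite /guarded_dens ps mul1r.
transitivity (iint T (fun b => (y 0%N == d)%:R%:E * ((nuS T W b)%:E * G b))%E f).
  apply: eq_iint => b; case: (boolP (pivS sI b W)) => ps; last first.
    by rewrite nuS_pivS (negbTE ps) mulr0 !mul0e mule0.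
  by rewrite QJ_cyl // -GE // muleCA.
rewrite iintZl ?lee_fin //; last 2 first.
- apply: emeasurable_funM; first by apply/measurable_EFinP; exact: measurable_nuS_FunSp.
  exact: measurable_guarded_iterint.
- by move=> b; rewrite mule_ge0 // lee_fin nuS_ge0.
congr (_ * _)%E.
rewrite (iint_mixture val_inj Ws W0 (s := sI) n y f mB uniq_T).
rewrite iint_nuM ?uniq_T //; last first.
  move=> b b' bb'; rewrite /G; congr iterint; apply/funext => t.
  rewrite /guarded_dens; have -> : pivS sI b W = pivS sI b' W by rewrite (eq_on_elim W bb').
  have -> : elimS sI b W = elimS sI b' W by rewrite (eq_on_elim W bb').
  by [].
apply: eq_iint => b; case: (boolP (pivS sI b W)) => ps; first by rewrite GE.
by rewrite nuM_piv0 // !mul0e.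
Qed.

Definition skel_term n (y : nat -> JT) (B : nat -> set R) N (b : V -> R) : \bar R :=
  (\sum_(t : N.-tuple V | matches J N n (nth rho (rho :: t)) (val \o y))
    (nuS T W b)%:E * iterint N (fun u =>
      (path_weight W b (nth rho (rho :: t)) (lift_sets J (nth rho (rho :: t)) B) N u)%:E))%E.

Lemma measurable_skel_summand x B N : (forall k, measurable (B k)) ->
  measurable_fun setT (fun b : FunSp R V => (nuS T W b)%:E * iterint N (fun u =>
      (path_weight W b x B N u)%:E))%E.
Proof.
move=> mB; apply: emeasurable_funM; last exact: measurable_path_iterint.
by apply/measurable_EFinP; exact: measurable_nuS_FunSp.
Qed.

Lemma skel_summand_ge0 x B N b :
  (0 <= (nuS T W b)%:E * iterint N (fun u => (path_weight W b x B N u)%:E))%E.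
Proof. by rewrite mule_ge0 ?path_iterint_ge0 // lee_fin nuS_ge0. Qed.

Lemma skel_term_ge0 n y B N b : (0 <= skel_term n y B N b)%E.
Proof. by apply: sume_ge0 => t _; exact: skel_summand_ge0. Qed.

Lemma measurable_skel_term n y B N : (forall k, measurable (B k)) ->
  measurable_fun setT (skel_term n y B N : FunSp R V -> _).
Proof.
move=> mB; rewrite (_ : skel_term n y B N = (fun b => \sum_(t : N.-tuple V)
    if matches J N n (nth rho (rho :: t)) (val \o y) then
    (nuS T W b)%:E * iterint N (fun u =>
      (path_weight W b (nth rho (rho :: t)) (lift_sets J (nth rho (rho :: t)) B) N u)%:E)
    else 0)%E); last by apply/funext => b; rewrite /skel_term big_mkcond.
apply: emeasurable_sum => t; case: (matches _ _ _ _); last exact: measurable_cst.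
by apply: measurable_skel_summand => k; exact: measurable_lift_sets.
Qed.

(** All lifted paths end at [val (y n)], so the boundary factor is in each of them the local time of
    this one vertex. *)
Lemma skel_term_skel n y B N b : (forall k, measurable (B k)) -> y 0%N = d ->
  skel_term n y B N b =
  ((nuS T W b)%:E * skel J W b (val (y n)) rho N n (val \o y) B 0 rho)%E.
Proof.
move=> mB y0; rewrite /skel ge0_sume_distrr; last by move=> t _; exact: pwr_ge0.
apply: eq_bigr => t mt; congr (_ * _)%E.
have yJ : (val \o y) n \in J by exact: valP.
have [xN _ _] := matchesP yJ mt.
rewrite -iterint_pwr //; last by move=> k; exact: measurable_lift_sets.
by congr iterint; apply/funext => u; rewrite add0r /path_weight xN.
Qed.

(** For fixed [b] this is the comparison of path weights on [J] with sums over lifted paths;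
    integration against [nu] and exchange with the series give the probabilities of the skeleton
    events. *)
Lemma le_mixture_restr n y B f : (forall k, measurable (B k)) ->
  (iint T (fun b => (nuS T W b)%:E * QJ b (cylset (v0 := d) n y B)) f <=
   P ((restrJ d : PS -> PSJ) @^-1` cylset (v0 := d) n y B))%E.
Proof.
move=> mB; rewrite mixture_cyl //; case: eqP => [y0|_]; last by rewrite mul0e measure_ge0.
rewrite mul1e; apply: le_trans (le_skel_events hrho P n y mB).
have -> : (\sum_(N <oo) \sum_(t : N.-tuple V | matches J N n (nth rho (rho :: t)) (val \o y))
     P (cylset (v0 := rho) N (nth rho (rho :: t)) (lift_sets J (nth rho (rho :: t)) B)))%E =
   iint T (fun b => \sum_(N <oo) skel_term n y B N b)%E f.
  rewrite iint_nneseries; last 2 first.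
  - by move=> N; exact: measurable_skel_term.
  - by move=> N b; exact: skel_term_ge0.
  apply: eq_eseriesr => N _; rewrite /skel_term.
  transitivity (iint T (fun b => \sum_(t <- index_enum (N.-tuple V))
    if matches J N n (nth rho (rho :: t)) (val \o y) then
    (nuS T W b)%:E * iterint N (fun u =>
      (path_weight W b (nth rho (rho :: t)) (lift_sets J (nth rho (rho :: t)) B) N u)%:E)
    else 0)%E f); last by apply: eq_iint => b; rewrite [RHS]big_mkcond.
  rewrite iint_sum; last 2 first.
  - move=> t; case: (matches _ _ _ _); last exact: measurable_cst.
    by apply: measurable_skel_summand => k; exact: measurable_lift_sets.
  - by move=> t b; case: ifP => // _; exact: skel_summand_ge0.
  rewrite big_mkcond; apply: eq_bigr => t _; case: ifP => _; last by rewrite iint0.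
  rewrite (law_cyl _ _ f) ?eqxx ?mul1e // => k; exact: measurable_lift_sets.
apply: le_iint.
(* The indicator of positive pivots changes nothing, as [nuS] vanishes elsewhere, and makes the
   integrand nonnegative everywhere. *)
- rewrite (_ : (fun _ => _) = (fun b : FunSp R V => (nuS T W b)%:E *
    iterint n (fun t => ((pivS sI b W)%:R * path_weight (elimS sI b W) b (val \o y) B n t)%:E))%E).
    apply: emeasurable_funM; first by apply/measurable_EFinP; exact: measurable_nuS_FunSp.
    apply: (@measurable_iterint_weight R _ (FunSp R V) n (fun b t =>
      (pivS sI b W)%:R * path_weight (elimS sI b W) b (val \o y) B n t)).
      apply: measurable_funM.
        exact: (measurableT_comp measurable_pivS_FunSp measurable_fst).
      refine (@measurable_path_weight _ _ _ (FunSp R V * FunSp R nat)%type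
        (fun p => elimS sI p.1 W) fst (val \o y) B n snd _ _ _ _) => //.
      + by move=> j k; exact: (measurableT_comp (measurable_elimS_FunSp j k) measurable_fst).
      + by move=> v; exact: (measurableT_comp (measurable_eval v) measurable_fst).
      + by move=> k; exact: (measurableT_comp (measurable_eval k) measurable_snd).
    move=> b t; case: (boolP (pivS sI b W)) => ps; last by rewrite mul0r.
    by rewrite mul1r path_weight_ge0 //; exact: eW0.
  apply/funext => b; case: (boolP (pivS sI b W)) => ps.
    by congr (_ * iterint _ _)%E; apply/funext => t; rewrite mul1r.
  by rewrite nuS_pivS (negbTE ps) mulr0 !mul0e.
- apply: (ge0_emeasurable_sum (h := fun N (b : FunSp R V) => skel_term n y B N b) (P := xpredT)).
    by move=> *; exact: skel_term_ge0.
  by move=> N _; exact: measurable_skel_term.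
- move=> b; case: (boolP (pivS sI b W)) => ps; last by rewrite nuS_pivS (negbTE ps) mulr0 mul0e.
  by rewrite mule_ge0 ?lee_fin ?nuS_ge0 // path_iterint_ge0 //; exact: eW0.
move=> b; case: (boolP (pivS sI b W)) => ps; last first.
  rewrite nuS_pivS (negbTE ps) mulr0 mul0e nneseries_ge0 // => *; exact: skel_term_ge0.
under eq_eseriesr do rewrite skel_term_skel //.
rewrite nneseriesZl; last by move=> *; exact: skel_ge0.
rewrite lee_wpmul2l ?lee_fin ?nuS_ge0 //.
have zJ : val (y n) \in J by exact: valP.
have yJ k : (k <= n)%N -> (val \o y) k \in J by move=> _; exact: valP.
have := le_pwr_skels rho JI zJ Ws W0 ps 0 yJ mB.
rewrite [(val \o y) 0%N]/= y0 /= => h; apply: le_trans h.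
rewrite -iterint_pwr //; last exact: eW0.
rewrite le_eqVlt; apply/orP; left; apply/eqP; congr iterint; apply/funext => t.
by rewrite add0r.
Qed.

Lemma iint_nuS1 f : iint T (fun b => (nuS T W b)%:E) f = 1%E.
Proof.
have := iint_laplace f uniq_T Ws W0 (a := fun=> 1) (fun=> ltr01).
rewrite laplace1 => <-; apply: eq_iint => b.
rewrite big1; last by move=> v _; rewrite expr1n subrr mul0r.
by rewrite oppr0 expR0 mulr1.
Qed.

Theorem restr_mixture f A : measurable A ->
  P ((restrJ d : PS -> PSJ) @^-1` A) = iint T (fun b => (nuS T W b)%:E * QJ b A)%E f.
Proof.
move=> mA.
have [la laE] := mixture_probability (fun b => nuS_ge0 T W b) measurable_nuS_QJ (iint_nuS1 f).
have [mu muE] := image_probability P (@measurable_restrJ R V rho J d).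
rewrite -muE -laE; apply/esym; apply: (cyl_le_eq _ mA) => n y B mB.
by rewrite laE muE; exact: le_mixture_restr.
Qed.

End RestrictedLaw.

(** * Removal of self-loops *)

Section LoopSkeleton.
Variables (R : realType) (U : finType).
Implicit Types (x y : nat -> U) (B : nat -> set R) (t : nat -> R) (n N k l : nat) (a : R).

(* Step [N] is the jump to [y n] after [n] blocks of repeated positions whose durations lie in [B];
   [a] is the time already spent in the first block. *)
Fixpoint merges N n x y B a t : bool :=
  if N is N'.+1 then
    if n is n'.+1 then
      (x 0%N == y 0%N) &&
      if x 1%N == x 0%N then merges N' n (stail x) y B (a + t 0%N) (stail t)
      else ((a + t 0%N) \in B 0%N) && merges N' n' (stail x) (stail y) (stail B) 0 (stail t)
    else false
  else (n == 0%N) && (x 0%N == y 0%N).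

(** The number, counted from 0, of the block of repeated positions that contains the index [l]. *)
Fixpoint jumps x l : nat :=
  if l is l'.+1 then ((x 1%N != x 0%N) + jumps (stail x) l')%N else 0%N.

Lemma jumpsS x l : jumps x l.+1 = (jumps x l + (x l.+1 != x l))%N.
Proof.
elim: l x => [|l IH] x; first by rewrite /= addn0 add0n.
by rewrite [LHS]/= -/(jumps (stail x) l.+1) IH addnA.
Qed.

Lemma jumps_mono x l l' : (l <= l')%N -> (jumps x l <= jumps x l')%N.
Proof.
elim: l' => [|l' IH]; first by rewrite leqn0 => /eqP ->.
rewrite leq_eqVlt => /orP[/eqP -> //|]; rewrite ltnS => /IH h.
by rewrite jumpsS (leq_trans h) // leq_addr.
Qed.

Lemma jumps_onto x k N : (k <= jumps x N)%N ->
  exists l, [/\ (l <= N)%N, jumps x l = k & (0 < l)%N -> x l != x l.-1].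
Proof.
elim: N => [|N IH]; first by rewrite leqn0 => /eqP ->; exists 0%N.
rewrite jumpsS; case: (leqP k (jumps x N)) => [kN _|Nk].
  by have [l [lN jl h]] := IH kN; exists l; split=> //; exact: leqW.
case: (boolP (x N.+1 != x N)) => [xN|_]; last by rewrite addn0 leqNgt Nk.
rewrite addn1 => kN; exists N.+1; split=> //.
by rewrite jumpsS xN addn1; apply/eqP; rewrite eqn_leq Nk kN.
Qed.

Lemma sigmaN_jumps x l :
  (sigmaN x (jumps x l) <= l)%N /\
  forall i, (sigmaN x (jumps x l) <= i <= l)%N -> x i = x (sigmaN x (jumps x l)).
Proof.
elim: l => [|l [sl xs]]; first by split=> // i /andP[_]; rewrite leqn0 => /eqP ->.
rewrite jumpsS; case: (boolP (x l.+1 != x l)) => xl; last first.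
  rewrite addn0; split; first exact: leqW.
  move=> i /andP[si]; rewrite leq_eqVlt => /orP[/eqP ->|il]; last by apply: xs; rewrite si.
  by move: xl; rewrite negbK => /eqP ->; apply: xs; rewrite sl leqnn.
have tl : sigmaN x (jumps x l + 1) = l.+1.
  rewrite addn1 /=; apply: hit_next_eq; first exact: sl.
    by rewrite -(xs l) ?sl ?leqnn.
  by move=> i /andP[si il]; rewrite negbK (xs i) // (ltnW si).
by rewrite tl; split=> // i /andP[li il]; have -> : i = l.+1 by apply/eqP; rewrite eqn_leq il.
Qed.

Lemma sigmaN_jump x l : ((0 < l)%N -> x l != x l.-1) -> sigmaN x (jumps x l) = l.
Proof.
case: l => // l /(_ isT) xl; rewrite jumpsS xl addn1 /=.
have [sl xs] := sigmaN_jumps x l.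
apply: hit_next_eq => //; first by rewrite -(xs l) ?sl ?leqnn.
by move=> i /andP[si il]; rewrite negbK (xs i) // (ltnW si).
Qed.

(** If [N > 0], the index [N] opens a new block, so the [n] blocks before it are complete and the
    first [N] holding times decide their durations; the credit [a] goes to block 0. *)
Lemma mergesP N n x y B a t : merges N n x y B a t ->
  [/\ forall l, (l <= N)%N -> x l = y (jumps x l), jumps x N = n, (0 < N)%N -> x N != x N.-1 &
      forall k, (k < n)%N ->
        B k ((if k == 0%N then a else 0) + \sum_(l < N | jumps x l == k) t l)].
Proof.
elim: N n x y B a t => [|N IH] n x y B a t /=.
  move=> /andP[/eqP -> /eqP xy]; split=> // l; by rewrite leqn0 => /eqP ->.
case: n => // n /andP[/eqP xy]; case: (eqVneq (x 1%N) (x 0%N)) => [x1|x1] /=.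
  move=> /IH [xl jN xN Bs]; rewrite /stail in xl jN xN Bs; split.
  - by move=> [|l] lN /=; rewrite ?x1 ?eqxx //; exact: xl.
  - exact: jN.
  - by move=> _; case: N xN jN {IH xl Bs} => [|N] xN jN //=; exact: xN.
  move=> k kn; rewrite big_mkcond big_ord_recl /= -big_mkcond /=.
  have := Bs k kn; rewrite /bump /= x1 eqxx /=; case: k kn => [|k] kn /=.
    by rewrite addrA.
  by rewrite !add0r.
move=> /andP[/set_mem a0 /IH [xl jN xN Bs]]; rewrite /stail in xl jN xN Bs; split.
- by move=> [|l] lN //=; rewrite x1 /=; exact: xl.
- by rewrite add1n -[in RHS]jN.
- by move=> _; case: N xN jN {IH xl Bs} => [|N] xN jN //=; exact: xN.
move=> k kn; rewrite big_mkcond big_ord_recl /= -big_mkcond /= /bump /= x1.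
case: k kn => [|k] kn /=.
  by rewrite big1 ?addr0 // => l; rewrite add1n.
by rewrite !add0r; have := Bs k kn; case: ifP => _; rewrite add0r.
Qed.

Lemma eq_merges N n x x' y B a t : (forall k, (k <= N)%N -> x k = x' k) ->
  merges N n x y B a t = merges N n x' y B a t.
Proof.
elim: N n x x' y B a t => [|N IH] n x x' y B a t e /=; first by rewrite e.
case: n => // n; rewrite !e //.
by congr andb; case: ifP => _; rewrite !(IH _ (stail x) (stail x')) // => k kN; exact: e.
Qed.

Lemma eq_merges_times N n x y B a t t' : (forall k, (k < N)%N -> t k = t' k) ->
  merges N n x y B a t = merges N n x y B a t'.
Proof.
elim: N n x y B a t t' => [|N IH] n x y B a t t' e //=.
case: n => // n; rewrite e //.
by congr andb; case: ifP => _; rewrite !(IH _ (stail x) _ _ _ (stail t) (stail t')) // => k kN; exact: e.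
Qed.

Lemma sigmaN_incr x k : (sigmaN x k < sigmaN x k.+1)%N.
Proof.
rewrite [sigmaN x k.+1]/=; set p := (fun _ => _); set l := sigmaN x k.
have [[/andP[h _] _]|[-> _]] // := (hit_nextP p l (Defs.next p l)).1 erefl.
Qed.

Lemma sigmaN_mono x k k' : (k <= k')%N -> (sigmaN x k <= sigmaN x k')%N.
Proof.
elim: k' => [|k' IH]; first by rewrite leqn0 => /eqP ->.
rewrite leq_eqVlt => /orP[/eqP -> //|]; rewrite ltnS => /IH h.
exact: leq_trans h (ltnW (sigmaN_incr x k')).
Qed.

Lemma merges_rmloops N n x y B t : merges N n x y B 0 t ->
  [/\ sigmaN x n = N, forall k, (k <= n)%N -> x (sigmaN x k) = y k &
   forall k, (k < n)%N -> B k (\sum_(sigmaN x k <= l < sigmaN x k.+1) t l)].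
Proof.
move=> /mergesP [xl jN xN Bs].
have sN : sigmaN x n = N by rewrite -jN sigmaN_jump.
have js k : (k <= n)%N -> jumps x (sigmaN x k) = k.
  rewrite -{1}jN => /jumps_onto [l [lN jl xl']].
  by rewrite -{1}jl (sigmaN_jump xl').
split=> // [k kn|k kn]; first by rewrite xl ?js // -sN; exact: sigmaN_mono.
have := Bs k kn; rewrite (_ : (if _ then 0 else 0) = 0) ?add0r; last by case: ifP.
congr (B k _); rewrite -(big_mkord (fun l => jumps x l == k)).
have kN : (sigmaN x k.+1 <= N)%N by rewrite -sN; exact: sigmaN_mono.
rewrite [RHS](big_nat_widen _ _ N) // [RHS](big_nat_widenl _ 0) //.
apply: congr_big_nat => // l /andP[_ lN].
apply/idP/idP => [/eqP jl|/andP[/= lk kl]].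
  have [sl _] := sigmaN_jumps x l; rewrite jl in sl; rewrite sl andbT ltnNge.
  by apply/negP => /(jumps_mono x); rewrite js // jl ltnn.
have kj : (k <= jumps x l)%N by rewrite -(js k (ltnW kn)); exact: jumps_mono.
rewrite eqn_leq kj andbT leqNgt; apply/negP => kj'.
have [sl _] := sigmaN_jumps x l.
by move: (leq_ltn_trans (leq_trans (sigmaN_mono x kj') sl) lk); rewrite ltnn.
Qed.

End LoopSkeleton.

(** * The vrjp law on general events of holding times *)

Section TimeSets.
Variables (R : realType) (U : finType) (u0 : U) (W : U -> U -> R).
Notation PS := (PathSp R u0).
Hypothesis W0 : forall i j, 0 <= W i j.
Variable Q : probability PS R.
Hypothesis hQ : is_vrjp_law W Q.
Variables (N : nat) (x : nat -> U).

(** Times from [N] on are set to 0, which is also their value inside [iterint N]; events that depend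
    on the first [N] times do not notice it. *)
Let trunc (t : nat -> R) : nat -> R := fun k => if (k < N)%N then t k else 0.
Let D1 (D : set (FunSp R nat)) : set PS :=
  [set w | (forall k, (k <= N)%N -> w.1 k = x k) /\ D (trunc w.2)].
Let p (t : nat -> R) : R := \prod_(k < N) dens W x t k.
Let c : R := (x 0%N == u0)%:R.

Let p0 t : 0 <= p t.
Proof.
have := @prod_dens_ge0 _ _ W x (fun=> setT) N t W0.
by under eq_bigr do rewrite indicT mul1r.
Qed.

Let mp : measurable_fun setT (p : FunSp R nat -> R).
Proof.
apply: measurable_prod => k _.
refine (@measurable_dens _ _ _ (FunSp R nat) (fun=> W) x id k _ _) => //.
by move=> m; exact: measurable_eval.
Qed.

Let mtrunc : measurable_fun setT (trunc : FunSp R nat -> FunSp R nat).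
Proof.
apply: (@measurable_toFunSp R nat _ (FunSp R nat)) => k; rewrite /trunc.
by case: (k < N)%N; [exact: measurable_eval|exact: measurable_cst].
Qed.

Let mD1 D : measurable D -> measurable (D1 D).
Proof.
move=> mD; rewrite (_ : D1 D = cylset (v0 := u0) N x (fun=> setT) `&`
    ((fun w : PS => (w.2 : FunSp R nat)) @^-1` (trunc @^-1` D))); last first.
  by apply/seteqP; split=> w /=; [move=> [? ?]|move=> [[? _] ?]].
apply: measurableI; first exact: measurable_cylset.
rewrite -[X in measurable X]setTI.
have m2 : measurable_fun setT (fun w : PS => (w.2 : FunSp R nat)).
  by apply: (@measurable_toFunSp R nat _ PS) => k; exact: measurable_holding.
apply: m2 => //; rewrite -[X in measurable X]setTI; exact: mtrunc.
Qed.

Let D2 (D : set (FunSp R nat)) : \bar R :=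
  iint (iota 0 N) (fun t => (p t)%:E * \d_(trunc t : FunSp R nat) D)%E (fun=> 0).

Let md D : measurable D -> measurable_fun setT
  (fun t : FunSp R nat => (p t)%:E * \d_(trunc t : FunSp R nat) D)%E.
Proof.
move=> mD; apply: emeasurable_funM; first exact/measurable_EFinP.
rewrite (_ : (fun _ => _) = EFin \o ((\1_D : FunSp R nat -> R) \o trunc)); last first.
  by apply/funext => t; rewrite /= indicE diracE.
by apply/measurable_EFinP; exact: measurableT_comp.
Qed.

Let d0 D t : (0 <= (p t)%:E * \d_(trunc t : FunSp R nat) D)%E.
Proof. by rewrite mule_ge0 ?lee_fin. Qed.

Let lawT : Q (D1 setT) = (c%:E * D2 setT)%E.
Proof.
rewrite (_ : D1 setT = cylset (v0 := u0) N x (fun=> setT)).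
  rewrite hQ // /D2 iterintE; congr (_ * _)%E; apply: eq_iint => t.
  rewrite diracT mule1; congr _%:E; apply: eq_bigr => k _.
  by rewrite indicT mul1r.
by apply/seteqP; split=> w /=; [move=> [? ?]; split|move=> [? _]].
Qed.

Let lawD D : measurable D -> Q (D1 D) = (c%:E * D2 D)%E.
Proof.
apply: (@dynkin_induction _ (FunSp R nat) (@coord_sets R nat) (fun D => Q (D1 D) = (c%:E * D2 D)%E)) => //.
- exact: coord_sets_setI.
- move=> _ [s [B [mB ->]]].
  (* A rectangle constraining a coordinate beyond [N] either admits the truncated value 0 there or
     contains no truncated sequence. *)
  have [h|h] := pselect (forall k, k \in s -> (N <= k)%N -> B k 0); last first.
    rewrite (_ : D1 _ = set0); last first.
      apply/seteqP; split=> w //= [_ wB]; apply: h => k ks Nk.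
      by have := wB k ks; rewrite /trunc ltnNge Nk.
    rewrite measure0 /D2 (_ : (fun _ => _) = fun=> 0%E) ?iint0 ?mule0 //.
    apply/funext => t; rewrite diracE memNset ?mule0 // => tB; apply: h => k ks Nk.
    by have := tB k ks; rewrite /trunc ltnNge Nk.
  rewrite (_ : D1 _ = cylset (v0 := u0) N x (fun k => if k \in s then B k else setT)).
    rewrite hQ; last by move=> k; case: ifP.
    congr (_ * _)%E; rewrite iterintE; apply: eq_iint => t.
    rewrite diracE -EFinM big_split /= mulrC; congr (_ * _)%:E.
    have [tB|tB] := pselect (forall k, k \in s -> B k (trunc t k)).
      rewrite mem_set // big1 // => k _; case: ifPn => ks; last by rewrite indicT.
      by rewrite indicE mem_set //; have := tB _ ks; rewrite /trunc ltn_ord.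
    rewrite memNset //.
    have [k kN kB] : exists2 k, (k < N)%N & (k \in s) /\ ~ B k (t k).
      apply: contra_notP tB => nB k ks; rewrite /trunc; case: ltnP => kN; last exact: h.
      by apply: contrapT => nBk; apply: nB; exists k.
    rewrite (bigD1 (Ordinal kN)) //= kB.1 indicE memNset ?mul0r //; exact: kB.2.
  apply/seteqP; split=> w /= [wx wB]; split=> // k.
    by move=> kN; case: ifPn => // ks; have := wB k ks; rewrite /trunc kN.
  move=> ks; rewrite /trunc; case: ltnP => kN; last exact: h.
  by have := wB k kN; rewrite ks.
- move=> S mS lS.
  have mSC := measurableC mS.
  have eQ : (Q (D1 S) + Q (D1 (~` S)) = Q (D1 setT))%E.
    rewrite -measureU //; [|exact: mD1|exact: mD1|].
      congr (Q _); apply/seteqP; split=> w /=; first by move=> [[]|[]].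
      by move=> [wx _]; have [?|?] := pselect (S (trunc w.2)); [left|right].
    by apply/seteqP; split=> w //= [[_ a] [_ b]].
  have e2 : (c%:E * D2 S + c%:E * D2 (~` S) = c%:E * D2 setT)%E.
    rewrite -ge0_muleDr ?iint_ge0 //; congr (_ * _)%E.
    rewrite /D2 -iintD //; [|exact: md|exact: md].
    apply: eq_iint => t; rewrite -ge0_muleDr //; congr (_ * _)%E.
    by rewrite -measureU ?setUv // setICr.
  have : (Q (D1 S) + Q (D1 (~` S)) = Q (D1 S) + c%:E * D2 (~` S))%E by rewrite eQ lawT -e2 lS.
  move/(congr1 (fun z => z - Q (D1 S)))%E.
  by rewrite ![(Q (D1 S) + _)%E]addeC !addeK // fin_num_measure //; exact: mD1.
- move=> F mF tF lF.
  rewrite (_ : D1 (\bigcup_k F k) = \bigcup_k D1 (F k)); last first.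
    apply/seteqP; split=> w /=; first by move=> [wx [k _ Fk]]; exists k.
    by move=> [k _ [wx Fk]]; split=> //; exists k.
  rewrite measure_semi_bigcup; last 3 first.
  - by move=> k; exact: mD1.
  - by move=> i j _ _ [w [[_ Fi] [_ Fj]]]; apply: (tF i j) => //; exists (trunc w.2).
  - by apply: bigcupT_measurable => k; exact: mD1.
  rewrite (eq_eseriesr (fun k _ => lF k)) nneseriesZl; last by move=> *; exact: iint_ge0.
  congr (_ * _)%E; rewrite /D2 -iint_nneseries //; last by move=> k; exact: md.
  apply: eq_iint => t; rewrite nneseriesZl //; congr (_ * _)%E.
  by rewrite measure_semi_bigcup //; exact: bigcupT_measurable.
Qed.

(** Loop removal constrains sums of holding times, so its events are not cylinders; the density
    formula is extended to them from rectangles by Dynkin's argument. *)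
Lemma law_times (D : set (FunSp R nat)) : measurable D ->
  (forall t t', (forall k, (k < N)%N -> t k = t' k) -> D t -> D t') ->
  Q [set w | (forall k, (k <= N)%N -> w.1 k = x k) /\ D w.2] =
  ((x 0%N == u0)%:R%:E * iterint N (fun t => (\1_D (t : FunSp R nat) * \prod_(k < N) dens W x t k)%:E))%E.
Proof.
move=> mD hD; have tD t : D (trunc t) <-> D t.
  by split; apply: hD => k kN; rewrite /trunc kN.
rewrite (_ : [set w | _] = D1 D); last first.
  by apply/seteqP; split=> w /= [wx /tD wD].
rewrite lawD // /D2 iterintE; congr (_ * _)%E; apply: eq_iint => t.
rewrite diracE indicE -EFinM mulrC; congr (_ * _)%:E; congr (_%:R); congr nat_of_bool.
by apply/idP/idP => /set_mem /tD ?; exact: mem_set.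
Qed.

End TimeSets.

(** * Sums over the paths with a given loop-free skeleton *)

Section LoopSums.
Variables (R : realType) (U : finType) (u0 : U).
Notation mu := (@lebesgue_measure R).
Implicit Types (W : U -> U -> R) (l : U -> R) (x y : nat -> U) (B : nat -> set R) (t : nat -> R)
  (n N : nat) (a s : R) (i j v u : U).

Definition addl l i s : U -> R := fun v => l v + (i == v)%:R * s.

(** The product of the step densities computed from the first step on, carrying the local times
    forward, where [dens] recomputes them from the whole path. *)
Fixpoint pdens N W l x t : R :=
  if N is N'.+1 then
    stepd W l (x 0%N) (x 1%N) (t 0%N) * pdens N' W (addl l (x 0%N) (t 0%N)) (stail x) (stail t)
  else 1.

Lemma loc_recl x t k v : loc x t k.+1 v = (x 0%N == v)%:R * t 0%N + loc (stail x) (stail t) k v.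
Proof.
rewrite /loc big_mkcond big_ord_recl /= [in RHS]big_mkcond; congr (_ + _).
by case: (x 0%N == v); rewrite ?mul1r ?mul0r.
Qed.

Lemma prod_stepd N W l x t :
  \prod_(k < N) stepd W (fun v => l v + loc x t k v) (x k) (x k.+1) (t k) = pdens N W l x t.
Proof.
elim: N l x t => [|N IH] l x t; first by rewrite big_ord0.
rewrite big_ord_recl /= -IH; congr (_ * _).
  by congr (stepd W _ _ _ _); apply/funext => v; rewrite /loc big_ord0 addr0.
apply: eq_bigr => k _; rewrite /stail; congr (stepd W _ _ _ _).
by apply/funext => v; rewrite loc_recl addrA.
Qed.

Lemma prod_dens_pdens N W x t : \prod_(k < N) dens W x t k = pdens N W (fun=> 0) x t.
Proof.
rewrite -prod_stepd; apply: eq_bigr => k _.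
rewrite (_ : (fun v => 0 + loc x t k v) = loc x t k) //.
by apply/funext => v; rewrite add0r.
Qed.

Lemma pdens_ge0 N W l x t : (forall i j, 0 <= W i j) -> 0 <= pdens N W l x t.
Proof. by move=> W0; elim: N l x t => //= N IH l x t; rewrite mulr_ge0 ?stepd_ge0. Qed.

Lemma measurable_pdens d (X : measurableType d) N W (l : X -> U -> R) x (t : X -> nat -> R) :
  (forall v, measurable_fun setT (fun w => l w v)) ->
  (forall k, measurable_fun setT (fun w => t w k)) ->
  measurable_fun setT (fun w => pdens N W (l w) x (t w)).
Proof.
elim: N l x t => [|N IH] l x t ml mt /=; first exact: measurable_cst.
apply: measurable_funM; first exact: (@measurable_stepd _ _ _ X (fun=> W)).
apply: (IH (fun w => addl (l w) (x 0%N) (t w 0%N)) (stail x) (fun w => stail (t w))) => [v|k]; last exact: mt.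
by apply: measurable_funD => //; exact: measurable_funM.
Qed.

Lemma measurable_merges d (X : measurableType d) N n x y B (a : X -> R) (t : X -> nat -> R) :
  (forall k, measurable (B k)) -> measurable_fun setT a ->
  (forall k, measurable_fun setT (fun w => t w k)) ->
  measurable_fun setT (fun w => (merges N n x y B (a w) (t w))%:R : R).
Proof.
elim: N n x y B a t => [|N IH] n x y B a t mB ma mt /=; first exact: measurable_cst.
case: n => [|n]; first exact: measurable_cst.
case: (x 0%N == y 0%N) => /=; last exact: measurable_cst.
have mat : measurable_fun setT (fun w => a w + t w 0%N) by exact: measurable_funD.
case: (x 1%N == x 0%N).
  by apply: (IH n.+1 _ _ _ (fun w => a w + t w 0%N) (fun w => stail (t w))) => // k; exact: mt.
rewrite (_ : (fun _ => _) = fun w => \1_(B 0%N) (a w + t w 0%N) *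
    (merges N n (stail x) (stail y) (stail B) 0 (stail (t w)))%:R : R); last first.
  by apply/funext => w; rewrite indicE -natrM mulnb.
apply: measurable_funM; first exact: (measurableT_comp (measurable_indic (mB 0%N)) mat).
by apply: (IH n _ _ _ (fun=> 0) (fun w => stail (t w))) => // k; [exact: mB|exact: mt].
Qed.

Variable W : U -> U -> R.
Hypothesis W0 : forall i j, 0 <= W i j.

Definition merge_int N n y B a l x : \bar R :=
  iterint N (fun t => ((merges N n x y B a t)%:R * pdens N W l x t)%:E).

Definition merge_sum N n y B a l v : \bar R :=
  (\sum_(t : N.-tuple U) merge_int N n y B a l (nth u0 (v :: t)))%E.

Lemma merge_int_ge0 N n y B a l x : (0 <= merge_int N n y B a l x)%E.
Proof.
by rewrite /merge_int iterintE; apply: iint_ge0 => t; rewrite lee_fin mulr_ge0 ?ler0n ?pdens_ge0.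
Qed.

Lemma merge_sum_ge0 N n y B a l v : (0 <= merge_sum N n y B a l v)%E.
Proof. by apply: sume_ge0 => t _; exact: merge_int_ge0. Qed.

Lemma measurable_merge_int d (X : measurableType d) N n x y B (a : X -> R) (l : X -> U -> R) :
  (forall k, measurable (B k)) -> measurable_fun setT a ->
  (forall v, measurable_fun setT (fun w => l w v)) ->
  measurable_fun setT (fun w => merge_int N n y B (a w) (l w) x).
Proof.
move=> mB ma ml.
apply: (@measurable_iterint_weight R _ X N (fun w t => (merges N n x y B (a w) t)%:R * pdens N W (l w) x t)).
  have m2 k : measurable_fun setT (fun p : X * FunSp R nat => p.2 k).
    exact: (measurableT_comp (measurable_eval k) measurable_snd).
  apply: measurable_funM.
    apply: (@measurable_merges _ (X * FunSp R nat)%type N n x y B (fun p => a p.1) snd) => //.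
    exact: (measurableT_comp ma measurable_fst).
  apply: (@measurable_pdens _ (X * FunSp R nat)%type N W (fun p => l p.1) x snd) => //.
  by move=> v; exact: (measurableT_comp (ml v) measurable_fst).
by move=> w t; rewrite mulr_ge0 ?ler0n ?pdens_ge0.
Qed.

Lemma measurable_merge_sum d (X : measurableType d) N n y B (a : X -> R) (l : X -> U -> R) v :
  (forall k, measurable (B k)) -> measurable_fun setT a ->
  (forall v, measurable_fun setT (fun w => l w v)) ->
  measurable_fun setT (fun w => merge_sum N n y B (a w) (l w) v).
Proof. by move=> mB ma ml; apply: emeasurable_sum => t; exact: measurable_merge_int. Qed.

Lemma merge_int_recl N n y B a l x : (forall k, measurable (B k)) -> x 0%N = y 0%N ->
  merge_int N.+1 n.+1 y B a l x =
  (\int[mu]_s ((stepd W l (x 0%N) (x 1%N) s)%:E *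
    if x 1%N == x 0%N then merge_int N n.+1 y B (a + s) (addl l (x 0%N) s) (stail x)
    else (\1_(B 0%N) (a + s))%:E * merge_int N n (stail y) (stail B) 0 (addl l (x 0%N) s) (stail x)))%E.
Proof.
move=> mB xy; apply: eq_integral => s _.
have mB' k : measurable (stail B k) by exact: mB.
have mint M m y' B' a' l' x' : (forall k, measurable (B' k)) -> measurable_fun setT
    (fun t : FunSp R nat => (merges M m x' y' B' a' t)%:R * pdens M W l' x' t).
  move=> mB''; apply: measurable_funM.
    by apply: (@measurable_merges _ (FunSp R nat) M m x' y' B' (fun=> a') id) => // k; exact: measurable_eval.
  by apply: (@measurable_pdens _ (FunSp R nat) M W (fun=> l') x' id) => // k; exact: measurable_eval.
rewrite /= xy eqxx -xy /=; case: ifPn => x1.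
  rewrite /merge_int -iterintZl ?stepd_ge0 //; last 2 first.
  - by move=> t; rewrite mulr_ge0 ?ler0n ?pdens_ge0.
  - exact: mint.
  by congr iterint; apply/funext => t; rewrite mulrCA.
rewrite muleA -EFinM /merge_int -iterintZl; last 3 first.
- by rewrite mulr_ge0 ?stepd_ge0 // indicE ler0n.
- by move=> t; rewrite mulr_ge0 ?ler0n ?pdens_ge0.
- exact: mint.
congr iterint; apply/funext => t; rewrite indicE -mulnb natrM; congr _%:E.
rewrite /stail /=; ring.
Qed.

(** First-step analysis in which only two continuations are kept: a loop at [y 0], which prolongs
    the current block, and the jump to [y 1], which closes it and tests its duration. *)
Lemma le_merge_sum_recl N n y B a l : (forall k, measurable (B k)) -> y 1%N != y 0%N ->
  (\int[mu]_s ((stepd W l (y 0%N) (y 0%N) s)%:E * merge_sum N n.+1 y B (a + s) (addl l (y 0%N) s) (y 0%N)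
     + (stepd W l (y 0%N) (y 1%N) s * \1_(B 0%N) (a + s))%:E *
       merge_sum N n (stail y) (stail B) 0 (addl l (y 0%N) s) (y 1%N)) <=
   merge_sum N.+1 n.+1 y B a l (y 0%N))%E.
Proof.
move=> mB y10; have mB' k : measurable (stail B k) by exact: mB.
have madd v : measurable_fun setT (fun s : R => addl l (y 0%N) s v).
  by apply: measurable_funD => //; exact: measurable_funM.
have mas : measurable_fun setT (fun s : R => a + s) by exact: measurable_funD.
have mst j : measurable_fun setT (fun s : R => stepd W l (y 0%N) j s).
  by apply: (@measurable_stepd _ _ _ R (fun=> W) (fun=> l)).
have mi : measurable_fun setT (fun s : R => \1_(B 0%N) (a + s) : R).
  exact: (measurableT_comp (measurable_indic (mB 0%N)) mas).
pose F u (t : seq U) s := ((stepd W l (y 0%N) u s)%:E *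
    if u == y 0%N then merge_int N n.+1 y B (a + s) (addl l (y 0%N) s) (nth u0 (u :: t))
    else (\1_(B 0%N) (a + s))%:E * merge_int N n (stail y) (stail B) 0 (addl l (y 0%N) s) (nth u0 (u :: t)))%E.
have F0 u (t : seq U) s : (0 <= F u t s)%E.
  rewrite /F mule_ge0 ?lee_fin ?stepd_ge0 //; case: ifP => _; first exact: merge_int_ge0.
  by rewrite mule_ge0 ?merge_int_ge0 // lee_fin indicE ler0n.
have mF u (t : seq U) : measurable_fun setT (F u t).
  apply: emeasurable_funM; first exact/measurable_EFinP.
  case: (u == y 0%N); first exact: (@measurable_merge_int _ R).
  apply: emeasurable_funM; first exact/measurable_EFinP.
  exact: (@measurable_merge_int _ R _ _ _ _ _ (fun=> 0)).
rewrite /merge_sum.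
rewrite (sum_cons_tuple N xpredT (fun t : seq U => merge_int N.+1 n.+1 y B a l (nth u0 (y 0%N :: t)))).
have -> : (\sum_u \sum_(t : N.-tuple U) merge_int N.+1 n.+1 y B a l (nth u0 (y 0%N :: u :: t)) =
   \int[mu]_s \sum_u \sum_(t : N.-tuple U) F u t s)%E.
  rewrite ge0_integral_sum //; last 2 first.
  - by move=> u; apply: emeasurable_sum => t; exact: mF.
  - by move=> u s _; apply: sume_ge0 => t _; exact: F0.
  apply: eq_bigr => u _; rewrite ge0_integral_sum //; last by move=> t; exact: mF.
  by apply: eq_bigr => t _; rewrite merge_int_recl.
apply: ge0_le_integral => //.
- move=> s _; rewrite adde_ge0 // mule_ge0 ?merge_sum_ge0 // lee_fin ?stepd_ge0 //.
  by rewrite mulr_ge0 ?stepd_ge0 // indicE ler0n.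
- apply: emeasurable_funD; apply: emeasurable_funM.
  + by apply/measurable_EFinP; exact: mst.
  + exact: (@measurable_merge_sum _ R).
  + by apply/measurable_EFinP; apply: measurable_funM; [exact: mst|exact: mi].
  + exact: (@measurable_merge_sum _ R _ _ _ _ (fun=> 0)).
- by apply: emeasurable_sum => u; apply: emeasurable_sum => t; exact: mF.
move=> s _; rewrite (bigD1 (y 0%N)) //= (bigD1 (y 1%N)) //= addeA.
apply: le_trans (leeDl _ _); last by apply: sume_ge0 => u _; apply: sume_ge0 => t _; exact: F0.
rewrite /F eqxx (negbTE y10); apply: leeD.
  by rewrite /merge_sum ge0_sume_distrr // => t _; exact: merge_int_ge0.
rewrite /merge_sum ge0_sume_distrr; last by move=> t _; exact: merge_int_ge0.
by apply: lee_sum => t _; rewrite EFinM muleA.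
Qed.

Definition merge_sums n y B a l v : \bar R := (\sum_(N <oo) merge_sum N n y B a l v)%E.

Lemma merge_sums_ge0 n y B a l v : (0 <= merge_sums n y B a l v)%E.
Proof. by apply: nneseries_ge0 => *; exact: merge_sum_ge0. Qed.

Lemma measurable_merge_sums d (X : measurableType d) n y B (a : X -> R) (l : X -> U -> R) v :
  (forall k, measurable (B k)) -> measurable_fun setT a ->
  (forall v, measurable_fun setT (fun w => l w v)) ->
  measurable_fun setT (fun w => merge_sums n y B (a w) (l w) v).
Proof.
move=> mB ma ml.
apply: (ge0_emeasurable_sum (h := fun N w => merge_sum N n y B (a w) (l w) v) (P := xpredT)).
  by move=> *; exact: merge_sum_ge0.
by move=> N _; exact: measurable_merge_sum.
Qed.

Lemma le_merge_sums_recl n y B a l : (forall k, measurable (B k)) -> y 1%N != y 0%N ->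
  (\int[mu]_s ((stepd W l (y 0%N) (y 0%N) s)%:E * merge_sums n.+1 y B (a + s) (addl l (y 0%N) s) (y 0%N)
     + (stepd W l (y 0%N) (y 1%N) s * \1_(B 0%N) (a + s))%:E *
       merge_sums n (stail y) (stail B) 0 (addl l (y 0%N) s) (y 1%N)) <=
   merge_sums n.+1 y B a l (y 0%N))%E.
Proof.
move=> mB y10; have mB' k : measurable (stail B k) by exact: mB.
have madd v : measurable_fun setT (fun s : R => addl l (y 0%N) s v).
  by apply: measurable_funD => //; exact: measurable_funM.
have mas : measurable_fun setT (fun s : R => a + s) by exact: measurable_funD.
have mst j : measurable_fun setT (fun s : R => stepd W l (y 0%N) j s).
  by apply: (@measurable_stepd _ _ _ R (fun=> W) (fun=> l)).
have mi : measurable_fun setT (fun s : R => \1_(B 0%N) (a + s) : R).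
  exact: (measurableT_comp (measurable_indic (mB 0%N)) mas).
have si0 s : 0 <= stepd W l (y 0%N) (y 1%N) s * \1_(B 0%N) (a + s).
  by rewrite mulr_ge0 ?stepd_ge0 // indicE ler0n.
rewrite [leRHS]/merge_sums nneseries_recl //; last by move=> *; exact: merge_sum_ge0.
apply: le_trans (leeDr _ (merge_sum_ge0 _ _ _ _ _ _ _)).
rewrite -(nneseries_addn 1); last by move=> *; exact: merge_sum_ge0.
under eq_eseriesr do rewrite addn1.
apply: (@le_trans _ _ (\sum_(N <oo) \int[mu]_s
   ((stepd W l (y 0%N) (y 0%N) s)%:E * merge_sum N n.+1 y B (a + s) (addl l (y 0%N) s) (y 0%N)
     + (stepd W l (y 0%N) (y 1%N) s * \1_(B 0%N) (a + s))%:E *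
       merge_sum N n (stail y) (stail B) 0 (addl l (y 0%N) s) (y 1%N)))%E); last first.
  apply: lee_nneseries => [N _ _|N _]; last exact: le_merge_sum_recl.
  apply: integral_ge0 => s _.
  by rewrite adde_ge0 // mule_ge0 ?merge_sum_ge0 // lee_fin ?stepd_ge0.
rewrite -integral_nneseries //; last 2 first.
- move=> N; apply: emeasurable_funD; apply: emeasurable_funM.
  + by apply/measurable_EFinP; exact: mst.
  + exact: (@measurable_merge_sum _ R).
  + by apply/measurable_EFinP; apply: measurable_funM; [exact: mst|exact: mi].
  + exact: (@measurable_merge_sum _ R _ _ _ _ (fun=> 0)).
- move=> N s _; by rewrite adde_ge0 // mule_ge0 ?merge_sum_ge0 // lee_fin ?stepd_ge0.
rewrite le_eqVlt; apply/orP; left; apply/eqP; apply: eq_integral => s _.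
rewrite nneseriesD; last 2 first.
- by move=> N _ _; rewrite mule_ge0 ?merge_sum_ge0 // lee_fin stepd_ge0.
- by move=> N _ _; rewrite mule_ge0 ?merge_sum_ge0 // lee_fin.
by congr (_ + _)%E; rewrite nneseriesZl // => *; exact: merge_sum_ge0.
Qed.

Definition loopless i j : R := if i == j then 0 else W i j.

Let sw i := W i i / 2.
(** The probability that neither a jump nor a loop occurs during time [a] at [i], started from local
    times [l]; [jmp] is the rate of the jump to [j] after that time, and [sw] the rate of the loop
    clock. *)
Let surv l i a : R :=
  expR (- (\sum_(v | v != i) W i v * Num.sqrt (1 + l v) *
                 (Num.sqrt (1 + l i + a) - Num.sqrt (1 + l i)) + W i i * a / 2)).
Let jmp l i j a : R := W i j / 2 * Num.sqrt (1 + l j) / Num.sqrt (1 + l i + a).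

Let addl_self l i a : addl l i a i = l i + a.
Proof. by rewrite /addl eqxx mul1r. Qed.

Let addl_other l i a v : v != i -> addl l i a v = l v.
Proof. by rewrite /addl eq_sym => /negbTE ->; rewrite mul0r addr0. Qed.

Let wsum l i : R := \sum_(v | v != i) W i v * Num.sqrt (1 + l v).

Let survE l i a : surv l i a =
  expR (- (wsum l i * (Num.sqrt (1 + l i + a) - Num.sqrt (1 + l i)) + W i i * a / 2)).
Proof. by rewrite /surv -mulr_suml. Qed.

Let wsum_addl l i a : wsum (addl l i a) i = wsum l i.
Proof. by apply: eq_bigr => v vi; rewrite addl_other. Qed.

(** The survival exponent is an integral of rates over the elapsed time, hence additive. *)
Let surv_addl l i a s : surv l i a * surv (addl l i a) i s = surv l i (a + s).
Proof.
rewrite !survE -expRD wsum_addl addl_self !addrA; congr expR; ring.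
Qed.

Let surv_stepd_loop l i a s : 0 < s ->
  surv l i a * stepd W (addl l i a) i i s = sw i * surv l i (a + s).
Proof. by move=> s0; rewrite -surv_addl /stepd s0 eqxx mulrCA. Qed.

Let surv_stepd_jump l i j a s : j != i -> 0 < s ->
  surv l i a * stepd W (addl l i a) i j s = surv l i (a + s) * jmp l i j (a + s).
Proof.
move=> ji s0; rewrite -surv_addl /stepd s0 ji -/(surv (addl l i a) i s) addl_self addl_other //.
by rewrite /jmp !addrA; ring.
Qed.

(** Switching off the loop clock removes its part of the survival probability, which is the factor
    [exp (sw i * s)]. *)
Let stepd_loopless l i j s : j != i -> 0 < s ->
  stepd loopless l i j s = expR (sw i * s) * (surv l i s * jmp l i j s).
Proof.
move=> ji s0; rewrite /stepd s0 ji /surv /jmp /loopless eqxx (eq_sym i j) (negbTE ji).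
rewrite mul0r mul0r addr0.
rewrite (eq_bigr (fun v => W i v * Num.sqrt (1 + l v) *
   (Num.sqrt (1 + l i + s) - Num.sqrt (1 + l i)))); last first.
  by move=> v; rewrite eq_sym => /negbTE ->.
rewrite [in RHS]mulrA -expRD [RHS]mulrC; congr (_ * expR _).
by rewrite /sw; set S := \sum_(v | _) _; ring.
Qed.

Lemma addlA l i a s : addl (addl l i a) i s = addl l i (a + s).
Proof. by apply/funext => v; rewrite /addl mulrDr addrA. Qed.

Lemma addl0 l i : addl l i 0 = l.
Proof. by apply/funext => v; rewrite /addl mulr0 addr0. Qed.

(* The times of [m] loops before a jump at time [t] contribute [(w t)^m / m!]; the sum over [m] cancels
   the factor [exp (- w t)] of the loop clock. *)
Lemma le_merge_sums_loopless n y B l : (forall k, measurable (B k)) -> y 1%N != y 0%N ->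
  (\int[mu]_s ((\1_(B 0%N) s * stepd loopless l (y 0%N) (y 1%N) s)%:E *
       merge_sums n (stail y) (stail B) 0 (addl l (y 0%N) s) (y 1%N)) <=
   merge_sums n.+1 y B 0 l (y 0%N))%E.
Proof.
move=> mB y10; have mB' k : measurable (stail B k) by exact: mB.
have madd v : measurable_fun setT (fun s : R => addl l (y 0%N) s v).
  by apply: measurable_funD => //; exact: measurable_funM.
set i := y 0%N in y10 madd *; set j := y 1%N in y10 *.
(* After multiplication by the survival up to the elapsed time [a], the first-step inequality
   becomes a renewal inequality with the constant loop rate [sw i]. *)
pose c a := ((surv l i a)%:E * merge_sums n.+1 y B a (addl l i a) i)%E.
pose k a := ((surv l i a * jmp l i j a * \1_(B 0%N) a)%:E *
  merge_sums n (stail y) (stail B) 0 (addl l i a) j)%E.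
have msq (b : R) : measurable_fun setT (fun a : R => Num.sqrt (b + a)).
  by apply: (measurableT_comp (@measurable_sqrtr R)); exact: measurable_funD.
have msurv : measurable_fun setT (surv l i).
  rewrite (_ : surv l i = fun a => expR (- (wsum l i *
      (Num.sqrt (1 + l i + a) - Num.sqrt (1 + l i)) + W i i * a / 2))); last first.
    by apply/funext => a; exact: survE.
  apply: (measurableT_comp (@measurable_expR R)); apply: measurable_funN; apply: measurable_funD.
    by apply: measurable_funM => //; exact: measurable_funB.
  by apply: measurable_funM => //; exact: measurable_funM.
have mjmp : measurable_fun setT (jmp l i j) by apply: measurable_div.
have jmp0 a : 0 <= jmp l i j a by rewrite divr_ge0 ?sqrtr_ge0 // mulr_ge0 ?sqrtr_ge0 // divr_ge0.
have mc : measurable_fun setT c.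
  apply: emeasurable_funM; first exact/measurable_EFinP.
  exact: (@measurable_merge_sums _ R _ _ _ id).
have mk : measurable_fun setT k.
  apply: emeasurable_funM; last exact: (@measurable_merge_sums _ R _ _ _ (fun=> 0)).
  apply/measurable_EFinP; apply: measurable_funM; first exact: measurable_funM.
  exact: measurable_indic.
have c0 a : (0 <= c a)%E by rewrite mule_ge0 ?merge_sums_ge0 // lee_fin expR_ge0.
have k0 a : (0 <= k a)%E.
  by rewrite mule_ge0 ?merge_sums_ge0 // lee_fin !mulr_ge0 ?expR_ge0 // indicE ler0n.
have sw0 : 0 <= sw i by rewrite divr_ge0.
have rec a : (\int[mu]_t (if (0 < t)%R then (sw i)%:E * c (a + t)%R + k (a + t)%R else 0) <= c a)%E.
  apply: le_trans (lee_wpmul2l _ (@le_merge_sums_recl n y B a (addl l i a) mB y10)); last first.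
    by rewrite lee_fin expR_ge0.
  have ma2 v : measurable_fun setT (fun s : R => addl (addl l i a) i s v).
    by apply: measurable_funD => //; exact: measurable_funM.
  have mst j' : measurable_fun setT (fun s : R => stepd W (addl l i a) i j' s).
    by apply: (@measurable_stepd _ _ _ R (fun=> W) (fun=> addl l i a)).
  have mas : measurable_fun setT (fun s : R => a + s) by exact: measurable_funD.
  have mi : measurable_fun setT (fun s : R => \1_(B 0%N) (a + s) : R).
    exact: (measurableT_comp (measurable_indic (mB 0%N)) mas).
  rewrite -/i -/j -ge0_integralZl //; last 3 first.
  - apply: emeasurable_funD; apply: emeasurable_funM.
    + by apply/measurable_EFinP; exact: mst.
    + exact: (@measurable_merge_sums _ R).
    + by apply/measurable_EFinP; apply: measurable_funM; [exact: mst|exact: mi].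
    + exact: (@measurable_merge_sums _ R _ _ _ (fun=> 0)).
  - move=> s _; rewrite adde_ge0 // mule_ge0 ?merge_sums_ge0 // lee_fin ?stepd_ge0 //.
    by rewrite mulr_ge0 ?stepd_ge0 // indicE ler0n.
  - by rewrite lee_fin expR_ge0.
  rewrite le_eqVlt; apply/orP; left; apply/eqP; apply: eq_integral => s _.
  case: ifPn => s0; last by rewrite /stepd (negbTE s0) mul0r !mul0e adde0 mule0.
  rewrite ge0_muleDr; last 2 first.
  - by rewrite mule_ge0 ?merge_sums_ge0 // lee_fin stepd_ge0.
  - by rewrite mule_ge0 ?merge_sums_ge0 // lee_fin mulr_ge0 ?stepd_ge0 // indicE ler0n.
  rewrite !muleA -!EFinM surv_stepd_loop // [in RHS]mulrA surv_stepd_jump // addlA.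
  by [].
have := le_loop_resummation sw0 mc mk c0 k0 rec 0; rewrite /c addl0.
have -> : surv l i 0 = 1.
  by rewrite /surv addr0 subrr big1 ?mulr0 ?mul0r ?addr0 ?oppr0 ?expR0 // => v _; rewrite mulr0.
rewrite mul1e; apply: le_trans; rewrite le_eqVlt; apply/orP; left; apply/eqP.
apply: eq_integral => s _; case: ifPn => s0; last by rewrite /stepd (negbTE s0) mulr0 mul0e.
rewrite stepd_loopless // add0r /k muleA -EFinM; congr (_%:E * _)%E.
by rewrite mulrC !mulrA.
Qed.

(** One holding time of the process without loops is expanded into a block at a time, with the local
    times at the end of the block as the new start. *)
Lemma le_loopless_merge_sums n y B l : (forall k, measurable (B k)) ->
  (forall k, (k < n)%N -> y k.+1 != y k) ->
  (iterint n (fun t => (\prod_(k < n) \1_(B k) (t k) * pdens n loopless l y t)%:E) <=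
   merge_sums n y B 0 l (y 0%N))%E.
Proof.
have lW0 i j : 0 <= loopless i j by rewrite /loopless; case: ifP.
elim: n y B l => [|n IH] y B l mB ny.
  rewrite /merge_sums nneseries_recl //; last by move=> *; exact: merge_sum_ge0.
  apply: le_trans (leeDl _ _); last by apply: nneseries_ge0 => *; exact: merge_sum_ge0.
  rewrite /merge_sum (big_pred1 [tuple]); last by move=> t; rewrite (tuple0 t); exact/esym/eqP.
  by rewrite /merge_int /= eqxx big_ord0.
have mB' k : measurable (stail B k) by exact: mB.
apply: le_trans (le_merge_sums_loopless n l mB (ny 0%N isT)).
have mg n' (B' : nat -> set R) d (X : measurableType d) (l' : X -> U -> R) x' (t : X -> nat -> R) :
    (forall k, measurable (B' k)) -> (forall v, measurable_fun setT (fun w => l' w v)) ->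
    (forall k, measurable_fun setT (fun w => t w k)) ->
    measurable_fun setT (fun w => \prod_(k < n') \1_(B' k) (t w k) * pdens n' loopless (l' w) x' (t w)).
  move=> mB'' ml mt; apply: measurable_funM; last exact: measurable_pdens.
  by apply: measurable_prod => k _; exact: (measurableT_comp (measurable_indic (mB'' k)) (mt k)).
have g0 n' (B' : nat -> set R) l' x' t : 0 <= \prod_(k < n') \1_(B' k) (t k) * pdens n' loopless l' x' t.
  by rewrite mulr_ge0 ?pdens_ge0 // prodr_ge0 // => k _; rewrite indicE ler0n.
have madd v : measurable_fun setT (fun s : R => addl l (y 0%N) s v).
  by apply: measurable_funD => //; exact: measurable_funM.
have mst : measurable_fun setT (fun s : R => stepd loopless l (y 0%N) (y 1%N) s).
  by apply: (@measurable_stepd _ _ _ R (fun=> loopless) (fun=> l)).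
have e : iterint n.+1 (fun t => (\prod_(k < n.+1) \1_(B k) (t k) * pdens n.+1 loopless l y t)%:E) =
   (\int[mu]_s ((\1_(B 0%N) s * stepd loopless l (y 0%N) (y 1%N) s)%:E *
     iterint n (fun t => (\prod_(k < n) \1_(stail B k) (t k) *
       pdens n loopless (addl l (y 0%N) s) (stail y) t)%:E)))%E.
  apply: eq_integral => s _; rewrite -iterintZl; last 3 first.
  - by rewrite mulr_ge0 ?stepd_ge0 // indicE ler0n.
  - by move=> t; exact: g0.
  - by apply: (mg n (stail B) _ (FunSp R nat) (fun=> addl l (y 0%N) s) (stail y) id) => // k; exact: measurable_eval.
  congr iterint; apply/funext => t; congr _%:E; rewrite big_ord_recl /=.
  by rewrite /stail /=; ring.
rewrite e; apply: ge0_le_integral => //.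
- move=> s _; rewrite mule_ge0 // ?lee_fin ?mulr_ge0 ?stepd_ge0 ?indicE ?ler0n //.
  by rewrite iterintE; apply: iint_ge0 => t; rewrite lee_fin g0.
- apply: emeasurable_funM.
    by apply/measurable_EFinP; apply: measurable_funM; [exact: (measurable_indic (mB 0%N))|exact: mst].
  apply: (@measurable_iterint_weight R _ R n (fun s t => \prod_(k < n) \1_(stail B k) (t k) *
       pdens n loopless (addl l (y 0%N) s) (stail y) t)) => //.
  apply: (mg n (stail B) _ (R * FunSp R nat)%type (fun p => addl l (y 0%N) p.1) (stail y) snd) => //.
    by move=> v; exact: (measurableT_comp (madd v) measurable_fst).
  by move=> k; exact: (measurableT_comp (measurable_eval k) measurable_snd).
- apply: emeasurable_funM.
    by apply/measurable_EFinP; apply: measurable_funM; [exact: (measurable_indic (mB 0%N))|exact: mst].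
  exact: (@measurable_merge_sums _ R _ _ _ (fun=> 0)).
move=> s _; rewrite lee_wpmul2l ?lee_fin ?mulr_ge0 ?stepd_ge0 ?indicE ?ler0n //.
by apply: (IH (stail y)) => // k kn; exact: ny.
Qed.

End LoopSums.

(** * The law after removal of loops *)

Section LoopRemoval.
Variables (R : realType) (U : finType) (u0 : U) (W : U -> U -> R).
Notation PS := (PathSp R u0).
Hypothesis W0 : forall i j, 0 <= W i j.
Variables Q Q' : probability PS R.
Hypothesis hQ : is_vrjp_law W Q.
Hypothesis hQ' : is_vrjp_law (loopless W) Q'.
Implicit Types (y : nat -> U) (B : nat -> set R) (n N : nat).

Definition merge_event N n y B : set PS :=
  [set w | w.1 0%N = u0 /\ merges N n w.1 y B 0 w.2].

Lemma merge_event_prefix N n y B (t : N.+1.-tuple U) : merge_event N n y B `&` prefix_set t =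
  if nth u0 t 0 == u0 then
    [set w : PS | (forall k, (k <= N)%N -> w.1 k = nth u0 t k) /\ merges N n (nth u0 t) y B 0 w.2]
  else set0.
Proof.
case: ifPn => [/eqP t0|t0]; apply/seteqP; split=> w //=.
- by move=> [[_ wm] wt]; split=> //; rewrite -(@eq_merges _ _ N n w.1).
- by move=> [wt wm]; split=> //; split; [rewrite wt|rewrite (@eq_merges _ _ N n w.1 (nth u0 t))].
- by move=> [[w0 _] wt]; move: t0; rewrite -wt // w0 eqxx.
Qed.

Lemma measurable_merges_set (N n : nat) x y B : (forall k, measurable (B k)) ->
  measurable [set t : FunSp R nat | merges N n x y B 0 t].
Proof.
move=> mB.
have mf : measurable_fun setT (fun t : FunSp R nat => (merges N n x y B 0 t)%:R : R).
  by apply: (@measurable_merges R U _ (FunSp R nat) N n x y B (fun=> 0) id) => // k; exact: measurable_eval.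
rewrite (_ : [set t | _] = (fun t : FunSp R nat => (merges N n x y B 0 t)%:R : R) @^-1` [set 1]).
  by rewrite -[X in measurable X]setTI; exact: mf.
apply/seteqP; split=> t /=; first by move=> ->.
by case: merges => // /esym/eqP; rewrite oner_eq0.
Qed.

Lemma measurable_prefix_merges N n x y B : (forall k, measurable (B k)) ->
  measurable [set w : PS | (forall k, (k <= N)%N -> w.1 k = x k) /\ merges N n x y B 0 w.2].
Proof.
move=> mB; rewrite (_ : [set w | _] = cylset (v0 := u0) N x (fun=> setT) `&`
    ((fun w : PS => (w.2 : FunSp R nat)) @^-1` [set t : FunSp R nat | merges N n x y B 0 t])).
  apply: measurableI; first exact: measurable_cylset.
  rewrite -[X in measurable X]setTI.
  have m2 : measurable_fun setT (fun w : PS => (w.2 : FunSp R nat)).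
    by apply: (@measurable_toFunSp R nat _ PS) => k; exact: measurable_holding.
  by apply: m2 => //; exact: measurable_merges_set.
by apply/seteqP; split=> w /=; [move=> [? ?]|move=> [[? _] ?]].
Qed.

Lemma measurable_merge_event N n y B : (forall k, measurable (B k)) -> measurable (merge_event N n y B).
Proof.
move=> mB; rewrite (_ : merge_event N n y B =
  \bigcup_(t in [set: N.+1.-tuple U]) (merge_event N n y B `&` prefix_set t)).
  apply: fin_bigcup_measurable => [|t _]; first exact: finite_finset.
  by rewrite merge_event_prefix; case: ifP => // _; exact: measurable_prefix_merges.
apply/seteqP; split=> w /=; last by move=> [t _ []].
by move=> Ew; have [t wt] := prefix_cover N w; exists t.
Qed.

Lemma merge_event_law N n y B : (forall k, measurable (B k)) ->
  Q (merge_event N n y B) = merge_sum u0 W N n y B 0 (fun=> 0) u0.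
Proof.
move=> mB; rewrite (@measure_prefix_partition _ _ _ Q N); last exact: measurable_merge_event.
transitivity (\sum_(t : N.+1.-tuple U | xpredT t)
    if nth u0 t 0 == u0 then merge_int W N n y B 0%R (fun=> 0%R) (nth u0 t) else 0)%E.
  apply: eq_bigr => t _; rewrite merge_event_prefix; case: ifPn => [t0|_]; last by rewrite measure0.
  have mD := measurable_merges_set N n (nth u0 t) y mB.
  have hD t1 t2 : (forall k, (k < N)%N -> t1 k = t2 k) ->
      merges N n (nth u0 t) y B 0 t1 -> merges N n (nth u0 t) y B 0 t2.
    by move=> e; rewrite (eq_merges_times _ _ _ _ _ e).
  have /= -> := law_times W0 hQ (nth u0 t) mD hD; rewrite t0 mul1e /merge_int; congr iterint; apply/funext => t'.
  rewrite prod_dens_pdens indicE; congr (_%:R * _)%:E; congr nat_of_bool.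
  by apply/idP/idP => [/set_mem|h] //; exact: mem_set.
rewrite (sum_cons_tuple N xpredT (fun t : seq U =>
    if nth u0 t 0 == u0 then merge_int W N n y B 0%R (fun=> 0%R) (nth u0 t) else 0%E)).
rewrite (bigD1 u0) //= [X in (_ + X)%E]big1 ?adde0; last first.
  by move=> v /negbTE vr; rewrite big1 // => t _; rewrite vr.
by apply: eq_bigr => t _; rewrite eqxx.
Qed.

Lemma merge_event_sub N n y B : merge_event N n y B `<=`
  (@rmloops R U u0 : PS -> PS) @^-1` cylset (v0 := u0) n y B.
Proof. by move=> w [_ wm]; have [_ h1 h2] := merges_rmloops wm; split. Qed.

Lemma le_loopless_rmloops n y B : (forall k, measurable (B k)) ->
  (Q' (cylset (v0 := u0) n y B) <= Q ((@rmloops R U u0 : PS -> PS) @^-1` cylset (v0 := u0) n y B))%E.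
Proof.
move=> mB; rewrite hQ' //; case: (eqVneq (y 0%N) u0) => [y0|_]; last by rewrite mul0e measure_ge0.
rewrite mul1e.
(* A repeated position has density 0 for weights without diagonal, so only skeletons with distinct
   consecutive vertices remain. *)
have [ny|nny] := pselect (forall k, (k < n)%N -> y k.+1 != y k); last first.
  have [k kn yk] : exists2 k, (k < n)%N & y k.+1 = y k.
    apply: contra_notP nny => h k kn; apply/eqP => yk; apply: h; by exists k.
  rewrite (_ : (fun t => _) = fun=> 0%E) ?iterintE ?iint0 ?measure_ge0 //.
  apply/funext => t; rewrite (bigD1 (Ordinal kn)) //= {1}/dens yk /loopless !eqxx /=.
  by case: ifP => _; rewrite ?mul0r ?mulr0 mul0r.
apply: (@le_trans _ _ (\sum_(N <oo) Q (merge_event N n y B))%E).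
  apply: (@le_trans _ _ (merge_sums u0 W n y B 0%R (fun=> 0%R) (y 0%N))).
    apply: le_trans (le_loopless_merge_sums u0 W0 (fun=> 0) mB ny).
    rewrite le_eqVlt; apply/orP; left; apply/eqP; congr iterint; apply/funext => t.
    by rewrite big_split /= prod_dens_pdens.
  rewrite y0 /merge_sums le_eqVlt; apply/orP; left; apply/eqP; apply: eq_eseriesr => N _.
  by rewrite merge_event_law.
have mE : measurable (\bigcup_N merge_event N n y B).
  by apply: bigcupT_measurable => N; exact: measurable_merge_event.
rewrite -measure_semi_bigcup //; last 2 first.
- by move=> N; exact: measurable_merge_event.
- move=> N N' _ _ [w [[_ wm] [_ wm']]].
  by have [<- _ _] := merges_rmloops wm; have [<- _ _] := merges_rmloops wm'.
apply: le_measure; rewrite ?inE //.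
- rewrite -[X in measurable X]setTI; apply: measurable_rmloops => //.
  exact: measurable_cylset.
- by move=> w [N _ /merge_event_sub].
Qed.

Theorem rmloops_law A : measurable A -> Q' A = Q ((@rmloops R U u0 : PS -> PS) @^-1` A).
Proof.
move=> mA; have [la laE] := image_probability Q (@measurable_rmloops R U u0).
rewrite -laE; apply: (cyl_le_eq _ mA) => n y B mB.
by rewrite laE; exact: le_loopless_rmloops.
Qed.

End LoopRemoval.

(** * Lumping the complement of [I] *)

Section Lumping.
Variables (R : realType) (V : finType) (W : V -> V -> R) (I J : {set V}) (rho : V).
Hypotheses (Ws : forall i j, W i j = W j i) (W0 : forall i j, 0 <= W i j).
Hypotheses (JI : forall v, (v \in I) = (v \notin J)) (hrho : rho \in J).
Notation JT := {x : V | x \in J}.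
Notation UT := {x : V | x \in rho |: I}.
Notation d := (exist (fun x => x \in J) rho hrho : JT).
Notation PSJ := (PathSp R d).
Let sI := enum I.
Let rJ := [seq val u | u <- enum {: JT}].
Let T := sI ++ rJ.
(** Both [T] and [sR] begin with [I], so both densities split off a factor [nuM] over [I], and these
    factors can be compared. *)
Let sR := sI ++ [:: rho].
Variable QJ : (V -> R) -> probability PSJ R.
Hypothesis hQJ : forall b, posdef (subM I (Hb W b)) -> is_vrjp_law (@WJ R V W I J b) (QJ b).
(** The formula of [What] on all of [V], so that both eliminations take place over the same vertex
    type; only entries on [rho |: I] enter. *)
Let WR : V -> V -> R := fun i j =>
  if i == rho then (if j == rho then 0 else \sum_(k in J) W j k)
  else if j == rho then \sum_(k in J) W i k else W i j.

Let rhoI : rho \notin I. Proof. by rewrite JI negbK. Qed.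

Let WR_sym i j : WR i j = WR j i.
Proof. by rewrite /WR; case: eqP => _; case: eqP => // _. Qed.

Let WR_ge0 i j : 0 <= WR i j.
Proof. by rewrite /WR; do 2?case: ifP => _ //; rewrite sumr_ge0. Qed.

Let WR_in : {in sI & sI, WR =2 W}.
Proof.
move=> i j; rewrite !mem_enum => iI jI; rewrite /WR.
have -> : (i == rho) = false by apply/eqP => e; move: rhoI; rewrite -e iI.
by have -> : (j == rho) = false by apply/eqP => e; move: rhoI; rewrite -e jI.
Qed.

Let uniq_sR : uniq sR.
Proof. by rewrite cat_uniq enum_uniq /= orbF mem_enum rhoI. Qed.

Let mem_sR v : (v \in sR) = (v \in rho |: I).
Proof. by rewrite mem_cat mem_enum !inE orbC. Qed.

Let sU : seq UT := pmap insub sR.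

Let map_sU : map val sU = sR.
Proof.
rewrite pmap_filter; last exact: insubK.
by apply/all_filterP/allP => v; rewrite mem_sR => vR; rewrite /= insubT.
Qed.

Let perm_sU : perm_eq sU (enum {: UT}).
Proof.
apply: uniq_perm; rewrite ?enum_uniq // -?(map_inj_uniq val_inj) ?map_sU // => u.
by rewrite mem_enum -(mem_map val_inj) map_sU mem_sR (valP u).
Qed.

Lemma nu_dens_What (b : V -> R) : nu_dens (@What R V W I J rho) (b \o val) = nuS sR WR b.
Proof.
rewrite (nu_densE _ perm_sU); last by move=> u u'; exact: (WR_sym (val u) (val u')).
by rewrite (@nuS_map R V _ val sU WR _ b) ?map_sU.
Qed.

Lemma extb_in (b : V -> R) v : v \in rho |: I -> extb (b \o val : UT -> R) v = b v.
Proof. by move=> vR; rewrite /extb insubT. Qed.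

Lemma extb_val (b : UT -> R) : (extb b) \o val = b.
Proof. by apply/funext => u; rewrite /= /extb valK. Qed.

Let nuS_pivS b : nuS T W b = nuS T W b * (pivS sI b W)%:R.
Proof.
case: (boolP (pivS sI b W)) => ps; first by rewrite mulr1.
by rewrite nuS_piv0 ?mul0r // pivS_cat (negbTE ps).
Qed.

Let nuR_pivS b : nuS sR WR b = nuS sR WR b * (pivS sI b W)%:R.
Proof.
rewrite -(eq_on_pivS b WR_in); case: (boolP (pivS sI b WR)) => ps; first by rewrite mulr1.
by rewrite nuS_piv0 ?mul0r // pivS_cat (negbTE ps).
Qed.

Lemma nu_dens_pivS b : nu_dens W b = nu_dens W b * (pivS sI b W)%:R.
Proof. by rewrite (nu_densE _ (perm_T JI)) // -nuS_pivS. Qed.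

Lemma nu_dens_What_pivS (b : UT -> R) : nu_dens (@What R V W I J rho) b =
  nu_dens (@What R V W I J rho) b * (pivS sI (extb b) W)%:R.
Proof. by rewrite -{1 2}(extb_val b) nu_dens_What -nuR_pivS. Qed.

(** The Schur complement depends on [b] only through [I], and the cylinder probabilities determine
    the law. *)
Lemma QJ_local b b' A : {in sI, b =1 b'} -> pivS sI b W -> measurable A -> QJ b A = QJ b' A.
Proof.
move=> bb' ps mA; have [eE eP] := eq_on_elim W bb'.
have ps' : pivS sI b' W by rewrite -eP.
apply: (cyl_unique _ mA) => n y B mB.
rewrite (QJ_cyl Ws W0 JI hQJ n y ps mB) (QJ_cyl Ws W0 JI hQJ n y ps' mB).
by congr (_ * iterint n _)%E; apply/funext => t; rewrite -/sI eE.
Qed.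

Let f0 : V -> R := fun=> 0.
(** A genuine function of the restriction of [b] to [I], also where [QJ b] is unspecified. *)
Let cutQ A b : \bar R := ((pivS sI b W)%:R%:E * QJ b A)%E.

Let cutQ_ge0 A b : (0 <= cutQ A b)%E.
Proof. by rewrite mule_ge0 ?lee_fin. Qed.

Let cutQ_local A b b' : measurable A -> {in sI, b =1 b'} -> cutQ A b = cutQ A b'.
Proof.
move=> mA bb'; have [_ eP] := eq_on_elim W bb'; rewrite /cutQ -eP.
by case: (boolP (pivS sI b W)) => ps; rewrite ?mul0e // (QJ_local bb').
Qed.

Lemma intR_W A : measurable A ->
  intR (fun b : V -> R => (nu_dens W b)%:E * QJ b A)%E =
  iint T (fun b => (nuS T W b)%:E * QJ b A)%E f0.
Proof.
move=> mA; rewrite (@intRE R V V id _ f0) // map_id.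
transitivity (iint (enum V) (fun b => (nuS T W b)%:E * QJ b A)%E f0).
  by apply: eq_iint => b; rewrite (nu_densE _ (perm_T JI)).
rewrite (@iint_perm _ _ (enum V) T) ?enum_uniq //.
- by have := perm_T JI; rewrite perm_sym.
- exact: measurable_nuS_QJ.
- by move=> b; rewrite mule_ge0 // lee_fin nuS_ge0.
Qed.

(** Both integrals reduce to integrals over [I] against [nuM], and the two factors agree because the
    single vertex [rho] carries the row sums over [J]. *)
Lemma intR_What A : measurable A ->
  intR (fun b => (nu_dens (@What R V W I J rho) b)%:E * QJ (extb b) A)%E =
  iint T (fun b => (nuS T W b)%:E * QJ b A)%E f0.
Proof.
move=> mA; rewrite (@intRE R _ V val _ f0); last exact: val_inj.
transitivity (iint [seq val u | u <- enum {: UT}] (fun b => (nuS sR WR b)%:E * cutQ A b)%E f0).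
  apply: eq_iint => b; rewrite nu_dens_What {1}nuR_pivS EFinM -muleA; congr (_ * _)%E.
  rewrite (@cutQ_local A b (extb (b \o val : UT -> R))) //; last first.
    by move=> v; rewrite mem_enum => vI; rewrite extb_in // inE vI orbT.
  rewrite /cutQ; congr ((_%:R)%:E * _)%E.
  have bE : {in sI, b =1 extb (b \o val : UT -> R)}.
    by move=> v; rewrite mem_enum => vI; rewrite extb_in // inE vI orbT.
  by have [_ ->] := eq_on_elim W bE.
rewrite (@iint_perm _ _ _ sR); last 4 first.
- by rewrite (map_inj_uniq val_inj) enum_uniq.
- by rewrite -map_sU perm_map // perm_sym.
- apply: emeasurable_funM; last exact: (measurable_QJ Ws W0 JI hQJ).
  apply/measurable_EFinP; apply: measurable_nuS => [j k|v]; first exact: measurable_cst.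
  exact: measurable_eval.
- by move=> b; rewrite mule_ge0 // lee_fin nuS_ge0.
rewrite iint_nuM //; last by move=> b b'; exact: cutQ_local.
transitivity (iint T (fun b => (nuS T W b)%:E * cutQ A b)%E f0); last first.
  by apply: eq_iint => b; rewrite [in RHS]nuS_pivS EFinM -muleA.
rewrite iint_nuM ?(uniq_T JI) //; last by move=> b b'; exact: cutQ_local.
apply: eq_iint => b; congr (_%:E * _)%E; apply: nuM_lump; first exact: enum_uniq.
  exact: WR_in.
move=> i; rewrite mem_enum => iI; rewrite big_seq1 /WR eqxx.
have -> : (i == rho) = false by apply/eqP => e; move: rhoI; rewrite -e iI.
rewrite /rJ big_map big_enum /=.
rewrite (reindex_omap (val : JT -> V) insub) /=; last by move=> k kJ; rewrite insubT.
by apply: eq_bigl => k; rewrite valK eqxx andbT (valP k).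
Qed.

End Lumping.

Theorem theorem1p2 (R : realType) (V : finType) (W : V -> V -> R)
  (Wsym : forall i j, W i j = W j i)
  (Wnn : forall i j, 0 <= W i j)
  (Wloop : forall i, W i i = 0)
  (Wconn : forall i j, connect [rel a b | 0 < W a b] i j)
  (I J : {set V}) (hIJ : I :&: J = finset.set0) (hcov : I :|: J = finset.setT)
  (hJ : (1 < #|J|)%N) (rho : V) (hrho : rho \in J)
  (P : probability (PathSp R rho) R) (hP : @is_vrjp_law R V W rho P)
  (QJ Qneq : (V -> R) ->
     probability (PathSp R (exist (fun x => x \in J) rho hrho)) R)
  (hQJ : forall beta : V -> R, posdef (subM I (Hb W beta)) ->
     @is_vrjp_law R _ (@WJ R V W I J beta) (exist (fun x => x \in J) rho hrho) (QJ beta))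
  (hQneq : forall beta : V -> R, posdef (subM I (Hb W beta)) ->
     @is_vrjp_law R _ (@WJneq R V W I J beta) (exist (fun x => x \in J) rho hrho)
       (Qneq beta)) :
  forall A : set (PathSp R (exist (fun x => x \in J) rho hrho)),
    measurable A ->
    (P ((fun w : PathT R rho =>
            rmloops (restrJ (exist (fun x => x \in J) rho hrho) w)) @^-1` A)
      = intR (fun b => ((nu_dens (@What R V W I J rho) b)%:E
                        * Qneq (@extb R V I rho b) A)%E)
     /\ intR (fun b => ((nu_dens (@What R V W I J rho) b)%:E
                        * Qneq (@extb R V I rho b) A)%E)
      = intR (fun beta : V -> R => ((nu_dens W beta)%:E * Qneq beta A)%E))
    /\
    (P ((fun w : PathT R rho =>
            restrJ (exist (fun x => x \in J) rho hrho) w) @^-1` A)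
      = intR (fun b => ((nu_dens (@What R V W I J rho) b)%:E
                        * QJ (@extb R V I rho b) A)%E)
     /\ intR (fun b => ((nu_dens (@What R V W I J rho) b)%:E
                        * QJ (@extb R V I rho b) A)%E)
      = intR (fun beta : V -> R => ((nu_dens W beta)%:E * QJ beta A)%E)).
Proof.
have JI v : (v \in I) = (v \notin J).
  move/setP/(_ v): hIJ; move/setP/(_ v): hcov; rewrite !inE.
  by case: (v \in I); case: (v \in J).
have key (A : set (PathSp R (exist (fun x => x \in J) rho hrho))) : measurable A ->
    P ((fun w : PathT R rho => restrJ (exist (fun x => x \in J) rho hrho) w) @^-1` A)
      = intR (fun b => ((nu_dens (@What R V W I J rho) b)%:E * QJ (@extb R V I rho b) A)%E)
    /\ intR (fun b => ((nu_dens (@What R V W I J rho) b)%:E * QJ (@extb R V I rho b) A)%E)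
      = intR (fun beta : V -> R => ((nu_dens W beta)%:E * QJ beta A)%E).
  move=> mA; rewrite (intR_What Wsym Wnn JI hQJ mA) (intR_W Wsym Wnn JI hQJ mA); split=> //.
  exact: (restr_mixture Wsym Wnn JI hP hQJ).
move=> A mA; split; last exact: key.
have mA' : measurable ((@rmloops R _ (exist (fun x => x \in J) rho hrho)) @^-1` A : set (PathSp R _)).
  by rewrite -[X in measurable X]setTI; exact: measurable_rmloops.
(* For fixed weights, loop removal maps the law for [W^J] to the one without diagonal. Where the
   pivots are not all positive, both densities vanish and the values of [QJ] and [Qneq] do not
   matter. *)
have QE beta : pivS (enum I) beta W -> Qneq beta A =
    QJ beta ((@rmloops R _ (exist (fun x => x \in J) rho hrho)) @^-1` A).
  move=> ps; have pd : posdef (subM I (Hb W beta)) by apply/posdef_subMP.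
  have loopE : is_vrjp_law (loopless (@WJ R V W I J beta)) (Qneq beta) by exact: hQneq.
  have nn u u' : 0 <= @WJ R V W I J beta u u'.
    rewrite WJ_elimS //; first exact: elimS_ge0.
    by move=> v vJ; rewrite JI vJ.
  exact: (rmloops_law nn (hQJ _ pd) loopE mA).
have -> : (fun beta : V -> R => ((nu_dens W beta)%:E * Qneq beta A)%E) =
    (fun beta => ((nu_dens W beta)%:E * QJ beta ((@rmloops R _ _) @^-1` A))%E).
  apply/funext => beta; case: (boolP (pivS (enum I) beta W)) => ps; first by rewrite QE.
  by rewrite (nu_dens_pivS Wsym JI) (negbTE ps) mulr0 !mul0e.
have -> : (fun b => ((nu_dens (@What R V W I J rho) b)%:E * Qneq (@extb R V I rho b) A)%E) =
    (fun b => ((nu_dens (@What R V W I J rho) b)%:E *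
      QJ (@extb R V I rho b) ((@rmloops R _ _) @^-1` A))%E).
  apply/funext => b; case: (boolP (pivS (enum I) (extb b) W)) => ps; first by rewrite QE.
  by rewrite (nu_dens_What_pivS Wsym JI hrho) (negbTE ps) mulr0 !mul0e.
exact: key.
Qed.
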